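(* Assume the setting and standing assumptions of the context (smoothness, bounded variance and Lipschitz continuity of $\mathbf{F}$; boundedness of $\mathrm{dom}(\psi)$ by $M_\psi$), and suppose that $\psi$ is $\mu_\psi$-strongly convex with $\mu_\psi=1$. Let $c_0>0$, $c_1>0$, and let $P$, $Q$, $L_{\Phi_0}$ be the constants of the context. Given a mini-batch size $b$ with $0<b\le \hat b_0(T+1)$, let $b_0:=c_0\hat b_0$, $\hat b_1=\hat b_2:=b$ and $b_1=b_2:=c_0b$. Let $\{x_t\}_{t=0}^T$ be generated by the algorithm of the context using, for all $t$, $$\gamma_t:=0,\quad \beta_t=\hat\beta_t:=1-\frac{b^{1/2}}{[\hat b_0(T+1)]^{1/2}},\quad \theta_t=\theta:=\frac{L_{\Phi_0}b^{3/4}}{P[\hat b_0(T+1)]^{1/4}},\quad \eta_t=\eta:=\frac{2}{L_{\Phi_0}(3+\theta)},$$ provided that $\frac{\hat b_0(T+1)}{b^3}>\frac{L_{\Phi_0}^4}{P^4}$. Let $\hat b_0:=c_1^2[b(T+1)]^{1/3}$. Then the output $\bar x_T$ satisfies $$\mathbb{E}\big[\|\mathcal{G}_\eta(\bar x_T)\|^2\big]\le\frac{\Delta_0}{[b(T+1)]^{2/3}},\qquad \Delta_0:=16P\sqrt{c_1}\,[\Psi_0(x_0)-\Psi_0^\star]+\frac{24Q}{c_1}.$$ For a given tolerance $\varepsilon>0$, the total number of iterations $T$ to obtain $\mathbb{E}[\|\mathcal{G}_\eta(\bar x_T)\|^2]\le\varepsilon^2$ is at most $T:=\big\lfloor\frac{\Delta_0^{3/2}}{b\varepsilon^3}\big\rfloor$.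 The total numbers of evaluations of $\mathbf{F}(x_t,\xi)$ and of its Jacobian $\mathbf{F}'(x_t,\xi)$ are at most $$\mathcal{T}_F:=\Big\lfloor\frac{c_0c_1^2\Delta_0^{1/2}}{\varepsilon}+\frac{3c_0\Delta_0^{3/2}}{\varepsilon^3}\Big\rfloor\quad\text{and}\quad \mathcal{T}_J:=\Big\lfloor\frac{c_1^2\Delta_0^{1/2}}{\varepsilon}+\frac{3\Delta_0^{3/2}}{\varepsilon^3}\Big\rfloor,$$ respectively.
   Context: Problem. $\mathbf{F}:\mathbb{R}^p\times\Omega\to\mathbb{R}^q$ is a stochastic vector function on a probability space $(\Omega,\mathbb{P})$, $F(x):=\mathbb{E}_\xi[\mathbf{F}(x,\xi)]$, with Jacobians $\mathbf{F}'(x,\xi)$ and $F'(x)=\mathbb{E}_\xi[\mathbf{F}'(x,\xi)]$; $K\in\mathbb{R}^{q\times n}$; $\psi:\mathbb{R}^n\to\mathbb{R}\cup\{+\infty\}$ and $\mathcal{R}:\mathbb{R}^p\to\mathbb{R}\cup\{+\infty\}$ are proper, closed, convex. The minimax problem is $\min_x\max_y\{\mathcal{R}(x)+\mathbb{E}_\xi[\langle Ky,\mathbf{F}(x,\xi)\rangle]-\psi(y)\}$, equivalently $\min_x\Psi_0(x):=\phi_0(F(x))+\mathcal{R}(x)$ with $\phi_0(u):=\max_{y}\{\langle K^\top u,y\rangle-\psi(y)\}$. It is assumed that $\Psi_0^\star:=\inf_x\Psi_0(x)>-\infty$. Norms are Euclidean (spectral norm for $K$, Frobenius norm for Jacobians).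 Assumptions. There are constants $L_F,\sigma_F,\sigma_J,M_F,M_\psi\in(0,+\infty)$ such that for all $x,y\in\mathrm{dom}(\Psi_0)$: $\mathbb{E}_\xi[\|\mathbf{F}'(x,\xi)-\mathbf{F}'(y,\xi)\|^2]\le L_F^2\|x-y\|^2$; $\mathbb{E}_\xi[\|\mathbf{F}(x,\xi)-F(x)\|^2]\le\sigma_F^2$; $\mathbb{E}_\xi[\|\mathbf{F}'(x,\xi)-F'(x)\|^2]\le\sigma_J^2$; $\mathbb{E}_\xi[\|\mathbf{F}'(x,\xi)\|^2]\le M_F^2$; and $\sup\{\|y\|:y\in\mathrm{dom}(\psi)\}\le M_\psi$. Functions. For strongly convex $\psi$, $y_0^*(u):=\arg\max_y\{\langle u,Ky\rangle-\psi(y)\}$ is unique; $\Phi_0(x):=\phi_0(F(x))$ is differentiable with $\nabla\Phi_0(x)=F'(x)^\top Ky_0^*(F(x))$. The gradient mapping is $\mathcal{G}_\eta(x):=\frac1\eta\big(x-\mathrm{prox}_{\eta\mathcal{R}}(x-\eta\nabla\Phi_0(x))\big)$. Algorithm (with $\gamma_t=0$). Start from $x_0\in\mathrm{dom}(\Psi_0)$. Set $\tilde F_0:=\frac1{b_0}\sum_{\xi_i\in\mathcal{B}^0}\mathbf{F}(x_0,\xi_i)$, $\tilde J_0:=\frac1{\hat b_0}\sum_{\hat\xi_i\in\hat{\mathcal{B}}^0}\mathbf{F}'(x_0,\hat\xi_i)$. For $t\ge1$, $\tilde F_t:=\beta_{t-1}\tilde F_{t-1}+\frac{\beta_{t-1}}{b_1}\sum_{\xi_i\in\mathcal{B}_t^1}[\mathbf{F}(x_t,\xi_i)-\mathbf{F}(x_{t-1},\xi_i)]+\frac{1-\beta_{t-1}}{b_2}\sum_{\zeta_i\in\mathcal{B}_t^2}\mathbf{F}(x_t,\zeta_i)$,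 $\tilde J_t:=\hat\beta_{t-1}\tilde J_{t-1}+\frac{\hat\beta_{t-1}}{\hat b_1}\sum_{\hat\xi_i\in\hat{\mathcal{B}}_t^1}[\mathbf{F}'(x_t,\hat\xi_i)-\mathbf{F}'(x_{t-1},\hat\xi_i)]+\frac{1-\hat\beta_{t-1}}{\hat b_2}\sum_{\hat\zeta_i\in\hat{\mathcal{B}}_t^2}\mathbf{F}'(x_t,\hat\zeta_i)$. For $t=0,1,\dots,T$: $v_t:=\tilde J_t^\top Ky_0^*(\tilde F_t)$, $\hat x_{t+1}:=\mathrm{prox}_{\eta_t\mathcal{R}}(x_t-\eta_tv_t)$, $x_{t+1}:=(1-\theta_t)x_t+\theta_t\hat x_{t+1}$. The mini-batches $\mathcal{B}^0,\hat{\mathcal{B}}^0,\mathcal{B}_t^1,\hat{\mathcal{B}}_t^1,\mathcal{B}_t^2,\hat{\mathcal{B}}_t^2$ have sizes $b_0,\hat b_0,b_1,\hat b_1,b_2,\hat b_2$; each consists of i.i.d. copies of $\xi$ drawn independently of the past iterations; the mini-batches within one iteration may be correlated with each other. Output: $\bar x_T$ chosen at random from $\{x_0,\dots,x_T\}$ with probability of $x_t$ proportional to $\theta_t/L_{\Phi_{\gamma_t}}$ (uniform for constant parameters). Constants. $\kappa:=1$ if $\mathcal{B}_t^1$ is independent of $\mathcal{B}_t^2$ and $\kappa:=2$ otherwise; $\hat\kappa:=1$ if $\hat{\mathcal{B}}_t^1$ is independent of $\hat{\mathcal{B}}_t^2$ and $\hat\kappa:=2$ otherwise. For given $c_0>0$: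 $P:=\frac{\sqrt{26}\|K\|}{3\sqrt{c_0}}\sqrt{\kappa M_F^4\|K\|^2+c_0\hat\kappa L_F^2M_\psi^2}$, $Q:=\frac{26}{9c_0}\|K\|^2\big(\kappa M_F^2\|K\|^2\sigma_F^2+c_0\hat\kappa M_\psi^2\sigma_J^2\big)$, $L_{\Phi_0}:=L_FM_\psi\|K\|+M_F^2\|K\|^2$. Batch sizes and iteration numbers are integers; as in the paper, rounding to integers (and the difference between $T$ and $T+1$ in complexity counts) is ignored in the formulas.
   Formalization: The evaluation bounds T_F and T_J are proved as stated when T+1 ≤ Δ0^{3/2}/(bε³); for T equal to the floor of that number, where they can fail because the initial batch uses T+1, they are proved with c1²b^{1/3} (times c0 for F) added inside the floor. *)

(* Defs.v *)
From HB Require Import structures.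
From mathcomp Require Import all_boot all_order all_algebra.
From mathcomp Require Import all_classical all_reals all_analysis.

Set Implicit Arguments.
Unset Strict Implicit.
Unset Printing Implicit Defensive.

Import Order.TTheory GRing.Theory Num.Theory.
Import numFieldNormedType.Exports.

Local Open Scope classical_set_scope.
Local Open Scope ring_scope.

Section euclidean.
Context {R : realType}.

Definition dot n (u v : 'cV[R]_n) : R := \sum_(i < n) u i ord0 * v i ord0.

(* The norm that the library puts on matrices is the max norm. [frob] is the
   Frobenius norm, hence the Euclidean norm on column vectors. *)
Definition frob m n (A : 'M[R]_(m, n)) : R :=
  Num.sqrt (\sum_(i < m) \sum_(j < n) A i j ^+ 2).

Definition spectral_norm m n (A : 'M[R]_(m, n)) : R :=
  sup [set frob (A *m y) | y in [set y : 'cV[R]_n | frob y <= 1]].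

Definition Jac p q (f : 'cV[R]_p -> 'cV[R]_q) (x : 'cV[R]_p) : 'M[R]_(q, p) :=
  \matrix_(i < q, j < p)
    (('D_(delta_mx j ord0 : 'cV[R]_p) f x : 'cV[R]_q) i ord0).

Definition grad p (f : 'cV[R]_p -> R^o) (x : 'cV[R]_p) : 'cV[R]_p :=
  \col_(j < p) ('D_(delta_mx j ord0 : 'cV[R]_p) f x : R).

End euclidean.

Section convex_analysis.
Context {R : realType}.

Definition edom n (f : 'cV[R]_n -> \bar R) : set 'cV[R]_n :=
  [set x | (f x < +oo)%E].

Definition proper n (f : 'cV[R]_n -> \bar R) : Prop :=
  (forall x, (-oo < f x)%E) /\ edom f !=set0.

(* In the two definitions below the right-hand side is free of [oo - oo] because
   they are only used for functions that never take the value [-oo]. *)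
Definition strongly_convex_fun n (mu : R) (f : 'cV[R]_n -> \bar R) : Prop :=
  forall (x y : 'cV[R]_n) (t : R), 0 < t < 1 ->
    (f ((1 - t) *: x + t *: y)%R <=
      (1 - t)%:E * f x + t%:E * f y
        - (mu / 2 * t * (1 - t) * frob (x - y) ^+ 2)%:E)%E.

Definition convex_fun n (f : 'cV[R]_n -> \bar R) : Prop :=
  forall (x y : 'cV[R]_n) (t : R), 0 < t < 1 ->
    (f ((1 - t) *: x + t *: y)%R <= (1 - t)%:E * f x + t%:E * f y)%E.

Definition proper_closed_convex n (f : 'cV[R]_n -> \bar R) : Prop :=
  [/\ proper f, lower_semicontinuous f & convex_fun f].

Definition argmin n (f : 'cV[R]_n -> \bar R) : set 'cV[R]_n :=
  [set x | forall y, (f x <= f y)%E].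

Definition argmax n (f : 'cV[R]_n -> \bar R) : set 'cV[R]_n :=
  [set x | forall y, (f y <= f x)%E].

Definition prox n (eta : R) (f : 'cV[R]_n -> \bar R) (x : 'cV[R]_n) :
    'cV[R]_n :=
  get (argmin (fun z => (f z + (frob (z - x) ^+ 2 / (2 * eta))%:E)%E)).

End convex_analysis.

Section probability.
Context {R : realType}.

Definition Emx d (Xi : measurableType d) (D : probability Xi R) m n
    (X : Xi -> 'M[R]_(m, n)) : 'M[R]_(m, n) :=
  \matrix_(i < m, j < n) fine ('E_D[fun xi => X xi i j])%E.

Definition integrable_mx d (Xi : measurableType d) (D : probability Xi R) m n
    (X : Xi -> 'M[R]_(m, n)) : Prop :=
  forall i j, D.-integrable [set: Xi] (fun xi => (X xi i j)%:E).

Context d d' (Xi : measurableType d) (Om : measurableType d').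

(* The sigma-algebra on [Om] generated by a set of random elements of [Xi]. *)
Definition sigma_of (S : set (Om -> Xi)) : set_system Om :=
  <<s [set A | exists2 X, S X & exists2 B, measurable B & A = X @^-1` B] >>.

Definition indep_systems (Pr : probability Om R) (G H : set_system Om) : Prop :=
  forall A B, G A -> H B -> (Pr (A `&` B) = Pr A * Pr B)%E.

(* Taking [A i = setT] for some of the indices gives the product rule for the
   subfamilies. *)
Definition mutually_independent (Pr : probability Om R) m
    (X : 'I_m -> Om -> Xi) : Prop :=
  forall A : 'I_m -> set Xi, (forall i, measurable (A i)) ->
    (Pr (\bigcap_(i in [set: 'I_m]) (X i @^-1` A i)) =
       \prod_(i < m) Pr (X i @^-1` A i))%E.

Definition iid_copies (Pr : probability Om R) (D : probability Xi R) m
    (X : 'I_m -> Om -> Xi) : Prop :=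
  [/\ forall i, measurable_fun [set: Om] (X i),
      forall i A, measurable A -> Pr (X i @^-1` A) = D A
    & mutually_independent Pr X].

End probability.

Section problem.
Context {R : realType} d (Xi : measurableType d) (D : probability Xi R).
Context (p q n : nat) (F : 'cV[R]_p -> Xi -> 'cV[R]_q) (K : 'M[R]_(q, n)).
Context (psi : 'cV[R]_n -> \bar R) (Reg : 'cV[R]_p -> \bar R).

Definition JF (x : 'cV[R]_p) (xi : Xi) : 'M[R]_(q, p) := Jac (F^~ xi) x.

Definition meanF (x : 'cV[R]_p) : 'cV[R]_q := Emx D (F x).

Definition phi0 (u : 'cV[R]_q) : \bar R :=
  ereal_sup (range (fun y => ((dot (K^T *m u) y)%:E - psi y)%E)).

Definition Psi0 (x : 'cV[R]_p) : \bar R := (phi0 (meanF x) + Reg x)%E.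

Definition Psi0_star : \bar R := ereal_inf (range Psi0).

Definition y0star (u : 'cV[R]_q) : 'cV[R]_n :=
  get (argmax (fun y => ((dot u (K *m y))%:E - psi y)%E)).

Definition Phi0 (x : 'cV[R]_p) : R := fine (phi0 (meanF x)).

Definition grad_mapping (eta : R) (x : 'cV[R]_p) : 'cV[R]_p :=
  eta^-1 *: (x - prox eta Reg (x - eta *: grad Phi0 x)).

(* [F] and its Jacobian are stochastic functions with finite means, [F(., xi)]
   and the mean are differentiable, and the Jacobian of the mean is the mean of
   the Jacobians. *)
Record stochastic_smooth_map : Prop := {
  F_integrable : forall x, integrable_mx D (F x);
  JF_integrable : forall x, integrable_mx D (JF x);
  F_differentiable : forall x xi, differentiable (F^~ xi) x;
  meanF_differentiable : forall x, differentiable meanF x;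
  Jac_meanF : forall x, Jac meanF x = Emx D (JF x) }.

Record regularity (LF sigmaF sigmaJ MF Mpsi : R) : Prop := {
  constants_gt0 : [/\ 0 < LF, 0 < sigmaF, 0 < sigmaJ, 0 < MF & 0 < Mpsi];
  average_smooth : forall x y, edom Psi0 x -> edom Psi0 y ->
    ('E_D[fun xi => (frob (JF x xi - JF y xi) ^+ 2)%R]
       <= (LF ^+ 2 * frob (x - y) ^+ 2)%:E)%E;
  variance_F : forall x, edom Psi0 x ->
    ('E_D[fun xi => (frob (F x xi - meanF x) ^+ 2)%R] <= (sigmaF ^+ 2)%:E)%E;
  variance_J : forall x, edom Psi0 x ->
    ('E_D[fun xi => (frob (JF x xi - Jac meanF x) ^+ 2)%R] <= (sigmaJ ^+ 2)%:E)%E;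
  second_moment_J : forall x, edom Psi0 x ->
    ('E_D[fun xi => (frob (JF x xi) ^+ 2)%R] <= (MF ^+ 2)%:E)%E;
  bounded_dom_psi : forall y, edom psi y -> frob y <= Mpsi }.

End problem.

(* [bat0], [bat1 t], [bat2 t] feed the estimator of [F]; the [hbat]s feed the
   estimator of its Jacobian. [bat1 t], ..., [hbat2 t] are used for [t >= 1]. *)
Record minibatches (Om Xi : Type) (b0 hb0 b1 hb1 b2 hb2 : nat) := Minibatches {
  bat0 : 'I_b0 -> Om -> Xi;
  hbat0 : 'I_hb0 -> Om -> Xi;
  bat1 : nat -> 'I_b1 -> Om -> Xi;
  hbat1 : nat -> 'I_hb1 -> Om -> Xi;
  bat2 : nat -> 'I_b2 -> Om -> Xi;
  hbat2 : nat -> 'I_hb2 -> Om -> Xi }.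

Section algorithm.
Context {R : realType} d d' (Xi : measurableType d) (Om : measurableType d').
Context (D : probability Xi R) (Pr : probability Om R).
Context (b0 hb0 b1 hb1 b2 hb2 : nat).
Context (S : minibatches Om Xi b0 hb0 b1 hb1 b2 hb2).

Definition draws (t : nat) : set (Om -> Xi) :=
  if t is 0%N then range (bat0 S) `|` range (hbat0 S)
  else range (bat1 S t) `|` range (hbat1 S t)
         `|` range (bat2 S t) `|` range (hbat2 S t).

Definition draws_before (t : nat) : set (Om -> Xi) :=
  \bigcup_(s in [set s | (s < t)%N]) draws s.

(* Nothing is assumed on the joint law of the mini-batches of one iteration. *)
Record sampling_scheme (T : nat) : Prop := {
  iid_bat0 : iid_copies Pr D (bat0 S);
  iid_hbat0 : iid_copies Pr D (hbat0 S);
  iid_bat1 : forall t, (1 <= t <= T)%N -> iid_copies Pr D (bat1 S t);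
  iid_hbat1 : forall t, (1 <= t <= T)%N -> iid_copies Pr D (hbat1 S t);
  iid_bat2 : forall t, (1 <= t <= T)%N -> iid_copies Pr D (bat2 S t);
  iid_hbat2 : forall t, (1 <= t <= T)%N -> iid_copies Pr D (hbat2 S t);
  indep_past : forall t, (1 <= t <= T)%N ->
    indep_systems Pr (sigma_of (draws t)) (sigma_of (draws_before t)) }.

Definition kappa (T : nat) : R :=
  if `[< forall t, (1 <= t <= T)%N ->
         indep_systems Pr (sigma_of (range (bat1 S t)))
                          (sigma_of (range (bat2 S t))) >] then 1 else 2.

Definition hkappa (T : nat) : R :=
  if `[< forall t, (1 <= t <= T)%N ->
         indep_systems Pr (sigma_of (range (hbat1 S t)))
                          (sigma_of (range (hbat2 S t))) >] then 1 else 2.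

Context (p q n : nat) (F : 'cV[R]_p -> Xi -> 'cV[R]_q) (K : 'M[R]_(q, n)).
Context (psi : 'cV[R]_n -> \bar R) (Reg : 'cV[R]_p -> \bar R).

Record generated_by_algorithm (T : nat) (x0 : 'cV[R]_p)
    (beta hbeta theta eta : nat -> R)
    (x : nat -> Om -> 'cV[R]_p) (Ft : nat -> Om -> 'cV[R]_q)
    (Jt : nat -> Om -> 'M[R]_(q, p)) : Prop := {
  x_init : forall w, x 0 w = x0;
  Ft_init : forall w, Ft 0 w = b0%:R^-1 *: \sum_(i < b0) F (x 0 w) (bat0 S i w);
  Jt_init : forall w,
    Jt 0 w = hb0%:R^-1 *: \sum_(i < hb0) JF F (x 0 w) (hbat0 S i w);
  Ft_step : forall t w, (1 <= t <= T)%N ->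
    Ft t w = beta t.-1 *: Ft t.-1 w
      + (beta t.-1 / b1%:R) *: \sum_(i < b1)
          (F (x t w) (bat1 S t i w) - F (x t.-1 w) (bat1 S t i w))
      + ((1 - beta t.-1) / b2%:R) *: \sum_(i < b2) F (x t w) (bat2 S t i w);
  Jt_step : forall t w, (1 <= t <= T)%N ->
    Jt t w = hbeta t.-1 *: Jt t.-1 w
      + (hbeta t.-1 / hb1%:R) *: \sum_(i < hb1)
          (JF F (x t w) (hbat1 S t i w) - JF F (x t.-1 w) (hbat1 S t i w))
      + ((1 - hbeta t.-1) / hb2%:R) *: \sum_(i < hb2)
          JF F (x t w) (hbat2 S t i w);
  x_step : forall t w, (t <= T)%N ->
    let v := (Jt t w)^T *m (K *m y0star K psi (Ft t w)) in
    let hx := prox (eta t) Reg (x t w - eta t *: v) in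
    x t.+1 w = (1 - theta t) *: x t w + theta t *: hx }.

(* [tau] is the index of the output iterate; it is drawn uniformly from
   {0, ..., T}, independently of the samples that produced the iterates. *)
Definition uniform_output_index (T : nat) (tau : Om -> nat) : Prop :=
  [/\ measurable_fun [set: Om] tau,
      forall w, (tau w <= T)%N,
      forall t, (t <= T)%N -> Pr (tau @^-1` [set t]) = (T.+1%:R^-1)%:E
    & indep_systems Pr [set tau @^-1` A | A in [set: set nat]]
                       (sigma_of (draws_before T.+1))].

End algorithm.

(* Evaluations made by the initial batch of size [m0] and by iterations
   1, ..., T: each sample of the batch of size [m1] is used at both [x_t] and
   [x_(t-1)], each sample of the batch of size [m2] at [x_t] only. *)
Definition evaluations (m0 m1 m2 T : nat) : nat :=
  (m0 + \sum_(1 <= t < T.+1) (2 * m1 + m2))%N.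

Section constants.
Context {R : realType}.

Definition const_P (normK c0 kap hkap LF MF Mpsi : R) : R :=
  Num.sqrt 26 * normK / (3 * Num.sqrt c0)
    * Num.sqrt (kap * MF ^+ 4 * normK ^+ 2 + c0 * hkap * LF ^+ 2 * Mpsi ^+ 2).

Definition const_Q (normK c0 kap hkap sigmaF sigmaJ MF Mpsi : R) : R :=
  26 / (9 * c0) * normK ^+ 2
    * (kap * MF ^+ 2 * normK ^+ 2 * sigmaF ^+ 2
       + c0 * hkap * Mpsi ^+ 2 * sigmaJ ^+ 2).

Definition const_L (normK LF MF Mpsi : R) : R :=
  LF * Mpsi * normK + MF ^+ 2 * normK ^+ 2.

End constants.

(* Main.v *)
Require Import Defs.
From HB Require Import structures.
From mathcomp Require Import all_boot all_order all_algebra.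
From mathcomp Require Import all_classical all_reals all_analysis.
From mathcomp Require Import measurable_realfun ring lra.

Set Implicit Arguments.
Unset Strict Implicit.
Unset Printing Implicit Defensive.

Import Order.TTheory GRing.Theory Num.Theory.
Import numFieldNormedType.Exports.

Local Open Scope classical_set_scope.
Local Open Scope ring_scope.

(** Write [s] for the spectral norm of [K], [L] for the constant [const_L],
    [e_t] for the distance between the search direction and the gradient of
    [Phi0] at [x_t], and [r_t] for the length of the proximal step at [x_t].
    The proof combines a deterministic and a probabilistic inequality, each of
    which bounds one of these two quantities by the other.

    Deterministic part. Since [psi] is strongly convex, its maximizer [y0star]
    is [s]-Lipschitz, so [phi0] is smooth by Danskin's argument
    ([phi0_sandwich]) and [Phi0] has the [L]-Lipschitz gradient [gradPhi]. A
    proximal step along an inexact gradient then decreases the objective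
    ([descent_step]):
      [theta / (16 L) |G(x_t)|^2 + (L theta / 2) r_t^2
         <= Psi0 x_t - Psi0 x_(t+1) + (5 theta / (8 L)) e_t^2].

    Probabilistic part. The error of a hybrid estimator at [t + 1] is [beta]
    times its error at [t] plus two mini-batch averages of functions that are
    centered given the past. These averages are orthogonal to everything
    determined by the past, and the samples of one batch are orthogonal to each
    other, so the mean squares add up ([hybrid_estimator_step],
    [estimator_step]); the factor [kappa = 2] pays for a possible correlation
    between the two batches. With [W_t] the weighted mean square error of both
    estimators, which dominates the mean of [e_t^2], this reads
      [W_(t+1) <= beta^2 W_t + (9/13) (P^2 theta^2 / b) E r_t^2
                   + (1 - beta)^2 (9/13) Q / b].

    Summation. As [beta^2 <= beta], summing the recursion bounds
    [(1 - beta) (W_0 + ... + W_T)]; see [averaged_recursion]. The schedule makes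
    [P^2 theta^2 = L^2 b (1 - beta)], hence the steps [r_t] that appear in this
    bound are absorbed by the term [(L theta / 2) r_t^2] of the descent
    inequality, with room to spare since [45/104 < 1/2]. What remains is the
    rate, with [16] in front of the initial gap and [180/13 < 24] in front of
    [Q] ([mean_gradient_bound]). Averaging over the output index, which is
    independent of the samples, turns the mean over [t] into the expectation at
    the output ([output_expectation]). If [K = 0], all step sizes degenerate to
    [0] and the gradient mapping vanishes. The complexity claims follow from the
    rate by comparing cubes.

    Two points need more than this outline. First, no moment of the iterates is
    assumed to be finite; the objective inequality summed along a trajectory
    bounds [r_t^2] by the errors up to time [t], and induction gives finiteness
    ([errors_finite]). Secondly, the Lipschitz constant [MF] of [F] in mean
    square must be derived from second moments of the Jacobian at each single
    point, although [F(., xi)] is merely differentiable: along a segment its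
    derivative need not be integrable. [increment_sqr_le] shows that
    [(f 1 - f 0)^2] is at most the integral of [f'^2] for every function that
    is differentiable everywhere, whether or not that integral is finite; it is
    followed by an exchange of integrals. *)

(** * Euclidean and spectral norms *)

Section euclidean_norms.
Context {R : realType}.

Lemma sqr_frob m n (A : 'M[R]_(m, n)) : frob A ^+ 2 = \sum_i \sum_j A i j ^+ 2.
Proof.
rewrite /frob sqr_sqrtr// sumr_ge0// => i _; apply: sumr_ge0 => j _.
exact: sqr_ge0.
Qed.

Lemma frob_ge0 m n (A : 'M[R]_(m, n)) : 0 <= frob A.
Proof. exact: sqrtr_ge0. Qed.

Lemma frobZ m n a (A : 'M[R]_(m, n)) : frob (a *: A) = `|a| * frob A.
Proof.
apply/eqP; rewrite -(eqrXn2 (n := 2))// ?mulr_ge0 ?frob_ge0//.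
rewrite exprMn !sqr_frob mulr_sumr; apply/eqP; apply: eq_bigr => i _.
rewrite mulr_sumr; apply: eq_bigr => j _.
by rewrite mxE exprMn real_normK ?num_real.
Qed.

Lemma frobN m n (A : 'M[R]_(m, n)) : frob (- A) = frob A.
Proof. by rewrite -scaleN1r frobZ normrN1 mul1r. Qed.

Lemma frobBC m n (A B : 'M[R]_(m, n)) : frob (A - B) = frob (B - A).
Proof. by rewrite -frobN opprB. Qed.

Lemma frob0 m n : frob (0 : 'M[R]_(m, n)) = 0.
Proof. by rewrite -[X in frob X](scale0r (0 : 'M[R]_(m, n))) frobZ normr0 mul0r. Qed.

Lemma frob_tr m n (A : 'M[R]_(m, n)) : frob A^T = frob A.
Proof.
rewrite /frob exchange_big; congr (Num.sqrt _).
by apply: eq_bigr => i _; apply: eq_bigr => j _; rewrite mxE.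
Qed.

Lemma cauchy_schwarz_sum (I : finType) (a b : I -> R) :
  (\sum_i a i * b i) ^+ 2 <= (\sum_i a i ^+ 2) * (\sum_i b i ^+ 2).
Proof.
set A := \sum_i a i ^+ 2; set B := \sum_i b i ^+ 2; set C := \sum_i a i * b i.
have B0 : 0 <= B by apply: sumr_ge0 => i _; exact: sqr_ge0.
have [Bp|] := ltP 0 B; last first.
  rewrite le_eqVlt ltNge B0 orbF => /eqP B00.
  have b0 i : b i = 0.
    apply/eqP; rewrite -sqrf_eq0; move/eqP: B00; rewrite psumr_eq0; last by move=> j _; exact: sqr_ge0.
    by move=> /allP/(_ i); rewrite mem_index_enum => /(_ isT).
  by rewrite /C big1 ?expr0n/= ?B00 ?mulr0// => i _; rewrite b0 mulr0.
have : 0 <= \sum_i (B * a i - C * b i) ^+ 2 by apply: sumr_ge0 => i _; exact: sqr_ge0.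
have -> : \sum_i (B * a i - C * b i) ^+ 2 = B * (A * B - C ^+ 2).
  under eq_bigr => i _ do (rewrite (_ : _ ^+ 2 = B ^+ 2 * a i ^+ 2 - 2 * B * C * (a i * b i) + C ^+ 2 * b i ^+ 2); last by ring).
  by rewrite big_split/= big_split/= sumrN -!mulr_sumr -/A -/B -/C; ring.
by rewrite pmulr_rge0// subr_ge0.
Qed.

Lemma sqr_frobE m n (A : 'M[R]_(m, n)) :
  frob A ^+ 2 = \sum_(p : 'I_m * 'I_n) A p.1 p.2 ^+ 2.
Proof. by rewrite sqr_frob pair_big. Qed.

Lemma frobD m n (A B : 'M[R]_(m, n)) : frob (A + B) <= frob A + frob B.
Proof.
rewrite -(ler_sqr (frob_ge0 _)) ?nnegrE ?addr_ge0 ?frob_ge0//.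
have CS := cauchy_schwarz_sum (fun p : 'I_m * 'I_n => A p.1 p.2) (fun p => B p.1 p.2).
have CS' : \sum_(p : 'I_m * 'I_n) A p.1 p.2 * B p.1 p.2 <= frob A * frob B.
  apply: le_trans (ler_norm _) _.
  rewrite -(ler_sqr (normr_ge0 _)) ?nnegrE ?mulr_ge0 ?frob_ge0//.
  by rewrite real_normK ?num_real// exprMn !sqr_frobE.
rewrite sqrrD !sqr_frobE.
under eq_bigr => p _ do rewrite mxE sqrrD.
by rewrite big_split/= big_split/= lerD2r lerD2l sumrMnl lerMn2r.
Qed.

Lemma frobB_le m n (A B C : 'M[R]_(m, n)) : frob (A - C) <= frob (A - B) + frob (B - C).
Proof. by apply: le_trans (frobD _ _); rewrite addrA subrK. Qed.

Lemma frob_mulmx m n (A : 'M[R]_(m, n)) (v : 'cV[R]_n) : frob (A *m v) <= frob A * frob v.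
Proof.
rewrite -(ler_sqr (frob_ge0 _)) ?nnegrE ?mulr_ge0 ?frob_ge0//.
rewrite exprMn !sqr_frob mulr_suml; apply: ler_sum => i _.
rewrite big_ord1 mxE.
under [X in _ <= _ * X]eq_bigr => j _ do rewrite big_ord1.
exact: (cauchy_schwarz_sum (fun j => A i j) (fun j => v j ord0)).
Qed.

Lemma entry_le_frob m n (A : 'M[R]_(m, n)) i j : `|A i j| <= frob A.
Proof.
rewrite -(ler_sqr (normr_ge0 _)) ?nnegrE ?frob_ge0// real_normK ?num_real//.
rewrite sqr_frobE (bigD1 (i, j))//= lerDl; apply: sumr_ge0 => p _; exact: sqr_ge0.
Qed.

Lemma frob_eq0 m n (A : 'M[R]_(m, n)) : frob A = 0 -> A = 0.
Proof.
move=> A0; apply/matrixP => i j; rewrite mxE; apply/eqP.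
by rewrite -normr_le0 -A0 entry_le_frob.
Qed.

Lemma frob_le_norm m n (A : 'M[R]_(m, n)) : frob A <= (m * n)%:R * `|A|.
Proof.
have le (p : 'I_m * 'I_n) : `|A p.1 p.2| <= `|A|.
  by rewrite [leRHS]mx_normrE; apply: (le_bigmax _ (fun p => `|A p.1 p.2|) p).
rewrite -(ler_sqr (frob_ge0 _)) ?nnegrE ?mulr_ge0// exprMn sqr_frobE.
apply: (@le_trans _ _ (\sum_(p : 'I_m * 'I_n) `|A| ^+ 2)).
  apply: ler_sum => p _; rewrite -[leLHS]real_normK ?num_real//.
  by rewrite ler_sqr ?nnegrE.
rewrite sumr_const card_prod !card_ord.
rewrite -[leLHS]mulr_natl; apply: ler_wpM2r; first exact: sqr_ge0.
rewrite -natrX ler_nat; case: (m * n)%N => // k; by rewrite expnS leq_pmulr// expn_gt0.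
Qed.

Lemma norm_le_frob m n (A : 'M[R]_(m, n)) : `|A| <= frob A.
Proof.
rewrite [leLHS]mx_normrE; apply: bigmax_le => [|p _]; first exact: frob_ge0.
exact: entry_le_frob.
Qed.

Lemma dotC n (u v : 'cV[R]_n) : dot u v = dot v u.
Proof. by apply: eq_bigr => i _; rewrite mulrC. Qed.

Lemma dotDl n (u v w : 'cV[R]_n) : dot (u + v) w = dot u w + dot v w.
Proof. by rewrite -big_split; apply: eq_bigr => i _; rewrite mxE mulrDl. Qed.

Lemma dotZl n a (u v : 'cV[R]_n) : dot (a *: u) v = a * dot u v.
Proof. by rewrite /dot mulr_sumr; apply: eq_bigr => i _; rewrite mxE mulrA. Qed.

Lemma dotNl n (u v : 'cV[R]_n) : dot (- u) v = - dot u v.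
Proof. by rewrite -scaleN1r dotZl mulN1r. Qed.

Lemma dotBl n (u v w : 'cV[R]_n) : dot (u - v) w = dot u w - dot v w.
Proof. by rewrite dotDl dotNl. Qed.

Lemma dotDr n (u v w : 'cV[R]_n) : dot w (u + v) = dot w u + dot w v.
Proof. by rewrite dotC dotDl !(dotC w). Qed.

Lemma dotZr n a (u v : 'cV[R]_n) : dot u (a *: v) = a * dot u v.
Proof. by rewrite dotC dotZl dotC. Qed.

Lemma dotNr n (u v : 'cV[R]_n) : dot u (- v) = - dot u v.
Proof. by rewrite dotC dotNl dotC. Qed.

Lemma dotBr n (u v w : 'cV[R]_n) : dot w (u - v) = dot w u - dot w v.
Proof. by rewrite dotDr dotNr. Qed.

Lemma dotvv n (u : 'cV[R]_n) : dot u u = frob u ^+ 2.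
Proof. by rewrite sqr_frob; apply: eq_bigr => i _; rewrite big_ord1 expr2. Qed.

Lemma sqr_frobD n (u v : 'cV[R]_n) :
  frob (u + v) ^+ 2 = frob u ^+ 2 + 2 * dot u v + frob v ^+ 2.
Proof. by rewrite -!dotvv dotDl !dotDr (dotC v u); ring. Qed.

Lemma sqr_frobB n (u v : 'cV[R]_n) :
  frob (u - v) ^+ 2 = frob u ^+ 2 - 2 * dot u v + frob v ^+ 2.
Proof. by rewrite sqr_frobD frobN dotNr mulrN. Qed.

Lemma cauchy_schwarz n (u v : 'cV[R]_n) : `|dot u v| <= frob u * frob v.
Proof.
rewrite -(ler_sqr (normr_ge0 _)) ?nnegrE ?mulr_ge0 ?frob_ge0//.
rewrite real_normK ?num_real// exprMn !sqr_frob.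
under [X in _ <= X * _]eq_bigr do rewrite big_ord1.
under [X in _ <= _ * X]eq_bigr do rewrite big_ord1.
exact: cauchy_schwarz_sum.
Qed.

Lemma dot_mulmx m n (A : 'M[R]_(m, n)) (u : 'cV[R]_m) (v : 'cV[R]_n) :
  dot (A^T *m u) v = dot u (A *m v).
Proof.
rewrite /dot; under eq_bigr do rewrite mxE mulr_suml.
rewrite exchange_big; apply: eq_bigr => i _ /=.
by rewrite mxE mulr_sumr; apply: eq_bigr => j _; rewrite mxE; ring.
Qed.

Let spectral_set m n (A : 'M[R]_(m, n)) := [set frob (A *m y) | y in [set y : 'cV[R]_n | frob y <= 1]].

Let spectral_sup m n (A : 'M[R]_(m, n)) : has_sup (spectral_set A).
Proof.
split; first by exists (frob (A *m (0 : 'cV[R]_n))); exists 0 => //=; rewrite frob0.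
exists (frob A) => _ [y /= y1 <-]; apply: le_trans (frob_mulmx _ _) _.
by rewrite ler_piMr// frob_ge0.
Qed.

Lemma spectral_norm_ge0 m n (A : 'M[R]_(m, n)) : 0 <= spectral_norm A.
Proof.
apply: (@le_trans _ _ (frob (A *m (0 : 'cV[R]_n)))); first exact: frob_ge0.
apply: ub_le_sup; first by have [] := spectral_sup A.
by exists 0 => //=; rewrite frob0.
Qed.

(** [spectral_norm] is a supremum over the unit ball, so this is homogeneity;
    for [y = 0] both sides vanish. *)
Lemma spectral_norm_mulmx m n (A : 'M[R]_(m, n)) (y : 'cV[R]_n) :
  frob (A *m y) <= spectral_norm A * frob y.
Proof.
have [y0|y0] := eqVneq (frob y) 0.
  by rewrite (frob_eq0 y0) mulmx0 !frob0 mulr0.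
have yp : 0 < frob y by rewrite lt_def y0 frob_ge0.
rewrite -ler_pdivrMr//; apply: ub_le_sup; first by have [] := spectral_sup A.
exists ((frob y)^-1 *: y); first by rewrite /= frobZ normfV ger0_norm ?frob_ge0// mulVf.
by rewrite -scalemxAr frobZ normfV ger0_norm ?frob_ge0// mulrC.
Qed.

End euclidean_norms.

Section minimization.
Context {R : realType}.

(** The library topology on matrices comes from the max norm; the two norms are
    equivalent in finite dimension. *)
Lemma frob_nbhs m n (x : 'M[R]_(m, n)) (e : R) : 0 < e -> \forall y \near x, frob (y - x) < e.
Proof.
move=> e0; apply/nbhs_normP.
have c0 : 0 < (m * n)%:R + 1 :> R by rewrite ltr_wpDl.
exists (e / ((m * n)%:R + 1)) => /=; first exact: divr_gt0.
move=> y; rewrite /ball_/= => xy; apply: (le_lt_trans (frob_le_norm _)).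
rewrite distrC in xy; rewrite ltr_pdivlMr// mulrC in xy; apply: le_lt_trans xy.
by apply: ler_wpM2r => //; rewrite lerDl.
Qed.

Lemma continuous_frobB m n (a : 'M[R]_(m, n)) : continuous (fun x : 'M[R]_(m, n) => frob (x - a)).
Proof.
move=> x; apply/(@cvgrPdist_lt _ _ _ (nbhs x) (nbhs_filter x)) => e e0; near=> y.
have yx : frob (y - x) < e by near: y; exact: frob_nbhs.
rewrite ltr_distlC; apply/andP; split.
  by have := frobB_le x y a; rewrite (frobBC x y); lra.
by have := frobB_le y x a; lra.
Unshelve. all: by end_near. Qed.

Lemma continuous_trmx m n : continuous (@trmx R m n).
Proof.
move=> z A [P HP PA]; exists (fun i j => P j i) => [i j|M HM] /=.
  by have := HP j i; rewrite mxE.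
by apply: PA => i j; rewrite mxE; exact: HM.
Qed.

(** Bounded closed sets are known to be compact for row vectors; transposition
    is a homeomorphism that preserves the Frobenius norm. *)
Lemma compact_ball n (x0 : 'cV[R]_n) (r : R) : compact [set x | frob (x - x0) <= r].
Proof.
have -> : [set x | frob (x - x0) <= r] =
    trmx @` [set z : 'rV[R]_n | frob (z - x0^T) <= r].
  apply/seteqP; split => [x /= xr|_ /= [z zr <-]].
    by exists x^T; rewrite ?trmxK//= -linearB/= frob_tr.
  by rewrite -[x0]trmxK -linearB/= frob_tr.
apply: continuous_compact.
  by apply: continuous_subspaceT; exact: continuous_trmx.
apply: bounded_closed_compact.
  exists (r + frob x0^T); split; first exact: num_real.
  move=> M MM z /= zr; apply: (le_trans (norm_le_frob _)).
  have := frobD (z - x0^T) x0^T; rewrite subrK => h.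
  by apply: (le_trans h); apply/ltW/(le_lt_trans _ MM); rewrite lerD2r.
apply: (@preimage_closed _ _ (fun z : 'rV[R]_n => frob (z - x0^T)) [set y | y <= r]).
  by move=> z _; exact: continuous_frobB.
exact: closed_le.
Qed.

(** Without a minimizer, the sublevel sets of [f] on [A] form a filter that
    clusters at some [x] of [A]. There is then a point of [A] whose value lies
    strictly below [f x], and lower semicontinuity separates a neighborhood of
    [x] from the corresponding sublevel set. *)
Lemma lsc_compact_argmin (T : topologicalType) (f : T -> \bar R) (A : set T) :
  lower_semicontinuous f -> compact A -> A !=set0 ->
  exists2 x, A x & forall y, A y -> (f x <= f y)%E.
Proof.
move=> lscf cA [a0 Aa0].
apply: contrapT => /forall2NP noargmin.
have H x : A x -> exists2 y, A y & (f y < f x)%E.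
  move=> Ax; have [//|] := noargmin x; move=> /existsNP[y /not_implyP[Ay /negP]].
  by rewrite -ltNge => yx; exists y.
pose F := filter_from A (fun y => [set x | A x /\ (f x <= f y)%E]).
have FF : ProperFilter F.
  apply: filter_from_proper; last by move=> y Ay; exists y.
  apply: filter_from_filter; first by exists a0.
  move=> y z Ay Az; have [yz|zy] := leP (f y) (f z).
    exists y => // x [Ax xy]; split; split => //; exact: le_trans yz.
  exists z => // x [Ax xy]; split; split => //; exact: (le_trans xy (ltW zy)).
have FA : F A by exists a0 => // x [].
have [x [Ax clx]] := cA F FF FA.
(* Two successive improvements: a real number must fit strictly between
   [f z] and [f x], also when one of the values is infinite. *)
have [y Ay yx] := H _ Ax.
have [z Az zy] := H _ Ay.
have [c zc cy] : exists2 c, (f z <= c%:E)%E & (c%:E < f x)%E.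
  have [fzN|fzr] : f z = -oo%E \/ f z \is a fin_num.
    move: zy; case: (f z) => [r _||_]; [by right| |by left].
    by rewrite ltNge leey.
  - move: (lt_trans zy yx); rewrite fzN; case: (f x) => [r _|_|//].
      by exists (r - 1); rewrite ?leNye// lte_fin ltrBlDl ltrDr.
    by exists 0; rewrite ?leNye ?ltry.
  - by exists (fine (f z)); rewrite fineK// (lt_trans zy yx).
have [V Vx Vc] := lscf _ _ cy.
have Fz : F [set x | A x /\ (f x <= f z)%E] by exists z.
have [w [[_ wz] Vw]] := clx _ _ Fz Vx.
by move: (lt_le_trans (Vc _ Vw) (le_trans wz zc)); rewrite ltxx.
Qed.

Section strongly_convex.
Context {n : nat} (f : 'cV[R]_n -> \bar R) (mu : R).
Hypotheses (mu0 : 0 < mu) (pf : Defs.proper f) (lscf : lower_semicontinuous f)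
  (scf : strongly_convex_fun mu f).

Lemma proper_fin_num x : edom f x -> f x \is a fin_num.
Proof. by move=> fx; rewrite fin_numE gt_eqF ?(pf.1 x)// lt_eqF. Qed.

Lemma strongly_convex_fin x y (t : R) : edom f x -> edom f y -> 0 < t < 1 ->
  edom f ((1 - t) *: x + t *: y) /\
  fine (f ((1 - t) *: x + t *: y)) <=
    (1 - t) * fine (f x) + t * fine (f y) - mu / 2 * t * (1 - t) * frob (x - y) ^+ 2.
Proof.
move=> fx fy t01; have := scf x y t01.
rewrite -(fineK (proper_fin_num fx)) -(fineK (proper_fin_num fy)) -!EFinM -EFinD.
move=> h; have d : edom f ((1 - t) *: x + t *: y) by apply: le_lt_trans h _; rewrite ltry.
by split => //; rewrite -lee_fin (fineK (proper_fin_num d)).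
Qed.

(** On the unit ball around a point [x0] of the domain, [f] is at least
    [f x1]. Strong convexity along the segment from [x0] to a point [z] outside
    the unit ball propagates this to a quadratic lower bound at [z], so points
    outside the ball of radius [r] cannot improve on [f x0], and a minimizer
    over that ball is global. *)
Lemma strongly_convex_argmin : argmin f !=set0.
Proof.
have [x0 x0d] := pf.2.
pose B r := [set x : 'cV[R]_n | frob (x - x0) <= r].
have Bx0 r : 0 <= r -> B r x0 by move=> r0; rewrite /B/= subrr frob0.
have B1 : B 1 !=set0 by exists x0; exact: Bx0.
have [x1 Bx1 min1] := lsc_compact_argmin lscf (@compact_ball n x0 1) B1.
have x1d : edom f x1 by apply: le_lt_trans (min1 _ (Bx0 _ ler01)) x0d.
pose r := 1 + 2 * (fine (f x0) - fine (f x1)) / mu.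
have m10 : fine (f x1) <= fine (f x0).
  by rewrite -lee_fin !fineK ?proper_fin_num// min1//; exact: Bx0.
have r1 : 1 <= r by rewrite lerDl divr_ge0 ?mulr_ge0 ?subr_ge0 ?(ltW mu0).
have r0 : 0 <= r by exact: le_trans ler01 r1.
have Br : B r !=set0 by exists x0; exact: Bx0.
have [x2 Bx2 min2] := lsc_compact_argmin lscf (@compact_ball n x0 r) Br.
exists x2 => z.
have [zr|rz] := leP (frob (z - x0)) r; first exact: min2.
apply: (le_trans (min2 _ (Bx0 _ r0))).
rewrite leNgt; apply/negP => zx0.
have zd : edom f z by exact: lt_trans zx0 x0d.
set s := frob (z - x0) in rz.
have s1 : 1 < s by exact: le_lt_trans r1 rz.
have s0 : 0 < s by exact: lt_trans ltr01 s1.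
(* The point at parameter [s^-1] is on the boundary of the unit ball. *)
have t01 : 0 < s^-1 < 1 by rewrite invr_gt0 s0 invf_lt1.
have [d le] := strongly_convex_fin x0d zd t01.
have Bt : B 1 ((1 - s^-1) *: x0 + s^-1 *: z).
  rewrite /B/=; have -> : (1 - s^-1) *: x0 + s^-1 *: z - x0 = s^-1 *: (z - x0).
    by apply/matrixP => i j; rewrite !mxE; ring.
  by rewrite frobZ gtr0_norm ?invr_gt0// mulVf// gt_eqF.
have := min1 _ Bt; rewrite -(fineK (proper_fin_num d)) -(fineK (proper_fin_num x1d)) lee_fin => h.
have zx0' : fine (f z) <= fine (f x0) by rewrite -lee_fin !fineK ?proper_fin_num// ltW.
have := le_trans h le; rewrite (frobBC x0 z) -/s.
have -> : mu / 2 * s^-1 * (1 - s^-1) * s ^+ 2 = mu / 2 * (s - 1) by field; rewrite gt_eqF.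
have sz : s^-1 * fine (f z) <= s^-1 * fine (f x0) by rewrite ler_pM2l// invr_gt0.
have : mu / 2 * (r - 1) < mu / 2 * (s - 1) by rewrite ltr_pM2l ?divr_gt0// ltrD2r.
have -> : mu / 2 * (r - 1) = fine (f x0) - fine (f x1) by rewrite /r; field; rewrite gt_eqF.
lra.
Qed.

(** Compare [f x] with the value at distance [t] on the way to [z], divide by
    [t], and let [t] tend to 0. *)
Lemma strongly_convex_argmin_le x z : argmin f x -> edom f z ->
  edom f x /\ fine (f x) + mu / 2 * frob (z - x) ^+ 2 <= fine (f z).
Proof.
move=> xmin zd; have xd : edom f x by apply: le_lt_trans (xmin z) zd.
split=> //; set N := frob _ ^+ 2; set c := mu / 2 * N.
have H t : 0 < t < 1 -> fine (f x) + (1 - t) * c <= fine (f z).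
  move=> t01; have [d le] := strongly_convex_fin xd zd t01.
  have := xmin ((1 - t) *: x + t *: z).
  rewrite -(fineK (proper_fin_num d)) -(fineK (proper_fin_num xd)) lee_fin => h.
  have := le_trans h le; rewrite (frobBC x z) -/N => h'.
  move/andP: t01 => [t0 _]; rewrite -(ler_pM2l t0) /c; lra.
have c0 : 0 <= c by rewrite mulr_ge0 ?sqr_ge0// divr_ge0// ltW.
rewrite -/c; apply/ler_addgt0Pr => e e0.
pose t := Num.min (2^-1) (e / (c + 1)).
have c1 : 0 < c + 1 by rewrite ltr_wpDl.
have t01 : 0 < t < 1.
  by rewrite lt_min invr_gt0 ltr0n divr_gt0//= gt_min invf_lt1 ?ltr1n.
have te : t * c <= e.
  apply: (@le_trans _ _ (e / (c + 1) * c)); first by rewrite ler_wpM2r// ge_min lexx orbT.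
  by rewrite mulrAC ler_pdivrMr// ler_wpM2l ?(ltW e0)// lerDl.
have := H _ t01; lra.
Qed.

End strongly_convex.
End minimization.

(** * Proximal points and the inner maximization *)

Section proximal.
Context {R : realType} {n : nat}.
Implicit Types f : 'cV[R]_n -> \bar R.

Lemma ltNy_addr (a : \bar R) (r : R) : (-oo < a -> -oo < a + r%:E)%E.
Proof. by case: a => [s||]//= _; rewrite -EFinD ltNyr. Qed.

(** Strong convexity only has to be tested on the domain, because outside it
    the right-hand side of the definition is [+oo]. *)
Lemma strongly_convex_funP mu f : (forall x, -oo < f x)%E ->
  (forall x y (t : R), edom f x -> edom f y -> 0 < t < 1 ->
    (f ((1 - t) *: x + t *: y)%R <= ((1 - t) * fine (f x) + t * fine (f y)
        - mu / 2 * t * (1 - t) * frob (x - y) ^+ 2)%:E)%E) ->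
  strongly_convex_fun mu f.
Proof.
move=> fN H x y t t01.
have [t0 t1] := andP t01.
have [xd|] := boolP (f x < +oo)%E; last first.
  rewrite ltey negbK => /eqP ->; rewrite gt0_muley ?lte_fin ?subr_gt0//.
  rewrite addye ?addye ?leey//.
  case: (f y) (fN y) => [r _||]//.
  by rewrite gt0_muley ?lte_fin.
have [yd|] := boolP (f y < +oo)%E; last first.
  rewrite ltey negbK => /eqP ->; rewrite gt0_muley ?lte_fin//.
  rewrite addey ?addye ?leey//.
  case: (f x) (fN x) xd => [r _||]//.
by have := H x y t xd yd t01; rewrite !EFinB EFinD !EFinM !fineK// fin_numE gt_eqF ?fN//= lt_eqF.
Qed.

Lemma edom_addr f (g : 'cV[R]_n -> R) x :
  edom (fun z => f z + (g z)%:E)%E x <-> edom f x.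
Proof.
rewrite /edom/=; case: (f x) => [r||]//=; split=> // _; exact: ltry.
Qed.

Lemma strongly_convex_funD mu nu f (g : 'cV[R]_n -> R) : Defs.proper f ->
  strongly_convex_fun mu f ->
  (forall x y (t : R), 0 < t < 1 -> g ((1 - t) *: x + t *: y) <=
     (1 - t) * g x + t * g y - nu / 2 * t * (1 - t) * frob (x - y) ^+ 2) ->
  strongly_convex_fun (mu + nu) (fun z => f z + (g z)%:E)%E.
Proof.
move=> pf scf gH; apply: strongly_convex_funP.
  by move=> x; apply: ltNy_addr; exact: pf.1.
move=> x y t /edom_addr xd /edom_addr yd t01.
have [d le] := strongly_convex_fin pf scf xd yd t01.
rewrite -(fineK (proper_fin_num pf d)) -(fineK (proper_fin_num pf xd)).
rewrite -(fineK (proper_fin_num pf yd)) -!EFinD/= lee_fin.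
apply: (le_trans (lerD le (gH x y t t01))); rewrite le_eqVlt; apply/orP; left; apply/eqP; ring.
Qed.

Lemma lower_semicontinuous_addr f (g : 'cV[R]_n -> R) : (forall x, -oo < f x)%E ->
  lower_semicontinuous f -> continuous g ->
  lower_semicontinuous (fun z => f z + (g z)%:E)%E.
Proof.
move=> fN lscf cg x a.
rewrite -lteBlDr// -EFinB => afx.
have [r ar rf] : exists2 r : R, a - g x < r & (r%:E < f x)%E.
  case: (f x) (fN x) afx => [y _|_ _|//].
    rewrite lte_fin => h; exists ((a - g x + y) / 2); rewrite ?lte_fin; lra.
  by exists (a - g x + 1); [rewrite ltrDl|exact: ltry].
have [V Vx Vr] := lscf _ _ rf.
have gn : \forall y \near x, `|g x - g y| < r - (a - g x).
  by apply: (@cvgr_dist_lt _ _ _ (nbhs x) (nbhs_filter x) _ (g x)); [exact: cg|rewrite subr_gt0].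
exists (V `&` [set y | `|g x - g y| < r - (a - g x)]); first exact: (@filterI _ _ (nbhs_filter x)).
move=> y [/Vr ry /= /ltr_normlP[_ gy]]; rewrite -lteBlDr// -EFinB.
by apply: lt_trans ry; rewrite lte_fin; lra.
Qed.

Lemma continuous_sqr_frobB (a : 'cV[R]_n) c : continuous (fun z : 'cV[R]_n => frob (z - a) ^+ 2 / c).
Proof.
move=> x; apply: (@cvgM _ _ (nbhs x) (nbhs_filter x)); last exact: cvg_cst.
apply: (@continuous_comp _ _ _ (fun z : 'cV[R]_n => frob (z - a)) (fun y : R => y ^+ 2)).
  exact: continuous_frobB.
exact: exprn_continuous.
Qed.

Lemma continuous_dot (a : 'cV[R]_n) : continuous (fun z : 'cV[R]_n => dot a z).
Proof.
move=> x; apply/(@cvgrPdist_lt _ _ _ (nbhs x) (nbhs_filter x)) => e e0.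
have a1 : 0 < frob a + 1 by rewrite ltr_wpDl ?frob_ge0.
have := @frob_nbhs _ _ _ x (e / (frob a + 1)); rewrite divr_gt0// => /(_ isT).
apply: (@filterS _ _ (nbhs_filter x)) => y yx; rewrite -dotBr.
apply: (le_lt_trans (cauchy_schwarz _ _)); rewrite frobBC.
rewrite ltr_pdivlMr// mulrC in yx; apply: le_lt_trans yx.
by rewrite ler_wpM2r ?frob_ge0// lerDl.
Qed.

Section prox.
Variables (f : 'cV[R]_n -> \bar R) (eta : R).
Hypotheses (eta0 : 0 < eta) (hf : proper_closed_convex f).

Let pf : Defs.proper f. Proof. by case: hf. Qed.

Lemma prox_argmin x :
  argmin (fun z => (f z + (frob (z - x) ^+ 2 / (2 * eta))%:E)%E) (prox eta f x) /\
  strongly_convex_fun eta^-1 (fun z => (f z + (frob (z - x) ^+ 2 / (2 * eta))%:E)%E).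
Proof.
have [_ lscf cf] := hf.
set g := fun z => _.
have scg : strongly_convex_fun eta^-1 g.
  rewrite -[eta^-1]add0r; apply: strongly_convex_funD => //.
    by move=> u v t t01; rewrite !mul0r sube0; exact: cf.
  move=> u v t _.
  have -> : (1 - t) *: u + t *: v - x = (1 - t) *: (u - x) + t *: (v - x).
    by apply/matrixP => i j; rewrite !mxE; ring.
  have -> : u - v = (u - x) - (v - x) by rewrite opprB addrA subrK.
  move: (u - x) (v - x) => a b.
  rewrite -!dotvv !(dotDl, dotDr, dotNl, dotNr, dotZl, dotZr) (dotC b a).
  by rewrite le_eqVlt; apply/orP; left; apply/eqP; field; rewrite gt_eqF.
split=> //; rewrite /prox -/g; apply: getPex; apply: (@strongly_convex_argmin _ _ g eta^-1).
- by rewrite invr_gt0.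
- split; first by move=> z; apply: ltNy_addr; exact: pf.1.
  by have [z zd] := pf.2; exists z; apply/edom_addr.
- by apply: lower_semicontinuous_addr => //; [exact: pf.1|exact: continuous_sqr_frobB].
- exact: scg.
Qed.

(** The proximal objective is [1 / eta]-strongly convex, so it grows
    quadratically away from its minimizer. *)
Lemma prox_three_point x z : edom f z -> edom f (prox eta f x) /\
  fine (f (prox eta f x)) + frob (prox eta f x - x) ^+ 2 / (2 * eta)
     + frob (z - prox eta f x) ^+ 2 / (2 * eta)
  <= fine (f z) + frob (z - x) ^+ 2 / (2 * eta).
Proof.
move=> zd; set p := prox _ _ _; set g := fun z => (f z + (frob (z - x) ^+ 2 / (2 * eta))%:E)%E.
have [pmin scg] := prox_argmin x.
have pg : Defs.proper g.
  split; first by move=> y; apply: ltNy_addr; exact: pf.1.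
  by exists z; apply/edom_addr.
have zg : edom g z by apply/edom_addr.
have [] := @strongly_convex_argmin_le _ _ g eta^-1 _ pg scg _ _ pmin zg.
  by rewrite invr_gt0.
rewrite -/p => /edom_addr pd le; split=> //; move: le.
rewrite /g -(fineK (proper_fin_num pf pd)) -(fineK (proper_fin_num pf zd)) -!EFinD/= => le.
have e : frob (z - p) ^+ 2 / (2 * eta) = eta^-1 / 2 * frob (z - p) ^+ 2.
  by field; rewrite gt_eqF.
by rewrite e.
Qed.

Lemma prox_edom x : edom f (prox eta f x).
Proof. by have [z zd] := pf.2; have [] := prox_three_point x zd. Qed.

Let three_points_sum (a b c d e g h i k : R) : 0 < k ->
  a + b / k + c / k <= d + e / k -> d + g / k + h / k <= a + i / k ->
  b + c + g + h <= e + i.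
Proof.
move=> k0 h1 h2; rewrite -(ler_pM2r (_ : 0 < k^-1)) ?invr_gt0// !mulrDl; lra.
Qed.

Let four_points (P Q x y : 'cV[R]_n) :
  frob (P - x) ^+ 2 + frob (Q - P) ^+ 2 + frob (Q - y) ^+ 2 + frob (P - Q) ^+ 2
    <= frob (Q - x) ^+ 2 + frob (P - y) ^+ 2 ->
  frob (P - Q) ^+ 2 <= dot (P - Q) (x - y).
Proof.
rewrite (frobBC Q P) !sqr_frobB !dotBl !dotBr -!dotvv.
move: (dot P P) (dot Q Q) (dot P Q) (dot P x) (dot P y) (dot Q x) (dot Q y) (dot x x) (dot y y).
by move=> r1 r2 r3 r4 r5 r6 r7 r8 r9 H; lra.
Qed.

(** Adding the three-point inequalities at [x] and [y], each tested at the other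
    proximal point, shows that [prox] is firmly nonexpansive. *)
Lemma prox_nonexpansive x y : frob (prox eta f x - prox eta f y) <= frob (x - y).
Proof.
have [_ h1] := prox_three_point x (prox_edom y).
have [_ h2] := prox_three_point y (prox_edom x).
set P := prox eta f x in h1 h2 *; set Q := prox eta f y in h1 h2 *.
have e2 : 0 < 2 * eta by rewrite mulr_gt0.
have h : frob (P - x) ^+ 2 + frob (Q - P) ^+ 2 + frob (Q - y) ^+ 2 + frob (P - Q) ^+ 2 <=
   frob (Q - x) ^+ 2 + frob (P - y) ^+ 2.
  exact: (three_points_sum e2 h1 h2).
have k := four_points h.
have [->|PQ] := eqVneq (frob (P - Q)) 0; first exact: frob_ge0.
have PQ0 : 0 < frob (P - Q) by rewrite lt_def PQ frob_ge0.
rewrite -(ler_pM2l PQ0) -expr2; apply: (le_trans k).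
by apply: le_trans (cauchy_schwarz _ _); exact: ler_norm.
Qed.

End prox.
End proximal.

Section conjugate.
Context {R : realType} {q n : nat} (K : 'M[R]_(q, n)) (psi : 'cV[R]_n -> \bar R).
Hypotheses (hpsi : proper_closed_convex psi) (hmu : strongly_convex_fun 1 psi).

Let ppsi : Defs.proper psi. Proof. by case: hpsi. Qed.

Let g u := fun y => (psi y + (- dot u (K *m y))%:E)%E.

Let gE u y : ((dot u (K *m y))%:E - psi y = - g u y)%E.
Proof.
rewrite /g; have := ppsi.1 y; case: (psi y) => [r _|_|//]; last by [].
by rewrite -!EFinD -EFinN opprD opprK addrC.
Qed.

Let gproper u : Defs.proper (g u).
Proof.
split; first by move=> z; apply: ltNy_addr; exact: ppsi.1.
by have [z zd] := ppsi.2; exists z; apply/edom_addr.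
Qed.

Let gsc u : strongly_convex_fun 1 (g u).
Proof.
rewrite -[1]addr0; apply: strongly_convex_funD => // x y t _.
by rewrite mulmxDr -!scalemxAr dotDr !dotZr !mul0r le_eqVlt; apply/orP; left; apply/eqP; ring.
Qed.

Let y0star_argmin u : argmin (g u) (y0star K psi u).
Proof.
have [y ymin] : argmin (g u) !=set0.
  apply: (@strongly_convex_argmin _ _ (g u) 1) => //.
  apply: lower_semicontinuous_addr; [exact: ppsi.1|by case: hpsi|].
  have -> : (fun z => - dot u (K *m z)) = (fun z => dot (- (K^T *m u)) z).
    by apply/funext => z; rewrite dotNl dot_mulmx.
  exact: continuous_dot.
have : argmax (fun y => ((dot u (K *m y))%:E - psi y)%E) (y0star K psi u).
  by rewrite /y0star; apply: getPex; exists y => z; rewrite !gE leeN2; exact: ymin.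
by move=> h z; have := h z; rewrite !gE leeN2.
Qed.

Let y0star_le u z : edom psi z -> edom psi (y0star K psi u) /\
  fine (psi (y0star K psi u)) - dot u (K *m y0star K psi u)
    + frob (z - y0star K psi u) ^+ 2 / 2 <= fine (psi z) - dot u (K *m z).
Proof.
move=> zd; have zg : edom (g u) z by apply/edom_addr.
have [] := @strongly_convex_argmin_le _ _ (g u) 1 _ (gproper u) (gsc u) _ _ (y0star_argmin u) zg => //.
move=> /edom_addr yd; rewrite /g -(fineK (proper_fin_num ppsi yd)).
rewrite -(fineK (proper_fin_num ppsi zd)) -!EFinD/= => le.
by split => //; rewrite mulrC -[2^-1]mul1r.
Qed.

Lemma y0star_edom u : edom psi (y0star K psi u).
Proof. by have [z zd] := ppsi.2; have [] := y0star_le u zd. Qed.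

(** Same symmetrization as for proximal points: the objective of the inner
    maximization is 1-strongly concave and depends on [u] linearly through [K]. *)
Lemma y0star_lipschitz u v :
  frob (y0star K psi u - y0star K psi v) <= spectral_norm K * frob (u - v).
Proof.
have [_ h1] := y0star_le u (y0star_edom v).
have [_ h2] := y0star_le v (y0star_edom u).
set P := y0star K psi u in h1 h2 *; set Q := y0star K psi v in h1 h2 *.
have k : frob (P - Q) ^+ 2 <= dot (u - v) (K *m (P - Q)).
  by rewrite mulmxBr dotBl !dotBr; move: h1 h2; rewrite (frobBC Q P); lra.
have [->|PQ] := eqVneq (frob (P - Q)) 0.
  by rewrite mulr_ge0 ?frob_ge0 ?spectral_norm_ge0.
have PQ0 : 0 < frob (P - Q) by rewrite lt_def PQ frob_ge0.
rewrite -(ler_pM2l PQ0) -expr2; apply: (le_trans k).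
apply: le_trans (ler_norm _) _; apply: le_trans (cauchy_schwarz _ _) _.
rewrite [leRHS]mulrC -mulrA [leRHS]mulrC -mulrA; apply: ler_wpM2l; first exact: frob_ge0.
by rewrite mulrC; exact: spectral_norm_mulmx.
Qed.

Lemma phi0E u : phi0 K psi u =
  (dot u (K *m y0star K psi u) - fine (psi (y0star K psi u)))%:E.
Proof.
have yd := y0star_edom u.
apply/eqP; rewrite eq_le; apply/andP; split.
  apply: ge_ereal_sup => _ [y _ <-]; rewrite dot_mulmx.
  rewrite EFinB (fineK (proper_fin_num ppsi yd)) !gE leeN2; exact: y0star_argmin.
apply: ereal_sup_ubound; exists (y0star K psi u) => //.
by rewrite dot_mulmx EFinB (fineK (proper_fin_num ppsi yd)).
Qed.

(** Danskin's theorem in quantitative form: [phi0] is a maximum of affine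
    functions, so the slope at [u] is a subgradient, and the remainder is at most
    the variation of the maximizer. *)
Lemma phi0_sandwich u v :
  let r := fine (phi0 K psi v) - fine (phi0 K psi u) - dot (v - u) (K *m y0star K psi u) in
  0 <= r <= spectral_norm K ^+ 2 * frob (v - u) ^+ 2.
Proof.
rewrite /= !phi0E/=.
have [_ h1] := y0star_le u (y0star_edom v).
have [_ h2] := y0star_le v (y0star_edom u).
set P := y0star K psi u in h1 h2 *; set Q := y0star K psi v in h1 h2 *.
have s1 := sqr_ge0 (frob (P - Q)).
have s2 : 0 <= frob (Q - P) ^+ 2 by exact: sqr_ge0.
apply/andP; split; first by rewrite dotBl; lra.
have k : dot (v - u) (K *m (Q - P)) <= spectral_norm K ^+ 2 * frob (v - u) ^+ 2.
  apply: le_trans (ler_norm _) _; apply: le_trans (cauchy_schwarz _ _) _.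
  have h : frob (K *m (Q - P)) <= spectral_norm K ^+ 2 * frob (v - u).
    apply: le_trans (spectral_norm_mulmx _ _) _; rewrite expr2 -mulrA.
    by apply: ler_wpM2l; [exact: spectral_norm_ge0|exact: y0star_lipschitz].
  apply: le_trans (ler_wpM2l (frob_ge0 _) h) _.
  by rewrite le_eqVlt; apply/orP; left; apply/eqP; ring.
by apply: le_trans k; rewrite mulmxBr dotBr !dotBl; lra.
Qed.

End conjugate.

(** * Increments of differentiable functions *)

Section pathwise.
Context {R : realType}.
Implicit Types f g h : R -> R.
Local Notation mu := (@lebesgue_measure R).

(** The supremum of the points where [g] has not dropped below [g a] is [b]:
    the local hypothesis at the supremum both attains it and moves past it. *)
Lemma locally_nondecreasing g (a b : R) : a <= b ->
  (forall s, a <= s <= b -> exists2 e, 0 < e &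
     forall t, a <= t <= b ->
       (s <= t < s + e -> g s <= g t) /\ (s - e < t <= s -> g t <= g s)) ->
  g a <= g b.
Proof.
move=> ab loc.
pose A := [set t | a <= t <= b /\ g a <= g t].
have Aa : A a by rewrite /A /= lexx ab.
have Aub : ubound A b by move=> t [/andP[]].
have supA : has_sup A by split; [exists a|exists b].
set c := sup A.
have ac : a <= c by apply: ub_le_sup => //; exists b.
have cb : c <= b by apply: ge_sup => //; exists a.
have cab : a <= c <= b by rewrite ac cb.
have [e e0 He] := loc _ cab.
have Ac : g a <= g c.
  have [t At] := sup_adherent e0 supA; rewrite -/c => tc.
  have [abt gat] := At.
  apply: (le_trans gat); apply: (He _ abt).2.
  by rewrite tc/=; apply: ub_le_sup => //; exists b.
move: cb; rewrite le_eqVlt => /predU1P[<-//|cb].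
pose t := Num.min b (c + e / 2).
have ct : c < t by rewrite lt_min cb ltrDl divr_gt0.
have tb : t <= b by rewrite ge_min lexx.
have abt : a <= t <= b by rewrite tb (le_trans ac (ltW ct)).
have At : A t.
  split => //; apply: (le_trans Ac); apply: (He _ abt).1.
  rewrite (ltW ct)/= gt_min; apply/orP; right.
  by rewrite ltrD2l gtr_pMr// invf_lt1 ?ltr1n.
have : t <= c by apply: ub_le_sup => //; exists b.
by rewrite leNgt ct.
Qed.

(** The Vitali-Caratheodory theorem in the form used here. The level sets of [h]
    in steps of [eps] are enclosed in open sets [U k] of almost the same measure,
    and [G] adds up the levels of all [U k] that contain the point. Near a point
    of level [k], [G] is at least [(k+1) eps], which exceeds [h] there. *)
Lemma lower_semicontinuous_majorant (D : set R) h (e : R) :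
  measurable D -> (mu D < +oo)%E ->
  measurable_fun D h -> (forall s, D s -> 0 <= h s) -> 0 < e ->
  exists G : R -> \bar R,
  [/\ measurable_fun [set: R] G, (forall s, 0 <= G s)%E,
      (forall s, D s -> exists c, h s < c /\
         exists2 r : R, 0 < r & forall t, `|t - s| < r -> (c%:E <= G t)%E) &
      (\int[mu]_(s in D) G s <= \int[mu]_(s in D) (h s)%:E + e%:E)%E].
Proof.
move=> mD muD mh h0 e0.
have [V V0 VD] : exists2 V : R, 0 < V & (mu D <= V%:E)%E.
  have : mu D \is a fin_num by rewrite ge0_fin_numE.
  move=> /fineK <-; exists (fine (mu D) + 1); last by rewrite lee_fin lerDl.
  by rewrite ltr_pwDr// fine_ge0.
pose eps := e / (2 * V).
have eps0 : 0 < eps by rewrite divr_gt0// mulr_gt0.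
pose E (k : nat) := D `&` h @^-1` `[k%:R * eps, k.+1%:R * eps[%classic.
have mE k : measurable (E k) by apply: mh.
have EmuD k : (mu (E k) < +oo)%E.
  apply: (@le_lt_trans _ _ (mu D)) => //.
  by apply: le_measure; rewrite ?inE; [exact: mE|exact: mD|exact: subIsetl].
(* The excess of [U k] costs at most [e / 2^(k+2)] in the integral. *)
pose eta (k : nat) := e / 2 / (2 ^ k.+1)%:R / (k.+1%:R * eps).
have eta0 k : 0 < eta k by apply: divr_gt0; [apply: divr_gt0; [exact: divr_gt0|rewrite ltr0n expn_gt0]|exact: mulr_gt0].
have /choice[U HU] : forall k, exists U : set R,
   [/\ open U, E k `<=` U & (mu (U `\` E k) < (eta k)%:E)%E].
  by move=> k; exact: (lebesgue_regularity_outer (mE k) (EmuD k) (eta0 k)).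
have mU k : measurable (U k) by apply: open_measurable; have [] := HU k.
pose g (k : nat) (s : R) : \bar R := (k.+1%:R * eps * \1_(U k) s)%:E.
have g0 k s : (0 <= g k s)%E.
  by rewrite lee_fin mulr_ge0// mulr_ge0// ltW.
have mg k : measurable_fun [set: R] (g k).
  by apply/measurable_EFinP; apply: measurable_funM => //; exact: measurable_indic.
exists (fun s => \sum_(0 <= k <oo) g k s)%E; split.
- by apply: ge0_emeasurable_sum => // k s _ _.
- by move=> s; apply: nneseries_ge0 => k _ _.
- move=> s Ds.
  pose k := Num.truncn (h s / eps).
  have Ek : E k s.
    split => //=; rewrite in_itv/=; apply/andP; split.
      by rewrite -ler_pdivlMr// truncn_le (divr_ge0 (h0 _ Ds) (ltW eps0)).
    by rewrite -ltr_pdivrMr//; exact: truncnS_gt.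
  exists (k.+1%:R * eps); split; first by case: Ek => _ /=; rewrite in_itv/= => /andP[].
  have [oU EU _] := HU k.
  have : nbhs s (U k) by apply: open_nbhs_nbhs; split => //; apply: EU.
  move=> /nbhs_ballP[r /= r0 rU]; exists r => // t ts.
  have Ut : U k t by apply: rU; rewrite /ball/= distrC.
  apply: (@le_trans _ _ (g k t)).
    by rewrite /g lee_fin indicE mem_set// mulr1.
  by rewrite (nneseriesD1 (fun i _ => g0 i t) (isT : xpredT k))// leeDl// nneseries_ge0// => i _ _; exact: g0.
rewrite (integral_nneseries mu mD (fun k => measurable_funTS (mg k)) (fun k x _ => g0 k x)).
have step k : (\int[mu]_(s in D) g k s <=
   \int[mu]_(s in E k) (h s + eps)%:E + (e / 2 / (2 ^ k.+1)%:R)%:E)%E.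
  have -> : (\int[mu]_(s in D) g k s = (k.+1%:R * eps)%:E * mu (U k `&` D))%E.
    under eq_integral do rewrite /g EFinM.
    have c0 : (0 <= (k.+1%:R * eps)%:E :> \bar R)%E by rewrite lee_fin mulr_ge0// ltW.
    have mI : measurable_fun D (fun s => (\1_(U k) s)%:E : \bar R).
      by apply/measurable_EFinP; apply: measurable_funTS; exact: measurable_indic.
    have I0 s : D s -> (0 <= (\1_(U k) s)%:E :> \bar R)%E by rewrite lee_fin.
    by rewrite (ge0_integralZl mu mD mI I0 c0) (integral_indic mu mD (mU k)).
  have [_ EU Ueta] := HU k.
  apply: (@le_trans _ _ ((k.+1%:R * eps)%:E * (mu (E k) + (eta k)%:E))%E).
    apply: lee_wpmul2l; first by rewrite lee_fin mulr_ge0// ltW.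
    apply: (@le_trans _ _ (mu (U k))).
      by apply: le_measure; rewrite ?inE; [exact: (measurableI _ _ (mU k) mD)|exact: mU|exact: subIsetl].
    have -> : U k = E k `|` (U k `\` E k) by rewrite setDUK.
    apply: (le_trans (measureU2 mu (mE k) (measurableD (mU k) (mE k)))).
    by rewrite leeD2l// ltW.
  rewrite ge0_muleDr//; last by rewrite lee_fin ltW.
  apply: leeD; last first.
    by rewrite -EFinM lee_fin /eta mulrC divfK// gt_eqF// mulr_gt0.
  rewrite -(integral_cst mu (mE k)); apply: (ge0_le_integral mu (mE k)) => //.
  + by move=> x _; rewrite lee_fin mulr_ge0// ltW.
  + apply/measurable_EFinP; apply: measurable_funD => //.
    by apply: measurable_funS mh => //; exact: subIsetl.
  + move=> x [_ /=]; rewrite in_itv/= => /andP[kh _].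
    by rewrite lee_fin -natr1 mulrDl mul1r lerD2r.
apply: (le_trans (lee_nneseries _ (fun k _ => step k))).
  by move=> k _ _; apply: integral_ge0.
apply: (le_trans (epsilon_trick _ _ _)).
- by move=> k; apply: integral_ge0 => x [Dx _]; rewrite lee_fin addr_ge0 ?h0// ltW.
- by rewrite divr_ge0// ltW.
rewrite -(ge0_integral_bigcup mu mE).
- have -> : \bigcup_k E k = D.
    apply/seteqP; split => [s [k _ []]//|s Ds].
    exists (Num.truncn (h s / eps)) => //; split => //=; rewrite in_itv/=; apply/andP; split.
      by rewrite -ler_pdivlMr// truncn_le (divr_ge0 (h0 _ Ds) (ltW eps0)).
    by rewrite -ltr_pdivrMr//; exact: truncnS_gt.
  under eq_integral do rewrite EFinD.
  rewrite (ge0_integralD mu mD)//; first last.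
  + by move=> x _; rewrite lee_fin ltW.
  + exact/measurable_EFinP.
  rewrite (integral_cst mu mD).
  rewrite -addeA leeD2l// [in leRHS](_ : e = eps * V + e / 2); last first.
    by rewrite /eps; field; rewrite gt_eqF.
  have eps0' : (0 <= eps%:E :> \bar R)%E by rewrite lee_fin ltW.
  by rewrite EFinD leeD2r// EFinM; exact: (lee_wpmul2l eps0' VD).
- apply/measurable_EFinP; apply: measurable_funD => //.
  by apply: measurable_funS mh => //; move=> s [k _ []].
- by move=> s [k _ [Ds _]]; rewrite lee_fin addr_ge0 ?h0// ltW.
- apply/trivIsetP => i j _ _; wlog ij : i j / (i < j)%N.
    move=> W; rewrite neq_lt => /orP[ij|ji]; first by apply: W => //; rewrite neq_lt ij.
    by rewrite setIC; apply: W => //; rewrite neq_lt ji.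
  move=> _; apply/seteqP; split => // s [[_ /=]]; rewrite in_itv/= => /andP[_ hi] [_ /=].
  rewrite in_itv/= => /andP[hj _].
  have : i.+1%:R * eps <= j%:R * eps by rewrite ler_pM2r// ler_nat.
  by move=> /(le_trans)/(_ hj); rewrite leNgt hi.
Qed.

Local Notation I01 := (`[0%R, 1%R]%classic : set R).

(** The derivative need not be integrable, so there is no fundamental theorem
    of calculus to apply. With [G] the lower semicontinuous majorant of [|f'|]
    and [Phi] its primitive, [Phi - f] is nondecreasing near every point, hence
    on the whole interval; then the excess of [G] tends to 0. *)
Lemma increment_le_integral f (f' : R -> R) : measurable_fun I01 f' ->
  (forall s : R, 0 <= s <= 1 -> is_derive s (1 : R) f (f' s)) ->
  ((f 1 - f 0)%:E <= \int[mu]_(s in I01) `|f' s|%:E)%E.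
Proof.
move=> mf' df.
have mD : measurable I01 by exact: measurable_itv.
have muD : (mu I01 = 1)%E.
  by rewrite lebesgue_measure_itv/= lte_fin ltr01 sube0.
have mnf' : measurable_fun I01 (fun s => `|f' s|) by exact: measurableT_comp.
apply/lee_addgt0Pr => e e0.
have [||G [mG G0 GD]] := lower_semicontinuous_majorant mD _ mnf' _ e0.
- by rewrite muD ltry.
- by move=> s _ /=.
apply: le_trans.
have [|] := leP (+oo)%E (\int[mu]_(s in I01) G s)%E.
  by rewrite leye_eq => /eqP ->; rewrite leey.
move=> Gfin.
pose Phi (t : R) := (\int[mu]_(s in `[0%R, t%R]) G s)%E.
have Gint : mu.-integrable I01 G.
  apply/integrableP; split; first exact: measurable_funTS.
  by under eq_integral => s _ do rewrite gee0_abs//.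
have PhiS (s t : R) : s <= t -> 0 <= s -> Phi t = (Phi s + \int[mu]_(x in `]s, t]) G x)%E.
  move=> st s0.
  have -> : Phi t = (\int[mu]_(x in `[0%R, s] `|` `]s, t]) G x)%E.
    by rewrite /Phi -itv_bndbnd_setU// bnd_simp.
  rewrite (ge0_integral_setU mu)//.
  - exact: measurable_funTS.
  - apply/disj_setPS => x [/=]; rewrite !in_itv/= => /andP[_ xs] /andP[sx _].
    by move: (lt_le_trans sx xs); rewrite ltxx.
have Phifin (t : R) : 0 <= t <= 1 -> Phi t \is a fin_num.
  move=> /andP[t0 t1]; rewrite ge0_fin_numE; last exact: integral_ge0.
  apply: le_lt_trans Gfin; apply: (ge0_subset_integral mu (measurable_itv _) mD) => //.
  - exact: measurable_funTS.
  - by move=> x/=; rewrite !in_itv/= => /andP[-> xt]; exact: le_trans xt t1.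
have lb (c s t : R) : 0 <= c -> s <= t -> (forall x, s < x <= t -> (c%:E <= G x)%E) -> 0 <= s -> t <= 1 ->
    c * (t - s) <= fine (Phi t) - fine (Phi s).
  move=> c0 st cG s0 t1.
  have s1 := le_trans st t1; have t0 := le_trans s0 st.
  rewrite -lee_fin EFinB !fineK ?Phifin ?s0 ?s1 ?t0// (PhiS _ _ st s0).
  rewrite addeAC subee ?Phifin ?s0// add0e.
  have -> : ((c * (t - s))%:E = \int[mu]_(x in `]s, t]) (cst c%:E) x)%E.
    rewrite (integral_cst mu (measurable_itv _)) [X in (_ * X)%E](lebesgue_measure_itv `]s, t])/= lte_fin.
    move: st; rewrite le_eqVlt => /predU1P[->|->]; last by rewrite EFinM.
    by rewrite ltxx subrr mulr0 mule0.
  apply: (ge0_le_integral mu (measurable_itv _)) => //.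
  - exact: measurable_funTS.
have mono : fine (Phi 0) - f 0 <= fine (Phi 1) - f 1.
  apply: (@locally_nondecreasing (fun t => fine (Phi t) - f t)) => // s s01.
  have Ds : I01 s by rewrite /= in_itv.
  have [c [fc [r r0 rG]]] := GD _ Ds.
  have [ddf f'E] := df _ s01.
  have : (fun h : R => h^-1 *: (f (h + s) - f s)) @ 0^' --> f' s.
    have -> : (fun h : R => h^-1 *: (f (h + s) - f s)) =
              (fun h : R => h^-1 *: (f (h *: 1 + s) - f s)).
      by apply/funext => h; rewrite /GRing.scale/= mulr1.
    by rewrite -f'E; exact: ddf.
  move=> /cvgrPdist_lt /(_ (c - `|f' s|)); rewrite subr_gt0 => /(_ fc).
  move=> /nbhs_ballP[r' /= r'0 r'H].
  have key t : t != s -> `|t - s| < r' -> `|f t - f s| <= c * `|t - s|.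
    move=> ts tr'.
    have := r'H (t - s); rewrite /ball/= sub0r normrN => /(_ tr').
    rewrite subr_eq0 => /(_ ts); rewrite subrK => H.
    have ts0 : 0 < `|t - s| by rewrite normr_gt0 subr_eq0.
    have : `|(t - s)^-1 *: (f t - f s)| <= c.
      rewrite -[X in `|X|](subrK (f' s)) (le_trans (ler_normD _ _))//.
      by rewrite -lerBrDr distrC ltW.
    by rewrite normrZ normfV mulrC ler_pdivrMr.
  exists (Num.min r r'); first by rewrite lt_min r0.
  have lbG (x : R) : `|x - s| < Num.min r r' -> (c%:E <= G x)%E.
    by rewrite lt_min => /andP[xr _]; exact: rG.
  move=> t /andP[t0 t1]; move: s01 => /andP[s0 s1]; split => /andP[].
    rewrite le_eqVlt => /predU1P[->//|st] ts.
    have ts' : `|t - s| < Num.min r r' by rewrite gtr0_norm ?subr_gt0// ltrBlDl.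
    have tr' : `|t - s| < r' by move: ts'; rewrite lt_min => /andP[].
    have tns : t != s by rewrite gt_eqF.
    have lbt : c * (t - s) <= fine (Phi t) - fine (Phi s).
      apply: lb => //; [exact: le_trans (ltW fc)|exact: ltW|].
      move=> x /andP[sx xt]; apply: lbG; apply: le_lt_trans ts'.
      by rewrite !gtr0_norm ?subr_gt0// lerD2r.
    have := key _ tns tr'; rewrite [X in _ <= _ * X]gtr0_norm ?subr_gt0// => /ler_normlP[_ ft].
    by rewrite -subr_ge0; lra.
  move=> ts; rewrite le_eqVlt => /predU1P[->//|st].
  have ts' : `|t - s| < Num.min r r' by rewrite ltr0_norm ?subr_lt0// opprB ltrBlDl -ltrBlDr.
  have tr' : `|t - s| < r' by move: ts'; rewrite lt_min => /andP[].
  have tns : t != s by rewrite lt_eqF.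
  have lbt : c * (s - t) <= fine (Phi s) - fine (Phi t).
    apply: lb => //; [exact: le_trans (ltW fc)|exact: ltW|].
    move=> x /andP[sx xt]; apply: lbG; apply: le_lt_trans ts'.
    by rewrite [leRHS]ltr0_norm ?subr_lt0// [leLHS]ler0_norm ?subr_le0// !opprB lerD2l lerN2 ltW.
  have := key _ tns tr'; rewrite [X in _ <= _ * X]ltr0_norm ?subr_lt0// opprB => /ler_normlP[ft _].
  by rewrite -subr_ge0; lra.
have Phi1 : (\int[mu]_(s in I01) G s)%E = (fine (Phi 1))%:E by rewrite fineK// Phifin// ler01 lexx.
have Phi00 : 0 <= fine (Phi 0) by rewrite fine_ge0// integral_ge0.
by rewrite Phi1 lee_fin; lra.
Qed.

(** Integrating [2 x |f'| <= f'^2 + x^2] with [x = f 1 - f 0] avoids an appeal to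
    the Cauchy-Schwarz inequality for a possibly infinite integral. *)
Lemma increment_sqr_le f (f' : R -> R) : measurable_fun I01 f' ->
  (forall s : R, 0 <= s <= 1 -> is_derive s (1 : R) f (f' s)) ->
  (((f 1 - f 0) ^+ 2)%:E <= \int[mu]_(s in I01) (f' s ^+ 2)%:E)%E.
Proof.
wlog : f f' / 0 <= f 1 - f 0.
  move=> W mf' df; have [|/ltW] := leP 0 (f 1 - f 0); first by move=> /W; exact.
  move=> f10; have := W (fun x => - f x) (fun x => - f' x).
  have -> : - f 1 - - f 0 = - (f 1 - f 0) by rewrite opprB opprK addrC.
  rewrite oppr_ge0 sqrrN => /(_ f10).
  under eq_integral do rewrite sqrrN.
  apply; first exact: measurableT_comp.
  by move=> s /df ?; exact: is_deriveN.
move=> x0 mf' df.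
have mD : measurable I01 by exact: measurable_itv.
have muD : (mu I01 = 1)%E.
  by rewrite lebesgue_measure_itv/= lte_fin ltr01 sube0.
have mnf' : measurable_fun I01 (fun s => `|f' s|) by exact: measurableT_comp.
have m2 : measurable_fun I01 (fun s => (f' s ^+ 2)%:E : \bar R).
  by apply/measurable_EFinP; exact: measurable_funX.
set x := f 1 - f 0 in x0 *.
have L1 : (x%:E <= \int[mu]_(s in I01) `|f' s|%:E)%E by exact: increment_le_integral.
(* The claim follows by subtracting [x^2] from both sides. *)
have L2 : ((2 * x)%:E * x%:E <= \int[mu]_(s in I01) (f' s ^+ 2)%:E + (x ^+ 2)%:E)%E.
  have xx0 : (0 <= (2 * x)%:E :> \bar R)%E by rewrite lee_fin mulr_ge0.
  apply: (le_trans (lee_wpmul2l xx0 L1)).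
  have mn : measurable_fun I01 (fun s => `|f' s|%:E : \bar R) by exact/measurable_EFinP.
  rewrite -(ge0_integralZl mu mD mn)//.
  have -> : ((x ^+ 2)%:E = \int[mu]_(s in I01) (cst (x ^+ 2)%:E) s)%E.
    by rewrite (integral_cst mu mD) [X in (_ * X)%E]muD mule1.
  rewrite -(ge0_integralD mu mD)//.
  - apply: (ge0_le_integral mu mD) => //.
    + by move=> s _; rewrite -EFinM lee_fin !mulr_ge0.
    + by apply: measurable_funeM.
    + by apply: emeasurable_funD => //.
    + move=> s _; rewrite -EFinM -EFinD lee_fin -[f' s ^+ 2]real_normK ?num_real//.
      by have := sqr_ge0 (`|f' s| - x); rewrite sqrrB; lra.
  - by move=> s _; rewrite lee_fin sqr_ge0.
  - by move=> s _; rewrite lee_fin sqr_ge0.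
move: L2; rewrite -EFinM -leeBlDr// -EFinB.
by have -> : 2 * x * x - x ^+ 2 = x ^+ 2 by ring.
Qed.
End pathwise.

(** * Measurability of random matrices *)

Section measurability.
Context {R : realType}.

Definition measurable_mx d (T : measurableType d) m n (X : T -> 'M[R]_(m, n)) : Prop :=
  forall i j, measurable_fun [set: T] (fun t => X t i j).

Lemma cvg_mx_entries (I : Type) (F : set_system I) {FF : Filter F} m n
    (X : I -> 'M[R]_(m, n)) (a : 'M[R]_(m, n)) :
  (forall i j, X x i j @[x --> F] --> a i j) -> X x @[x --> F] --> a.
Proof.
move=> H; apply/(@cvgrPdist_le _ _ _ F FF) => e e0.
have near_ij : forall p : 'I_m * 'I_n, \forall x \near F, `|a p.1 p.2 - X x p.1 p.2| <= e.
  by move=> p; have /cvgrPdist_le := H p.1 p.2; apply.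
have := @filter_forall _ _ _ F FF near_ij.
apply: filterS => x hx; rewrite [leLHS]mx_normrE; apply: bigmax_le => [|p _]; first exact: ltW.
by rewrite !mxE; exact: hx.
Qed.

(** A Caratheodory function composed with a random point: round the point to a
    grid of mesh [1 / (k+1)], where only countably many values occur, and let [k]
    tend to infinity using continuity. *)
Lemma measurable_caratheodory d (T : measurableType d) p (f : 'cV[R]_p -> T -> R)
    (Z : T -> 'cV[R]_p) :
  (forall t, continuous (f^~ t)) -> (forall z, measurable_fun [set: T] (f z)) ->
  measurable_mx Z -> measurable_fun [set: T] (fun t => f (Z t) t).
Proof.
move=> cf mf mZ.
pose grid (k : nat) (m : 'cV[int]_p) : 'cV[R]_p := \col_i ((m i ord0)%:~R / k.+1%:R).
pose fl (k : nat) (t : T) : 'cV[int]_p := \col_i Num.floor (k.+1%:R * Z t i ord0).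
have bigI (E : 'I_p -> set T) :
    \big[setI/[set: T]]_(i < p) E i = \bigcap_(i in [set: 'I_p]) E i.
  rewrite -bigcap_seq; congr bigcap; apply/seteqP; split=> i //= _.
  by rewrite mem_index_enum.
apply: (@measurable_fun_cvg _ _ _ _ (fun k t => f (grid k (fl k t)) t)).
  move=> k _ B mB; rewrite setTI.
  have -> : (fun t => f (grid k (fl k t)) t) @^-1` B =
      \bigcup_(m in [set: 'cV[int]_p])
        (\big[setI/[set: T]]_(i < p) ([set: T] `&` (fun t => Z t i ord0) @^-1`
            `[(m i ord0)%:~R / k.+1%:R, (m i ord0 + 1)%:~R / k.+1%:R[%classic)
         `&` ([set: T] `&` f (grid k m) @^-1` B)).
    have k0 : 0 < k.+1%:R :> R by [].
    have flE t (m : 'cV[int]_p) i : (`[(m i ord0)%:~R / k.+1%:R, (m i ord0 + 1)%:~R / k.+1%:R[%classic (Z t i ord0))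
        <-> fl k t i ord0 = m i ord0.
      rewrite /= in_itv/= mxE ler_pdivrMr// ltr_pdivlMr// (mulrC (Z t i ord0)) -floor_eq.
      by split => [/eqP|->].
    apply/seteqP; split => [t Bt|t [m _]].
      exists (fl k t) => //; split => //; rewrite bigI => i _; split => //.
      by apply/flE.
    rewrite bigI => -[Zt [_ Bt]].
    suff e : f (grid k (fl k t)) t = f (grid k m) t by rewrite /= e.
    congr (f (grid k _) t); apply/colP => i; apply/flE.
    by have [] := Zt i Logic.I.
  apply: countable_bigcupT_measurable; first exact: countableP.
  move=> m; apply: measurableI; last exact: mf.
  by apply: bigsetI_measurable => i _; apply: mZ => //; exact: measurable_itv.
move=> t _.
apply: (@cvg_comp _ _ _ (fun k => grid k (fl k t)) (f^~ t) _ (nbhs (Z t))); last exact: cf.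
apply: cvg_mx_entries => i j; rewrite ord1.
apply/cvgrPdist_le => e e0; near=> k.
have k0 : 0 < k.+1%:R :> R by [].
have ke : (k.+1%:R)^-1 <= e by apply: ltW; near: k; exact: (near_infty_natSinv_lt (PosNum e0)).
rewrite !mxE; set x := Z t i ord0.
have /andP[h1 h2] := floor_itv (k.+1%:R * x).
rewrite ger0_norm.
  apply: le_trans ke; rewrite lerBlDr -[X in X + _]mul1r -mulrDl ler_pdivlMr//.
  by move: h2; rewrite intrD mulr1z (mulrC x) addrC => /ltW.
by rewrite subr_ge0 ler_pdivrMr// (mulrC x).
Unshelve. all: by end_near. Qed.

Section closure.
Context {d : measure_display} {T : measurableType d}.

Lemma measurable_mxD m n (X Y : T -> 'M[R]_(m, n)) :
  measurable_mx X -> measurable_mx Y -> measurable_mx (fun t => X t + Y t).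
Proof. by move=> mX mY i j; under eq_fun do rewrite mxE; exact: measurable_funD. Qed.

Lemma measurable_mxZ m n a (X : T -> 'M[R]_(m, n)) :
  measurable_mx X -> measurable_mx (fun t => a *: X t).
Proof. by move=> mX i j; under eq_fun do rewrite mxE; exact: measurable_funM. Qed.

Lemma measurable_mxB m n (X Y : T -> 'M[R]_(m, n)) :
  measurable_mx X -> measurable_mx Y -> measurable_mx (fun t => X t - Y t).
Proof.
by move=> mX mY i j; under eq_fun do rewrite !mxE; exact: measurable_funB.
Qed.

Lemma measurable_mx_sum m n k (X : 'I_k -> T -> 'M[R]_(m, n)) :
  (forall i, measurable_mx (X i)) -> measurable_mx (fun t => \sum_(i < k) X i t).
Proof.
move=> mX i j; under eq_fun do rewrite summxE.
by apply: measurable_sum => l; exact: mX.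
Qed.

Lemma measurable_mxM m n l (X : T -> 'M[R]_(m, n)) (Y : T -> 'M[R]_(n, l)) :
  measurable_mx X -> measurable_mx Y -> measurable_mx (fun t => X t *m Y t).
Proof.
move=> mX mY i j; under eq_fun do rewrite mxE.
by apply: measurable_sum => k; exact: measurable_funM.
Qed.

Lemma measurable_mx_tr m n (X : T -> 'M[R]_(m, n)) :
  measurable_mx X -> measurable_mx (fun t => (X t)^T).
Proof. by move=> mX i j; under eq_fun do rewrite mxE; exact: mX. Qed.

Lemma measurable_mx_cst m n (A : 'M[R]_(m, n)) : measurable_mx (fun _ : T => A).
Proof. by move=> i j; exact: measurable_cst. Qed.

Lemma measurable_sqr_frob m n (X : T -> 'M[R]_(m, n)) :
  measurable_mx X -> measurable_fun [set: T] (fun t => frob (X t) ^+ 2).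
Proof.
move=> mX; under eq_fun do rewrite sqr_frob.
by apply: measurable_sum => i; apply: measurable_sum => j; exact: measurable_funX.
Qed.

Lemma measurable_mx_lipschitz p q (g : 'cV[R]_p -> 'cV[R]_q) (C : R) (Z : T -> 'cV[R]_p) :
  (forall x y, frob (g x - g y) <= C * frob (x - y)) ->
  measurable_mx Z -> measurable_mx (fun t => g (Z t)).
Proof.
move=> lip mZ i j.
apply: (@measurable_caratheodory _ T p (fun z _ => g z i j) Z) => //; last first.
move=> _ x; apply/(@cvgrPdist_lt _ _ _ (nbhs x) (nbhs_filter x)) => e e0.
have C1 : 0 < `|C| + 1 by rewrite ltr_wpDl.
have := @frob_nbhs _ _ _ x (e / (`|C| + 1)); rewrite divr_gt0// => /(_ isT).
apply: (@filterS _ _ (nbhs_filter x)) => y yx.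
have -> : g x i j - g y i j = (g x - g y) i j by rewrite !mxE.
apply: (le_lt_trans (entry_le_frob _ _ _)); apply: (le_lt_trans (lip _ _)).
rewrite frobBC; rewrite ltr_pdivlMr// mulrC in yx; apply: le_lt_trans yx.
by rewrite ler_wpM2r ?frob_ge0//; have := ler_norm C; lra.
Qed.

Section differentiable.
Context {p q : nat} (G : 'cV[R]_p -> T -> 'cV[R]_q) (Z : T -> 'cV[R]_p).
Hypotheses (dG : forall z t, differentiable (G^~ t) z)
  (mG : forall z, measurable_mx (G z)) (mZ : measurable_mx Z).

Let contG i t : continuous (fun z => G z t i ord0).
Proof.
move=> z; apply: (@cvg_comp _ _ _ (G^~ t) (fun A : 'cV[R]_q => A i ord0) _ (nbhs (G z t))).
  exact: (differentiable_continuous (dG z t)).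
exact: coord_continuous.
Qed.

Lemma measurable_mx_comp : measurable_mx (fun t => G (Z t) t).
Proof.
move=> i j; have -> : j = ord0 by exact: ord1.
apply: (@measurable_caratheodory _ T p (fun z t => G z t i ord0) Z) => //.
by move=> z; exact: mG.
Qed.

(** The entries are limits of difference quotients, to which
    [measurable_mx_comp] applies. *)
Lemma measurable_mx_Jac : measurable_mx (fun t => Jac (G^~ t) (Z t)).
Proof.
move=> i j; pose e : 'cV[R]_p := delta_mx j ord0.
apply: (@measurable_fun_cvg _ _ _ _
   (fun k t => (k.+1%:R : R) * (G (Z t + k.+1%:R^-1 *: e) t i ord0 - G (Z t) t i ord0))).
  move=> k; apply: measurable_funM => //; apply: measurable_funB.
    apply: (@measurable_caratheodory _ T p (fun z t => G (z + k.+1%:R^-1 *: e) t i ord0) Z) => //.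
      move=> t z; apply: (@continuous_comp _ _ _ (fun z : 'cV[R]_p => z + k.+1%:R^-1 *: e) (fun z => G z t i ord0)).
        by apply: (@cvgD _ _ _ (nbhs z) (nbhs_filter z)); [exact: cvg_id|exact: cvg_cst].
      exact: contG.
    by move=> z; exact: mG.
  by have := measurable_mx_comp i ord0.
move=> t _; rewrite mxE -/e.
have dv : derivable (G^~ t) (Z t) e by exact: diff_derivable.
have H : (fun h : R => h^-1 *: (G (h *: e + Z t) t - G (Z t) t)) @ 0^' --> 'D_e (G^~ t) (Z t).
  exact: dv.
have H2 : (fun h : R => h^-1 * (G (h *: e + Z t) t i ord0 - G (Z t) t i ord0)) @ 0^' -->
    ('D_e (G^~ t) (Z t) : 'cV[R]_q) i ord0.
  have := cvg_comp _ _ H (@coord_continuous _ _ _ i ord0 ('D_e (G^~ t) (Z t))).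
  by apply: cvg_trans; apply: near_eq_cvg; near=> h; rewrite /= !mxE.
have hk : (fun k : nat => k.+1%:R^-1 : R) @ \oo --> 0^'.
  move=> A /nbhs_ballP[r /= r0 rA].
  have := near_infty_natSinv_lt (PosNum r0); apply: filterS => k kr; apply: rA => /=.
    by rewrite /ball/= sub0r normrN gtr0_norm.
  by rewrite invr_eq0 pnatr_eq0.
have := cvg_comp _ _ hk H2; apply: cvg_trans; apply: near_eq_cvg; near=> k.
by rewrite /= invrK (addrC (Z t)).
Unshelve. all: by end_near. Qed.

End differentiable.
End closure.
End measurability.

(** * Mean-square Lipschitz continuity from a bound on the Jacobian *)

Section lines.
Context {R : realType} {p q : nat}.

Lemma derive_Jac (g : 'cV[R]_p -> 'cV[R]_q) z v : differentiable g z ->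
  'D_v g z = Jac g z *m v.
Proof.
move=> dg; apply/matrixP => i j; have -> : j = ord0 by exact: ord1.
rewrite mxE deriveE//.
have vE : v = \sum_(k < p) v k ord0 *: (delta_mx k ord0 : 'cV[R]_p).
  apply/colP => k; rewrite summxE (bigD1 k)//= big1 => [|l lk].
    by rewrite !mxE !eqxx mulr1 addr0.
  by rewrite !mxE eq_sym (negbTE lk) mulr0.
rewrite {1}vE linear_sum summxE; apply: eq_bigr => k _.
by rewrite linearZ/= !mxE deriveE// mulrC.
Qed.

Lemma is_derive_line (g : 'cV[R]_p -> 'cV[R]_q) (y v : 'cV[R]_p) (s : R) i :
  differentiable g (y + s *: v) ->
  is_derive s (1 : R) (fun r : R => g (y + r *: v) i ord0) ((Jac g (y + s *: v) *m v) i ord0).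
Proof.
move=> dg; set z := y + s *: v in dg *.
have H : (fun h : R => h^-1 *: (g (h *: v + z) - g z)) @ 0^' --> Jac g z *m v.
  by rewrite -derive_Jac//; exact: (diff_derivable dg).
have H2 : (fun h : R => h^-1 *: (g (y + (h *: 1 + s) *: v) i ord0 - g z i ord0)) @ 0^' -->
    (Jac g z *m v) i ord0.
  have := cvg_comp _ _ H (@coord_continuous _ _ _ i ord0 (Jac g z *m v)).
  apply: cvg_trans; apply: near_eq_cvg; near=> h; rewrite /= !mxE.
  have -> // : h *: v + z = y + (h *: 1 + s) *: v.
  by rewrite /z scalerDl addrCA [h *: 1]mulr1.
split; first by apply/cvg_ex; exists ((Jac g z *m v) i ord0).
exact: (cvg_lim _ H2).
Unshelve. all: by end_near. Qed.

End lines.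

Section second_moment.
Context {R : realType} d (Xi : measurableType d) (D : probability Xi R) {p q : nat}.
Local Notation mu := (@lebesgue_measure R).
Local Notation I01 := (`[0%R, 1%R]%classic : set R).

Local Notation GR := (measurableTypeR R).

Lemma sqr_frob_increment_le (g : 'cV[R]_p -> 'cV[R]_q) (y v : 'cV[R]_p) :
  (forall z, differentiable g z) ->
  ((frob (g (y + v) - g y) ^+ 2)%:E <=
    \int[mu]_(s in I01) (frob (Jac g (y + s *: v)) ^+ 2 * frob v ^+ 2)%:E)%E.
Proof.
move=> dg.
have mZ : measurable_mx (fun s : R => y + s *: v).
  apply: measurable_mxD; first exact: measurable_mx_cst.
  by move=> i j; under eq_fun do rewrite mxE; exact: measurable_funM.
have mJ : measurable_mx (fun s : R => Jac g (y + s *: v)).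
  apply: (@measurable_mx_Jac _ _ R p q (fun z _ => g z) (fun s : R => y + s *: v)) => //.
  by move=> z; exact: measurable_mx_cst.
have mJv : measurable_mx (fun s : R => Jac g (y + s *: v) *m v).
  by apply: measurable_mxM => //; exact: measurable_mx_cst.
have H i : (((g (y + v) i ord0 - g y i ord0) ^+ 2)%:E <=
    \int[mu]_(s in I01) (((Jac g (y + s *: v) *m v) i ord0) ^+ 2)%:E)%E.
  have := @increment_sqr_le _ (fun s : R => g (y + s *: v) i ord0)
    (fun s : R => (Jac g (y + s *: v) *m v) i ord0).
  rewrite scale1r scale0r addr0; apply.
    by apply: measurable_funTS; exact: mJv.
  by move=> s _; exact: is_derive_line.
have mI : measurable I01 by exact: measurable_itv.
rewrite sqr_frob; under eq_bigr do rewrite big_ord1 !mxE.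
rewrite -sumEFin; apply: (le_trans (lee_sum _ (fun i _ => H i))).
rewrite -(ge0_integral_sum mu mI).
- apply: (ge0_le_integral mu mI).
  + by move=> s _; apply: sume_ge0 => i _; rewrite lee_fin sqr_ge0.
  + apply: emeasurable_sum => i; apply/measurable_EFinP; apply: measurable_funX.
    by apply: measurable_funTS; exact: mJv.
  + apply/measurable_EFinP; apply: measurable_funM => //.
    by apply: measurable_funTS; exact: measurable_sqr_frob.
  + move=> s _; rewrite sumEFin lee_fin -exprMn.
    have -> : \sum_(i < q) ((Jac g (y + s *: v) *m v) i ord0) ^+ 2 = frob (Jac g (y + s *: v) *m v) ^+ 2.
      by rewrite sqr_frob; under [RHS]eq_bigr do rewrite big_ord1.
    by rewrite ler_sqr ?nnegrE ?mulr_ge0 ?frob_ge0// frob_mulmx.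
- move=> i; apply/measurable_EFinP; apply: measurable_funX.
  by apply: measurable_funTS; exact: mJv.
- by move=> i s _; rewrite lee_fin sqr_ge0.
Qed.

(** The pathwise bound along the segment from [y] to [y + v] is integrated over
    [xi]; Tonelli's theorem then exposes the second moment of the Jacobian at
    each single point of the segment. *)
Lemma second_moment_increment (F : 'cV[R]_p -> Xi -> 'cV[R]_q) (y v : 'cV[R]_p) (M : R) :
  (forall z xi, differentiable (F^~ xi) z) -> (forall z, measurable_mx (F z)) ->
  (forall s : R, 0 <= s <= 1 ->
    (\int[D]_xi (frob (JF F (y + s *: v) xi) ^+ 2)%:E <= M%:E)%E) ->
  (\int[D]_xi (frob (F (y + v)%R xi - F y xi) ^+ 2)%:E <= (M * frob v ^+ 2)%:E)%E.
Proof.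
move=> dF mF HM.
have mI : measurable I01 by exact: measurable_itv.
have muI : (mu I01 = 1)%E by rewrite lebesgue_measure_itv/= lte_fin ltr01 sube0.
pose h (t : Xi * GR) := (frob (JF F (y + t.2 *: v) t.1) ^+ 2 * frob v ^+ 2 : R).
have mZ : measurable_mx (fun t : Xi * GR => y + t.2 *: v).
  apply: measurable_mxD; first exact: measurable_mx_cst.
  by move=> i j; under eq_fun do rewrite mxE; apply: measurable_funM => //; exact: measurable_snd.
have mh : measurable_fun [set: Xi * GR] h.
  apply: measurable_funM => //; apply: measurable_sqr_frob.
  apply: (@measurable_mx_Jac _ _ (Xi * GR)%type p q (fun z t => F z t.1) (fun t : Xi * GR => y + t.2 *: v)) => //.
  by move=> z i j; apply: (measurableT_comp (mF z i j)); exact: measurable_fst.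
have h0 t : 0 <= h t by rewrite mulr_ge0 ?sqr_ge0.
pose k (t : Xi * GR) : \bar R := ((h t)%:E * (\1_I01 t.2)%:E)%E.
have mk : measurable_fun [set: Xi * GR] k.
  apply: emeasurable_funM; first exact/measurable_EFinP.
  apply/measurable_EFinP; apply: (measurableT_comp (measurable_indic mI)); exact: measurable_snd.
have k0 t : (0 <= k t)%E by rewrite mule_ge0// lee_fin.
(* The restriction to the unit interval is put into the integrand [k], so that
   both integrals of the double integral run over whole spaces. *)
have E1 xi : ((frob (F (y + v)%R xi - F y xi) ^+ 2)%:E <= \int[mu]_s k (xi, s))%E.
  apply: (le_trans (@sqr_frob_increment_le (F^~ xi) y v _)) => //.
  rewrite [leLHS]integral_mkcond le_eqVlt; apply/orP; left; apply/eqP.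
  by apply: eq_integral => s _; rewrite epatch_indic.
have mfrob : measurable_fun [set: Xi] (fun xi => (frob (F (y + v) xi - F y xi) ^+ 2)%:E : \bar R).
  apply/measurable_EFinP; apply: measurable_sqr_frob; apply: measurable_mxB; exact: mF.
apply: (@le_trans _ _ (\int[D]_xi \int[mu]_s k (xi, s))%E).
  apply: ge0_le_integral => //; first by move=> xi _; rewrite lee_fin sqr_ge0.
  exact: measurable_fun_fubini_tonelli_F.
rewrite (@fubini_tonelli _ _ Xi GR R D mu k)//.
apply: (@le_trans _ _ (\int[mu]_(s in I01) (cst (M * frob v ^+ 2)%:E) s)%E); last first.
  by rewrite (integral_cst mu mI) [X in (_ * X)%E]muI mule1.
rewrite [leRHS]integral_mkcond; apply: ge0_le_integral => //.
- by move=> s _; exact: integral_ge0.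
- exact: measurable_fun_fubini_tonelli_G.
- by apply/(measurable_restrictT _ _).1 => //.
move=> s _; rewrite patchE; case: ifPn => sI.
  have s01 : 0 <= s <= 1 by move: sI; rewrite inE/= in_itv.
  apply: (@le_trans _ _ ((frob v ^+ 2)%:E * \int[D]_xi (frob (JF F (y + s *: v) xi) ^+ 2)%:E)%E).
    rewrite -ge0_integralZl//; last by rewrite lee_fin sqr_ge0.
      rewrite le_eqVlt; apply/orP; left; apply/eqP; apply: eq_integral => xi _.
      by rewrite /k/= indicE sI mule1 -EFinM mulrC.
      apply/measurable_EFinP; apply: measurable_sqr_frob.
      apply: (@measurable_mx_Jac _ _ Xi p q F (fun=> y + s *: v)) => //.
    by move=> xi _; rewrite lee_fin sqr_ge0.
  have -> : (cst (M * frob v ^+ 2)%:E s = (frob v ^+ 2)%:E * M%:E :> \bar R)%E by rewrite /= -EFinM mulrC.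
  apply: lee_wpmul2l; last exact: HM.
  by rewrite lee_fin sqr_ge0.
rewrite le_eqVlt; apply/orP; left; apply/eqP; apply: integral0_eq => xi _.
by rewrite /k/= indicE (negbTE sI) mule0.
Qed.
End second_moment.

(** * Fresh samples and orthogonality *)

Section joint_law.
Context {R : realType} {d1 d2 d3 : measure_display} {Om : measurableType d1}
  {E : measurableType d2} {E' : measurableType d3}.
Context (Pr : probability Om R) (m2 : probability E' R) (Z : Om -> E) (Y : Om -> E').
Hypotheses (mZ : measurable_fun [set: Om] Z) (mY : measurable_fun [set: Om] Y).
Hypothesis indep : forall A B, measurable A -> measurable B ->
  (Pr (Z @^-1` A `&` Y @^-1` B) = Pr (Z @^-1` A) * m2 B)%E.

Let ZY w := (Z w, Y w).
Let mZY : measurable_fun [set: Om] ZY. Proof. exact: measurable_fun_pair. Qed.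

Let Zp : {mfun Om >-> E} := HB.pack Z (isMeasurableFun.Build _ _ _ _ Z mZ).
Let ZYp : {mfun Om >-> (E * E')%type} := HB.pack ZY (isMeasurableFun.Build _ _ _ _ ZY mZY).
Let m1 : probability E R := distribution Pr Zp.
Let m12 : probability (E * E')%type R := distribution Pr ZYp.

(** Independence says that the joint law is the product measure, which is
    determined by its values on rectangles. *)
Lemma joint_law A : measurable A -> (m1 \x m2)%E A = m12 A.
Proof.
by move=> mA; apply: product_measure_unique.
Qed.

Lemma joint_ge0_integral (f : E * E' -> \bar R) :
  measurable_fun [set: E * E'] f -> (forall z, 0 <= f z)%E ->
  (\int[Pr]_w f (Z w, Y w) = \int[Pr]_w \int[m2]_y f (Z w, y))%E.
Proof.
move=> mf f0.
transitivity (\int[m12]_z f z)%E.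
  by rewrite ge0_integral_distribution.
transitivity (\int[(m1 \x m2)%E]_z f z)%E.
  by apply: eq_measure_integral => A mA _; exact: (esym (joint_law mA)).
rewrite (fubini_tonelli1 f mf f0) ge0_integral_distribution//.
  exact: measurable_fun_fubini_tonelli_F.
by move=> z; apply: integral_ge0.
Qed.

(** Fubini's theorem needs integrability for the product measure; it is read off
    from integrability under [Pr]. *)
Lemma joint_integral0 (f : E * E' -> R) : measurable_fun [set: E * E'] f ->
  Pr.-integrable [set: Om] (fun w => (f (Z w, Y w))%:E) ->
  (forall z, \int[m2]_y (f (z, y))%:E = 0)%E ->
  (\int[Pr]_w (f (Z w, Y w))%:E = 0)%E.
Proof.
move=> mf intf f0.
have mEf : measurable_fun [set: E * E'] (EFin \o f) by exact/measurable_EFinP.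
transitivity (\int[m12]_z (f z)%:E)%E.
  by rewrite (@integral_distribution _ _ _ _ _ Pr ZYp _ mEf intf).
transitivity (\int[(m1 \x m2)%E]_z (f z)%:E)%E.
  by apply: eq_measure_integral => A mA _; exact: (esym (joint_law mA)).
have int12 : (m1 \x m2)%E.-integrable [set: E * E'] (EFin \o f).
  apply/integrableP; split => //.
  have /integrableP[_] := intf; apply: le_lt_trans.
  have mnf : measurable_fun [set: E * E'] (fun z => `|(EFin \o f) z|)%E by exact: measurableT_comp.
  rewrite -(@ge0_integral_distribution _ _ _ _ _ Pr ZYp _ mnf)//.
  rewrite le_eqVlt; apply/orP; left; apply/eqP.
  by apply: eq_measure_integral => A mA _; exact: joint_law.
rewrite -(integral12_prod_meas1 int12).
by apply: integral0_eq => z _; exact: f0.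
Qed.

End joint_law.

Section second_moments.
Context {R : realType} {d : measure_display} {Om : measurableType d} (Pr : probability Om R).
Implicit Types U V : Om -> R.

(** Second moments are kept in the extended reals, so that they can be compared
    before they are known to be finite. *)
Definition mom2 V : \bar R := (\int[Pr]_w ((V w) ^+ 2)%:E)%E.
Definition sqint V : Prop := measurable_fun [set: Om] V /\ (mom2 V < +oo)%E.

Lemma mom2_ge0 V : (0 <= mom2 V)%E.
Proof. by apply: integral_ge0 => w _; rewrite lee_fin sqr_ge0. Qed.

Let msqr V : measurable_fun [set: Om] V -> measurable_fun [set: Om] (fun w => ((V w) ^+ 2)%:E : \bar R).
Proof. by move=> mV; apply/measurable_EFinP; exact: measurable_funX. Qed.

Lemma sqint_integrable_sqr V : sqint V -> Pr.-integrable [set: Om] (fun w => ((V w) ^+ 2)%:E).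
Proof.
move=> [mV V2]; apply/integrableP; split; first exact: msqr.
by under eq_integral => w _ do rewrite gee0_abs ?lee_fin ?sqr_ge0//.
Qed.

Lemma sqint_integrable_mul U V : sqint U -> sqint V ->
  Pr.-integrable [set: Om] (fun w => (U w * V w)%:E).
Proof.
move=> sU sV.
apply: (@le_integrable _ _ _ _ _ _ _ (fun w => ((U w) ^+ 2)%:E + ((V w) ^+ 2)%:E)%E) => //.
- by apply/measurable_EFinP; apply: measurable_funM; [exact: sU.1|exact: sV.1].
- move=> w _; rewrite -EFinD !abse_EFin lee_fin normrM [leRHS]ger0_norm ?addr_ge0 ?sqr_ge0//.
  rewrite -[U w ^+ 2]real_normK ?num_real// -[V w ^+ 2]real_normK ?num_real//.
  have := sqr_ge0 (`|U w| - `|V w|); have := normr_ge0 (U w); have := normr_ge0 (V w).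
  move: (`|U w|) (`|V w|) => u v u0 v0; rewrite sqrrB => h.
  have uv : 0 <= u * v by rewrite mulr_ge0.
  lra.
- by apply: integrableD => //; exact: sqint_integrable_sqr.
Qed.

Lemma mom2Z a V : measurable_fun [set: Om] V -> mom2 (fun w => a * V w) = ((a ^+ 2)%:E * mom2 V)%E.
Proof.
move=> mV; rewrite /mom2 -ge0_integralZl//; first last.
- by rewrite lee_fin sqr_ge0.
- by move=> w _; rewrite lee_fin sqr_ge0.
- exact: msqr.
by apply: eq_integral => w _; rewrite exprMn EFinM.
Qed.

Lemma mom2D_le U V : measurable_fun [set: Om] U -> measurable_fun [set: Om] V ->
  (mom2 (fun w => (U w + V w)%R) <= 2%:E * mom2 U + 2%:E * mom2 V)%E.
Proof.
move=> mU mV; rewrite /mom2 -!ge0_integralZl//;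
  [|exact: msqr|by move=> w _; rewrite lee_fin sqr_ge0|exact: msqr|by move=> w _; rewrite lee_fin sqr_ge0].
rewrite -ge0_integralD//; first last.
- by apply: measurable_funeM; exact: msqr.
- by move=> w _; rewrite -EFinM lee_fin mulr_ge0 ?sqr_ge0.
- by apply: measurable_funeM; exact: msqr.
- by move=> w _; rewrite -EFinM lee_fin mulr_ge0 ?sqr_ge0.
apply: ge0_le_integral => //.
- by move=> w _; rewrite lee_fin sqr_ge0.
- by apply: msqr; exact: measurable_funD.
- by apply: emeasurable_funD; apply: measurable_funeM; exact: msqr.
move=> w _; rewrite -!EFinM -EFinD lee_fin.
by have := sqr_ge0 (U w - V w); rewrite sqrrB sqrrD; lra.
Qed.

Lemma sqintD U V : sqint U -> sqint V -> sqint (fun w => U w + V w).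
Proof.
move=> [mU U2] [mV V2]; split; first exact: measurable_funD.
apply: (le_lt_trans (mom2D_le mU mV)).
by rewrite lte_add_pinfty// lte_mul_pinfty.
Qed.

Lemma sqintZ a V : sqint V -> sqint (fun w => a * V w).
Proof.
move=> [mV V2]; split; first exact: measurable_funM.
by rewrite mom2Z// lte_mul_pinfty// lee_fin sqr_ge0.
Qed.

Lemma sqint0 : sqint (fun=> 0).
Proof.
by split => //; rewrite /mom2; under eq_integral do rewrite expr0n/=; rewrite integral0 ltry.
Qed.

Lemma sqint_sum (I : Type) (s : seq I) (Y : I -> Om -> R) :
  (forall i, sqint (Y i)) -> sqint (fun w => \sum_(i <- s) Y i w).
Proof.
move=> sY; elim: s => [|i s IH].
  by under eq_fun do rewrite big_nil; exact: sqint0.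
by under eq_fun do rewrite big_cons; exact: sqintD.
Qed.

Definition orthogonal_rv U V : Prop := (\int[Pr]_w (U w * V w)%:E = 0)%E.

Lemma orthogonal_rvC U V : orthogonal_rv U V -> orthogonal_rv V U.
Proof. by rewrite /orthogonal_rv => <-; apply: eq_integral => w _; rewrite mulrC. Qed.

Lemma orthogonal_rvZr a U V : sqint U -> sqint V ->
  orthogonal_rv U V -> orthogonal_rv U (fun w => a * V w).
Proof.
move=> sU sV UV; rewrite /orthogonal_rv.
under eq_integral do rewrite mulrCA EFinM.
by rewrite integralZl//; [rewrite UV mule0|exact: sqint_integrable_mul].
Qed.

Lemma orthogonal_rvDr U V W : sqint U -> sqint V -> sqint W ->
  orthogonal_rv U V -> orthogonal_rv U W -> orthogonal_rv U (fun w => V w + W w).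
Proof.
move=> sU sV sW UV UW; rewrite /orthogonal_rv.
under eq_integral do rewrite mulrDr EFinD.
rewrite integralD//; [by rewrite UV UW adde0| |]; exact: sqint_integrable_mul.
Qed.

Lemma orthogonal_rv_sumr (I : eqType) (s : seq I) U (Y : I -> Om -> R) :
  sqint U -> (forall i, sqint (Y i)) -> (forall i, i \in s -> orthogonal_rv U (Y i)) ->
  orthogonal_rv U (fun w => \sum_(i <- s) Y i w).
Proof.
move=> sU sY; elim: s => [|i s IH] H.
  by rewrite /orthogonal_rv; under eq_integral do rewrite big_nil mulr0; rewrite integral0.
under eq_fun do rewrite big_cons.
apply: orthogonal_rvDr => //; first exact: sqint_sum.
  by apply: H; rewrite mem_head.
by apply: IH => j js; apply: H; rewrite in_cons js orbT.
Qed.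

Lemma mom2D_orthogonal U V : sqint U -> sqint V -> orthogonal_rv U V ->
  mom2 (fun w => U w + V w) = (mom2 U + mom2 V)%E.
Proof.
move=> sU sV UV; rewrite /mom2.
have -> : (\int[Pr]_w ((U w + V w) ^+ 2)%:E =
   \int[Pr]_w ((((U w) ^+ 2)%:E + ((V w) ^+ 2)%:E) + 2%:E * (U w * V w)%:E))%E.
  by apply: eq_integral => w _; rewrite -EFinM -!EFinD; congr EFin; ring.
have iU := sqint_integrable_sqr sU; have iV := sqint_integrable_sqr sV.
have iUV := sqint_integrable_mul sU sV.
rewrite integralD//; [|exact: integrableD|exact: integrableZl].
by rewrite integralD// integralZl// UV mule0 adde0.
Qed.

(** Pythagoras: this is where averaging over a mini-batch divides the variance by
    its size. *)
Lemma mom2_sum_orthogonal (I : eqType) (s : seq I) (Y : I -> Om -> R) : uniq s ->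
  (forall i, sqint (Y i)) ->
  (forall i j, i != j -> orthogonal_rv (Y i) (Y j)) ->
  mom2 (fun w => \sum_(i <- s) Y i w) = (\sum_(i <- s) mom2 (Y i))%E.
Proof.
move=> us sY oY; elim: s us => [_|i s IH /= /andP[nis us]].
  by rewrite big_nil /mom2; under eq_integral do rewrite big_nil expr0n/=; rewrite integral0.
rewrite big_cons -IH//.
have -> : (fun w => \sum_(j <- i :: s) Y j w) = (fun w => Y i w + \sum_(j <- s) Y j w).
  by apply/funext => w; rewrite big_cons.
rewrite mom2D_orthogonal//; first exact: sqint_sum.
apply: orthogonal_rv_sumr => // j js; apply: oY.
by apply: contra nis => /eqP ->.
Qed.

End second_moments.

(** [gensP] generates the sigma-algebra of the past and [gensN] that of the new
    samples. A random variable that depends on the past and on one new sample is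
    written [g (w, X w)], where [g] is a function on the product of the past, seen
    as a measurable space of its own, and the sample space. *)
Section fresh.
Context {R : realType} {d d' : measure_display} {Xi : measurableType d} {Om : measurableType d'}.
Context (D : probability Xi R) (Pr : probability Om R) (gensP gensN : set_system Om).
Hypotheses (gensP_sub : gensP `<=` measurable) (gensN_sub : gensN `<=` measurable)
  (indepNP : indep_systems Pr <<s gensN>> <<s gensP>>).
Local Notation Past := (g_sigma_algebraType gensP).
Local Notation New := (g_sigma_algebraType gensN).

Lemma g_sigma_sub (G : set_system Om) : G `<=` measurable -> <<s G>> `<=` measurable.
Proof. by move=> GM; apply: smallest_sub => //; exact: sigma_algebra_measurable. Qed.

Lemma measurable_fun_past d3 (E : measurableType d3) (G : set_system Om) (f : Om -> E) :
  G `<=` measurable ->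
  measurable_fun [set: g_sigma_algebraType G] (f : g_sigma_algebraType G -> E) ->
  measurable_fun [set: Om] f.
Proof. by move=> GM mf _ B mB; apply: (g_sigma_sub GM); exact: mf. Qed.

Lemma measurable_id_past : measurable_fun [set: Om] (id : Om -> Past).
Proof. by move=> _ B mB; rewrite setTI; exact: (g_sigma_sub gensP_sub). Qed.

Definition law (X : Om -> Xi) : Prop := forall B, measurable B -> Pr (X @^-1` B) = D B.
Definition indep_pair (X Y : Om -> Xi) : Prop := forall A B, measurable A -> measurable B ->
  (Pr (X @^-1` A `&` Y @^-1` B) = D A * D B)%E.
Local Notation new X := (measurable_fun [set: New] (X : New -> Xi)).

Let past_new d3 (E' : measurableType d3) (X : Om -> E') A B :
  measurable_fun [set: New] (X : New -> E') -> <<s gensP>> A -> measurable B ->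
  (Pr (id @^-1` A `&` X @^-1` B) = Pr (id @^-1` A) * Pr (X @^-1` B))%E.
Proof.
move=> mX mA mB; rewrite setIC muleC; apply: indepNP => //.
by have := mX measurableT _ mB; rewrite setTI.
Qed.

(** The second moment of [g (w, X w)] after integrating out the fresh sample: the
    law of the sample replaces the sample itself. *)
Definition fresh_mom2 (g : Past * Xi -> R) : \bar R := (\int[Pr]_w \int[D]_xi ((g (w, xi)) ^+ 2)%:E)%E.

(** The identity map from [Om] to the past and the new sample [X] are
    independent. *)
Lemma mom2_fresh X (g : Past * Xi -> R) : new X -> law X -> measurable_fun [set: Past * Xi] g ->
  mom2 Pr (fun w => g (w, X w)) = fresh_mom2 g.
Proof.
move=> nX lX mg.
apply: (@joint_ge0_integral _ _ _ _ Om Past Xi Pr D id X measurable_id_past _ _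
   (fun z => ((g z) ^+ 2)%:E)).
- exact: measurable_fun_past nX.
- by move=> A B mA mB; rewrite past_new// lX.
- by apply/measurable_EFinP; exact: measurable_funX.
- by move=> z; rewrite lee_fin sqr_ge0.
Qed.

Let measurable_g_fresh X (g : Past * Xi -> R) : new X -> measurable_fun [set: Past * Xi] g ->
  measurable_fun [set: Om] (fun w => g (w, X w)).
Proof.
move=> nX mg; apply: (measurableT_comp mg); apply: measurable_fun_pair.
  exact: measurable_id_past.
exact: measurable_fun_past nX.
Qed.

Lemma sqint_fresh X (g : Past * Xi -> R) : new X -> law X -> measurable_fun [set: Past * Xi] g ->
  (fresh_mom2 g < +oo)%E -> sqint Pr (fun w => g (w, X w)).
Proof. by move=> nX lX mg Sg; split; [exact: measurable_g_fresh|rewrite mom2_fresh]. Qed.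

Definition centered (g : Past * Xi -> R) : Prop := forall w,
  D.-integrable [set: Xi] (fun xi => (g (w, xi))%:E) /\ (\int[D]_xi (g (w, xi))%:E = 0)%E.

Lemma orthogonal_past X (u : Past -> R) (g : Past * Xi -> R) :
  new X -> law X -> measurable_fun [set: Past] u -> sqint Pr u ->
  measurable_fun [set: Past * Xi] g -> (fresh_mom2 g < +oo)%E -> centered g ->
  orthogonal_rv Pr u (fun w => g (w, X w)).
Proof.
move=> nX lX mu su mg Sg cg.
apply: (@joint_integral0 _ _ _ _ Om Past Xi Pr D id X measurable_id_past _ _
   (fun z => u z.1 * g z)).
- exact: measurable_fun_past nX.
- by move=> A B mA mB; rewrite past_new// lX.
- by apply: measurable_funM => //; apply: (measurableT_comp mu); exact: measurable_fst.
- by apply: sqint_integrable_mul => //; exact: sqint_fresh.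
- move=> w /=; under eq_integral do rewrite EFinM.
  by have [ig g0] := cg w; rewrite integralZl// g0 mule0.
Qed.

(** The product of independent integrable variables is integrable and its mean is
    the product of the means; only one factor has to be centered. *)
Let indep_mul0 X Y (h1 h2 : Xi -> R) :
  measurable_fun [set: Om] X -> measurable_fun [set: Om] Y -> law X -> law Y -> indep_pair X Y ->
  D.-integrable [set: Xi] (EFin \o h1) -> D.-integrable [set: Xi] (EFin \o h2) ->
  (\int[D]_xi (h2 xi)%:E = 0)%E ->
  Pr.-integrable [set: Om] (fun w => (h1 (X w) * h2 (Y w))%:E) /\
  (\int[Pr]_w (h1 (X w) * h2 (Y w))%:E = 0)%E.
Proof.
move=> mX mY lX lY iXY i1 i2 h20.
have iXY' A B : measurable A -> measurable B ->
    (Pr (X @^-1` A `&` Y @^-1` B) = Pr (X @^-1` A) * D B)%E.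
  by move=> mA mB; rewrite iXY// lX.
have mh1 : measurable_fun [set: Xi] h1 by have /integrableP[/measurable_EFinP] := i1.
have mh2 : measurable_fun [set: Xi] h2 by have /integrableP[/measurable_EFinP] := i2.
have m12 : measurable_fun [set: Xi * Xi] (fun z => h1 z.1 * h2 z.2).
  by apply: measurable_funM; [apply: (measurableT_comp mh1); exact: measurable_fst|
    apply: (measurableT_comp mh2); exact: measurable_snd].
have fin1 : (\int[D]_xi `|(h1 xi)%:E| < +oo)%E by have /integrableP[] := i1.
have fin2 : (\int[D]_xi `|(h2 xi)%:E| < +oo)%E by have /integrableP[] := i2.
have int12 : Pr.-integrable [set: Om] (fun w => (h1 (X w) * h2 (Y w))%:E).
  apply/integrableP; split.
    by apply/measurable_EFinP; apply: measurable_funM; exact: measurableT_comp.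
  rewrite (@joint_ge0_integral _ _ _ _ Om Xi Xi Pr D X Y mX mY iXY'
    (fun z => `|(h1 z.1 * h2 z.2)%:E|%E)) => [||z]//; last first.
    by apply: measurableT_comp => //; exact/measurable_EFinP.
  have E x : (\int[D]_y `|(h1 x * h2 y)%:E| = `|(h1 x)%:E| * \int[D]_y `|(h2 y)%:E|)%E.
    rewrite -ge0_integralZl//; first by apply: eq_integral => y _; rewrite EFinM abseM.
    by apply: measurableT_comp => //; exact/measurable_EFinP.
  rewrite (eq_integral (fun w => `|(h1 (X w))%:E| * \int[D]_y `|(h2 y)%:E|)%E); last first.
    by move=> w _; exact: E.
  have mX1 : measurable_fun [set: Om] (fun w => `|(h1 (X w))%:E|%E).
    by apply: measurableT_comp => //; apply/measurable_EFinP; exact: measurableT_comp.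
  rewrite ge0_integralZr//; last exact: integral_ge0.
  have -> : (\int[Pr]_w `|(h1 (X w))%:E| = \int[D]_xi `|(h1 xi)%:E|)%E.
    have mS : measurable_fun [set: Xi * Xi] (fun z => `|(h1 z.2)%:E|%E).
      apply: measurableT_comp => //; apply/measurable_EFinP.
      by apply: (measurableT_comp mh1); exact: measurable_snd.
    (* The change of variables to the law of [X] is the joint law of [X] with a
       constant. *)
    have iX A B : measurable A -> measurable B ->
        (Pr ((fun=> point : Xi) @^-1` A `&` X @^-1` B) = Pr ((fun=> point : Xi) @^-1` A) * D B)%E.
      move=> mA mB; rewrite !preimage_cst; case: ifP => _; first by rewrite setTI probability_setT mul1e lX.
      by rewrite set0I measure0 mul0e.
    rewrite (@joint_ge0_integral _ _ _ _ Om Xi Xi Pr D (fun=> point) X _ mX iX _ mS)//.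
    by rewrite /= integral_cst//= probability_setT mule1.
  by rewrite lte_mul_pinfty ?integral_ge0// ge0_fin_numE ?integral_ge0.
split=> //.
apply: (@joint_integral0 _ _ _ _ Om Xi Xi Pr D X Y mX mY iXY' (fun z => h1 z.1 * h2 z.2)) => //.
move=> z /=; under eq_integral do rewrite EFinM.
by rewrite integralZl// h20 mule0.
Qed.

(** Given the past, the two variables are centered functions of independent
    samples, so the conditional mean of their product is 0. *)
Lemma orthogonal_new (X Y : Om -> Xi) (g1 g2 : Past * Xi -> R) :
  new X -> new Y -> law X -> law Y -> indep_pair X Y ->
  measurable_fun [set: Past * Xi] g1 -> measurable_fun [set: Past * Xi] g2 ->
  (fresh_mom2 g1 < +oo)%E -> (fresh_mom2 g2 < +oo)%E -> centered g1 -> centered g2 ->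
  orthogonal_rv Pr (fun w => g1 (w, X w)) (fun w => g2 (w, Y w)).
Proof.
move=> nX nY lX lY iXY mg1 mg2 S1 S2' c1 c2.
have mX := measurable_fun_past gensN_sub nX.
have mY := measurable_fun_past gensN_sub nY.
pose XY (w : Om) := (X w, Y w).
have nXY : measurable_fun [set: New] (XY : New -> (Xi * Xi)%type) by exact: measurable_fun_pair.
have mXY : measurable_fun [set: Om] XY by exact: measurable_fun_past nXY.
pose XYp : {mfun Om >-> (Xi * Xi)%type} := HB.pack XY (isMeasurableFun.Build _ _ _ _ XY mXY).
have mf : measurable_fun [set: Past * (Xi * Xi)] (fun z => g1 (z.1, z.2.1) * g2 (z.1, z.2.2)).
  apply: measurable_funM.
    apply: (measurableT_comp mg1); apply: measurable_fun_pair; first exact: measurable_fst.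
    by apply: (measurableT_comp measurable_fst); exact: measurable_snd.
  apply: (measurableT_comp mg2); apply: measurable_fun_pair; first exact: measurable_fst.
  by apply: (measurableT_comp measurable_snd); exact: measurable_snd.
apply: (@joint_integral0 _ _ _ _ Om Past (Xi * Xi)%type Pr (distribution Pr XYp) id XY
   measurable_id_past mXY _ _ mf).
- by move=> A B mA mB; rewrite past_new.
- by apply: sqint_integrable_mul; exact: sqint_fresh.
move=> w; have [i1 _] := c1 w; have [i2 g20] := c2 w.
have mfw : measurable_fun [set: Xi * Xi] (fun z => (g1 (w, z.1) * g2 (w, z.2))%:E).
  apply/measurable_EFinP; exact: (measurable_fun_pair2 (w : Past) mf).
have [imul mul0] := indep_mul0 mX mY lX lY iXY i1 i2 g20.
by rewrite (@integral_distribution _ _ _ _ _ Pr XYp _ mfw imul).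
Qed.

Let measurable_past_Om (u : Past -> R) : measurable_fun [set: Past] u ->
  measurable_fun [set: Om] (u : Om -> R).
Proof. exact: measurable_fun_past. Qed.

Section minibatch.
Variables (b : nat) (X : 'I_b -> Om -> Xi) (g : Past * Xi -> R).
Hypotheses (nX : forall i, new (X i)) (lX : forall i, law (X i))
  (iX : forall i j, i != j -> indep_pair (X i) (X j))
  (mg : measurable_fun [set: Past * Xi] g) (Sg : (fresh_mom2 g < +oo)%E) (cg : centered g).

Lemma sqint_minibatch (c : R) : sqint Pr (fun w => c / b%:R * \sum_(i < b) g (w, X i w)).
Proof. by apply: sqintZ; apply: sqint_sum => i; exact: sqint_fresh. Qed.

Lemma mom2_minibatch (c : R) : (0 < b)%N ->
  mom2 Pr (fun w => c / b%:R * \sum_(i < b) g (w, X i w)) = ((c ^+ 2 / b%:R)%:E * fresh_mom2 g)%E.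
Proof.
move=> b0; have sg i : sqint Pr (fun w => g (w, X i w)) by exact: sqint_fresh.
rewrite mom2Z; last by have [] := sqint_sum (index_enum 'I_b) sg.
rewrite (mom2_sum_orthogonal (index_enum_uniq _) sg); last first.
  by move=> i j ij; apply: orthogonal_new => //; exact: iX.
under eq_bigr do rewrite mom2_fresh//.
have Sfin : fresh_mom2 g \is a fin_num.
  by rewrite ge0_fin_numE//; apply: integral_ge0 => w _; apply: integral_ge0 => xi _; rewrite lee_fin sqr_ge0.
rewrite -(fineK Sfin) sumEFin -!EFinM; congr EFin.
rewrite sumr_const card_ord -mulr_natl; field.
by rewrite pnatr_eq0 -lt0n.
Qed.

Lemma orthogonal_past_minibatch (u : Past -> R) (c : R) :
  measurable_fun [set: Past] u -> sqint Pr u ->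
  orthogonal_rv Pr u (fun w => c / b%:R * \sum_(i < b) g (w, X i w)).
Proof.
move=> mu su; have sg i : sqint Pr (fun w => g (w, X i w)) by exact: sqint_fresh.
apply: orthogonal_rvZr => //; first exact: sqint_sum.
by apply: orthogonal_rv_sumr => // i _; exact: orthogonal_past.
Qed.

End minibatch.

(** The error of a hybrid estimator splits into the old error, which belongs to
    the past, and two averages that are orthogonal to it. If the batches are
    independent then these are orthogonal to each other; otherwise
    [(a + c)^2 <= 2 a^2 + 2 c^2] costs the factor [kap = 2]. *)
Lemma hybrid_estimator_step (b1 b2 : nat) (X1 : 'I_b1 -> Om -> Xi) (X2 : 'I_b2 -> Om -> Xi)
    (u : Past -> R) (g1 g2 : Past * Xi -> R) (beta kap : R) :
  (0 < b1)%N -> (0 < b2)%N ->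
  (forall i, new (X1 i)) -> (forall i, law (X1 i)) ->
  (forall i j, i != j -> indep_pair (X1 i) (X1 j)) ->
  (forall i, new (X2 i)) -> (forall i, law (X2 i)) ->
  (forall i j, i != j -> indep_pair (X2 i) (X2 j)) ->
  kap = 2 \/ kap = 1 /\ (forall i j, indep_pair (X1 i) (X2 j)) ->
  measurable_fun [set: Past] u -> sqint Pr u ->
  measurable_fun [set: Past * Xi] g1 -> (fresh_mom2 g1 < +oo)%E -> centered g1 ->
  measurable_fun [set: Past * Xi] g2 -> (fresh_mom2 g2 < +oo)%E -> centered g2 ->
  let V w := beta * u w + (beta / b1%:R * \sum_(i < b1) g1 (w, X1 i w)
     + (1 - beta) / b2%:R * \sum_(i < b2) g2 (w, X2 i w)) in
  sqint Pr V /\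
  (mom2 Pr V <= (beta ^+ 2)%:E * mom2 Pr u
     + kap%:E * ((beta ^+ 2 / b1%:R)%:E * fresh_mom2 g1 + ((1 - beta) ^+ 2 / b2%:R)%:E * fresh_mom2 g2))%E.
Proof.
move=> b10 b20 n1 l1 i1 n2 l2 i2 kapE mu su mg1 S1 c1 mg2 S2' c2 V.
set A1 := fun w => beta / b1%:R * \sum_(i < b1) g1 (w, X1 i w).
set A2 := fun w => (1 - beta) / b2%:R * \sum_(i < b2) g2 (w, X2 i w).
have s1 : sqint Pr A1 by exact: sqint_minibatch.
have s2 : sqint Pr A2 by exact: sqint_minibatch.
have s12 : sqint Pr (fun w => A1 w + A2 w) by exact: sqintD.
have sbu : sqint Pr (fun w => beta * u w) by exact: sqintZ.
split; first exact: sqintD.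
have o1 : orthogonal_rv Pr u A1 by exact: orthogonal_past_minibatch.
have o2 : orthogonal_rv Pr u A2 by exact: orthogonal_past_minibatch.
have o12 : orthogonal_rv Pr (fun w => beta * u w) (fun w => A1 w + A2 w).
  by apply/orthogonal_rvC/orthogonal_rvZr => //; apply/orthogonal_rvC/orthogonal_rvDr.
rewrite /V (mom2D_orthogonal sbu s12 o12) mom2Z; last exact: measurable_past_Om.
rewrite leeD2l// -(mom2_minibatch n1 l1 i1 mg1 S1 c1 beta b10).
rewrite -(mom2_minibatch n2 l2 i2 mg2 S2' c2 (1 - beta) b20) -/A1 -/A2.
case: kapE => [->|[-> i12]].
  by rewrite ge0_muleDr ?mom2_ge0//; apply: mom2D_le; [exact: s1.1|exact: s2.1].
rewrite mul1e mom2D_orthogonal//.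
have sg1 i : sqint Pr (fun w => g1 (w, X1 i w)) by exact: sqint_fresh.
have sg2 i : sqint Pr (fun w => g2 (w, X2 i w)) by exact: sqint_fresh.
apply: orthogonal_rvZr => //; first exact: sqint_sum.
apply: orthogonal_rv_sumr => // j _; apply: orthogonal_rvC.
apply: orthogonal_rvZr => //; first exact: sqint_sum.
apply: orthogonal_rv_sumr => // i _; apply: orthogonal_rvC.
by apply: orthogonal_new => //; exact: i12.
Qed.

End fresh.

(** * Hybrid mini-batch estimators *)

Section mean_square.
Context {R : realType} {d : measure_display} {Om : measurableType d} (Pr : probability Om R).

Definition mean_square m n (V : Om -> 'M[R]_(m, n)) : \bar R := (\int[Pr]_w (frob (V w) ^+ 2)%:E)%E.

Lemma mean_square_ge0 m n (V : Om -> 'M[R]_(m, n)) : (0 <= mean_square V)%E.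
Proof. by apply: integral_ge0 => w _; rewrite lee_fin sqr_ge0. Qed.

Lemma mean_square_entries m n (V : Om -> 'M[R]_(m, n)) : measurable_mx V ->
  mean_square V = (\sum_(p : 'I_m * 'I_n) mom2 Pr (fun w => V w p.1 p.2))%E.
Proof.
move=> mV; rewrite /mom2 -ge0_integral_sum//.
- by apply: eq_integral => w _; rewrite sqr_frobE sumEFin.
- by move=> p; apply/measurable_EFinP; apply: measurable_funX; exact: mV.
- by move=> p w _; rewrite lee_fin sqr_ge0.
Qed.

Lemma mom2_entry_le m n (V : Om -> 'M[R]_(m, n)) (p : 'I_m * 'I_n) : measurable_mx V ->
  (mom2 Pr (fun w => V w p.1 p.2) <= mean_square V)%E.
Proof.
move=> mV; rewrite mean_square_entries// (bigD1 p)//= leeDl// sume_ge0// => i _; exact: mom2_ge0.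
Qed.

Lemma sqint_entry m n (V : Om -> 'M[R]_(m, n)) (p : 'I_m * 'I_n) : measurable_mx V ->
  (mean_square V < +oo)%E -> sqint Pr (fun w => V w p.1 p.2).
Proof. by move=> mV V2; split; [exact: mV|exact: le_lt_trans (mom2_entry_le p mV) V2]. Qed.

(** The bias-variance decomposition: a constant is orthogonal to a centered
    variable. *)
Lemma mom2_center (h : Om -> R) : Pr.-integrable [set: Om] (EFin \o h) -> (mom2 Pr h < +oo)%E ->
  let c := fine (\int[Pr]_w (h w)%:E) in
  mom2 Pr h = (mom2 Pr (fun w => (h w - c)%R) + (c ^+ 2)%:E)%E.
Proof.
move=> ih hoo c.
have mh : measurable_fun [set: Om] h by have /integrableP[/measurable_EFinP] := ih.
have sh : sqint Pr h by [].
have mom2c : mom2 Pr (fun=> c) = (c ^+ 2)%:E.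
  by rewrite /mom2 integral_cst//= probability_setT mule1.
have sc : sqint Pr (fun=> c) by split => //; rewrite mom2c ltry.
have shc : sqint Pr (fun w => h w - c).
  by have := sqintD sh (sqintZ (-1) sc); under eq_fun do rewrite mulN1r.
have o : orthogonal_rv Pr (fun w => h w - c) (fun=> c).
  rewrite /orthogonal_rv; under eq_integral do rewrite mulrBl EFinB [(_ * c)%R]mulrC EFinM.
  rewrite integralB//; first last.
  - exact: finite_measure_integrable_cst.
  - exact: integrableZl.
  rewrite integralZl//.
  have -> : (\int[Pr]_w (h w)%:E = c%:E)%E.
    by rewrite fineK//; exact: integrable_fin_num.
  by rewrite integral_cst//= probability_setT mule1 -EFinM subee.
have := mom2D_orthogonal shc sc o; under eq_fun do rewrite subrK.
by rewrite mom2c.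
Qed.

Lemma mom2_center_le (h : Om -> R) : Pr.-integrable [set: Om] (EFin \o h) ->
  (mom2 Pr (fun w => (h w - fine (\int[Pr]_w (h w)%:E))%R) <= mom2 Pr h)%E.
Proof.
move=> ih; have [hoo|] := ltP (mom2 Pr h) +oo%E; last by rewrite leye_eq => /eqP ->; rewrite leey.
by rewrite [leRHS]mom2_center// leeDl// lee_fin sqr_ge0.
Qed.

Lemma sqr_mean_le (h : Om -> R) : Pr.-integrable [set: Om] (EFin \o h) ->
  ((fine (\int[Pr]_w (h w)%:E) ^+ 2)%:E <= mom2 Pr h)%E.
Proof.
move=> ih; have [hoo|] := ltP (mom2 Pr h) +oo%E; last by rewrite leye_eq => /eqP ->; rewrite leey.
by rewrite [leRHS]mom2_center// leeDr// mom2_ge0.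
Qed.

End mean_square.

Section estimator.
Context {R : realType} {d d' : measure_display} {Xi : measurableType d} {Om : measurableType d'}.
Context (D : probability Xi R) (Pr : probability Om R).
Context {p m n : nat} (H : 'cV[R]_p -> Xi -> 'M[R]_(m, n)) (Hbar : 'cV[R]_p -> 'M[R]_(m, n)).
Variables (dom : set 'cV[R]_p) (sigma Lam : R).

(** What the analysis of the estimators uses of a stochastic function [H] with
    mean [Hbar]. It applies to [F] as well as to its Jacobian. The measurability
    fields cover random arguments, which joint measurability would give, but only
    differentiability in the first argument is available. *)
Record estimable : Prop := {
  est_meas : forall d3 (T : measurableType d3) (Z : T -> 'cV[R]_p) (X : T -> Xi),
     measurable_mx Z -> measurable_fun [set: T] X -> measurable_mx (fun t => H (Z t) (X t));
  est_meas_mean : forall d3 (T : measurableType d3) (Z : T -> 'cV[R]_p),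
     measurable_mx Z -> measurable_mx (fun t => Hbar (Z t));
  est_int : forall z, integrable_mx D (H z);
  est_mean : forall z, Hbar z = Emx D (H z);
  est_var : forall z, dom z -> (\int[D]_xi (frob (H z xi - Hbar z) ^+ 2)%:E <= (sigma ^+ 2)%:E)%E;
  est_lip : forall z z', dom z -> dom z' ->
     (\int[D]_xi (frob (H z xi - H z' xi) ^+ 2)%:E <= (Lam ^+ 2 * frob (z - z') ^+ 2)%:E)%E }.

Hypothesis hH : estimable.

Lemma est_mean_entry z i j : (\int[D]_xi (H z xi i j)%:E = (Hbar z i j)%:E)%E.
Proof.
rewrite (est_mean hH) mxE unlock fineK//.
by apply: integrable_fin_num => //; exact: (est_int hH).
Qed.

Lemma measurable_est z : measurable_mx (H z).
Proof. by move=> i j; have /integrableP[/measurable_EFinP] := est_int hH z i j. Qed.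

(** Jensen's inequality, applied entry by entry. *)
Lemma mean_increment_le z z' : dom z -> dom z' ->
  frob (Hbar z - Hbar z') ^+ 2 <= Lam ^+ 2 * frob (z - z') ^+ 2.
Proof.
move=> dz dz'; rewrite -lee_fin; apply: le_trans (est_lip hH dz dz').
rewrite sqr_frobE -sumEFin.
have mV : measurable_mx (fun xi => H z xi - H z' xi) by apply: measurable_mxB; exact: measurable_est.
rewrite [leRHS](mean_square_entries D mV); apply: lee_sum => q _.
have i1 := est_int hH z q.1 q.2; have i2 := est_int hH z' q.1 q.2.
have iD : D.-integrable [set: Xi] (EFin \o (fun xi => (H z xi - H z' xi) q.1 q.2)).
  by under [EFin \o _]eq_fun do rewrite /= !mxE EFinB; exact: integrableB.
apply: le_trans (sqr_mean_le iD).
under [X in fine X]eq_integral do rewrite !mxE EFinB.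
by rewrite integralB// !est_mean_entry -EFinB !mxE.
Qed.

Lemma sqr_frob_mean_le z c : (\int[D]_xi (frob (H z xi) ^+ 2)%:E <= c%:E)%E ->
  frob (Hbar z) ^+ 2 <= c.
Proof.
rewrite -lee_fin; apply: le_trans; rewrite sqr_frobE -sumEFin.
rewrite [leRHS](mean_square_entries D (measurable_est z)); apply: lee_sum => q _.
apply: le_trans (sqr_mean_le (est_int hH z q.1 q.2)).
by rewrite est_mean_entry.
Qed.

Section step.
Context (gensP gensN : set_system Om).
Hypotheses (gensP_sub : gensP `<=` measurable) (gensN_sub : gensN `<=` measurable)
  (indepNP : indep_systems Pr <<s gensN>> <<s gensP>>).
Local Notation Past := (g_sigma_algebraType gensP).
Local Notation New := (g_sigma_algebraType gensN).
Local Notation new X := (measurable_fun [set: New] (X : New -> Xi)).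

Variables (x x' : Past -> 'cV[R]_p) (mx : measurable_mx x) (mx' : measurable_mx x').
Hypotheses (dx : forall w, dom (x w)) (dx' : forall w, dom (x' w)).

Let g1 (q : 'I_m * 'I_n) (z : Past * Xi) : R :=
  (H (x z.1) z.2 - H (x' z.1) z.2 - (Hbar (x z.1) - Hbar (x' z.1))) q.1 q.2.
Let g2 (q : 'I_m * 'I_n) (z : Past * Xi) : R := (H (x z.1) z.2 - Hbar (x z.1)) q.1 q.2.

Let mHx (y : Past -> 'cV[R]_p) : measurable_mx y ->
  measurable_mx (fun z : Past * Xi => H (y z.1) z.2) /\
  measurable_mx (fun z : Past * Xi => Hbar (y z.1)).
Proof.
move=> my; have my1 : measurable_mx (fun z : Past * Xi => y z.1).
  by move=> i j; apply: (measurableT_comp (my i j)); exact: measurable_fst.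
by split; [apply: (est_meas hH) => //; exact: measurable_snd|exact: (est_meas_mean hH)].
Qed.

Let mg1 q : measurable_fun [set: Past * Xi] (g1 q).
Proof.
have [a b] := mHx mx; have [a' b'] := mHx mx'.
by apply: (measurable_mxB (measurable_mxB a a') (measurable_mxB b b')).
Qed.

Let mg2 q : measurable_fun [set: Past * Xi] (g2 q).
Proof. by have [a b] := mHx mx; apply: (measurable_mxB a b). Qed.

Let cg1 q : centered D (g1 q).
Proof.
move=> w; rewrite /g1/=.
have E : (fun xi => ((H (x w) xi - H (x' w) xi - (Hbar (x w) - Hbar (x' w))) q.1 q.2)%:E) =
  (fun xi => ((H (x w) xi q.1 q.2)%:E - (H (x' w) xi q.1 q.2)%:E) - (cst (Hbar (x w) q.1 q.2 - Hbar (x' w) q.1 q.2)%:E) xi)%E.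
  by apply/funext => xi; rewrite !mxE -!EFinB.
rewrite E; have i1 := est_int hH (x w) q.1 q.2; have i2 := est_int hH (x' w) q.1 q.2.
have i12 := integrableB measurableT i1 i2.
have ic : D.-integrable [set: Xi] (cst (Hbar (x w) q.1 q.2 - Hbar (x' w) q.1 q.2)%:E).
  exact: finite_measure_integrable_cst.
split; first exact: integrableB.
by rewrite integralB// integralB// !est_mean_entry integral_cst//= probability_setT mule1 -!EFinB subrr.
Qed.

Let cg2 q : centered D (g2 q).
Proof.
move=> w; rewrite /g2/=.
have E : (fun xi => ((H (x w) xi - Hbar (x w)) q.1 q.2)%:E) =
  (fun xi => (H (x w) xi q.1 q.2)%:E - (cst (Hbar (x w) q.1 q.2)%:E) xi)%E.
  by apply/funext => xi; rewrite !mxE -!EFinB.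
rewrite E; have i1 := est_int hH (x w) q.1 q.2.
have ic : D.-integrable [set: Xi] (cst (Hbar (x w) q.1 q.2)%:E).
  exact: finite_measure_integrable_cst.
split; first exact: integrableB.
by rewrite integralB// !est_mean_entry integral_cst//= probability_setT mule1 -!EFinB subrr.
Qed.

(* Passes from entries, where orthogonality is available, to Frobenius norms. *)
Let sumS2 (G : Past * Xi -> 'M[R]_(m, n)) : measurable_mx G ->
  (\sum_(q : 'I_m * 'I_n) fresh_mom2 D Pr (fun z : Past * Xi => G z q.1 q.2)
    = \int[Pr]_w \int[D]_xi (frob (G ((w : Past), xi)) ^+ 2)%:E)%E.
Proof.
move=> mG.
have mGq (q : 'I_m * 'I_n) : measurable_fun [set: Past * Xi] (fun z => ((G z q.1 q.2) ^+ 2)%:E : \bar R).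
  by apply/measurable_EFinP; apply: measurable_funX; exact: mG.
rewrite -ge0_integral_sum//.
- apply: eq_integral => w _; rewrite -ge0_integral_sum//.
  + by apply: eq_integral => xi _; rewrite sqr_frobE sumEFin.
  + by move=> q; exact: (measurable_fun_pair2 (w : Past) (mGq q)).
  + by move=> q xi _; rewrite lee_fin sqr_ge0.
- move=> q; apply: (measurable_fun_past gensP_sub).
  apply: (measurable_fun_fubini_tonelli_F (m2 := D) (fun z : Past * Xi => ((G z q.1 q.2) ^+ 2)%:E)) => //.
  by move=> z; rewrite lee_fin sqr_ge0.
- by move=> q w _; apply: integral_ge0 => xi _; rewrite lee_fin sqr_ge0.
Qed.

Let S2_sum_lt (G : Past * Xi -> 'M[R]_(m, n)) q : measurable_mx G ->
  (\int[Pr]_w \int[D]_xi (frob (G ((w : Past), xi)) ^+ 2)%:E < +oo)%E ->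
  (fresh_mom2 D Pr (fun z : Past * Xi => G z q.1 q.2) < +oo)%E.
Proof.
move=> mG; rewrite -sumS2// (bigD1 q)//=; apply: le_lt_trans.
rewrite leeDl// sume_ge0// => i _; apply: integral_ge0 => w _; apply: integral_ge0 => xi _.
by rewrite lee_fin sqr_ge0.
Qed.

Let G2 (z : Past * Xi) := H (x z.1) z.2 - Hbar (x z.1).
Let mG2 : measurable_mx G2.
Proof. by have [a b] := mHx mx; exact: (measurable_mxB a b). Qed.

Let G2_le : (\int[Pr]_w \int[D]_xi (frob (G2 ((w : Past), xi)) ^+ 2)%:E <= (sigma ^+ 2)%:E)%E.
Proof.
have -> : ((sigma ^+ 2)%:E = \int[Pr]_w (cst (sigma ^+ 2)%:E) w)%E.
  by rewrite integral_cst//= probability_setT mule1.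
apply: ge0_le_integral => //.
- by move=> w _; apply: integral_ge0 => xi _; rewrite lee_fin sqr_ge0.
- apply: (measurable_fun_past gensP_sub).
  apply: (measurable_fun_fubini_tonelli_F (m2 := D) (fun z : Past * Xi => (frob (G2 z) ^+ 2)%:E)) => //.
    by apply/measurable_EFinP; exact: measurable_sqr_frob.
  by move=> z; rewrite lee_fin sqr_ge0.
by move=> w _; exact: (est_var hH (dx w)).
Qed.

Let G1 (z : Past * Xi) := H (x z.1) z.2 - H (x' z.1) z.2 - (Hbar (x z.1) - Hbar (x' z.1)).
Let mG1 : measurable_mx G1.
Proof.
have [a b] := mHx mx; have [a' b'] := mHx mx'.
exact: (measurable_mxB (measurable_mxB a a') (measurable_mxB b b')).
Qed.

(* Centering does not increase the second moment of the increment. *)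
Let G1_le : (\int[Pr]_w \int[D]_xi (frob (G1 ((w : Past), xi)) ^+ 2)%:E <=
  (Lam ^+ 2)%:E * mean_square Pr (fun w => (x w - x' w)%R))%E.
Proof.
have mxx : measurable_mx (fun w : Om => x w - x' w).
  by move=> i j; apply: (measurable_fun_past gensP_sub); apply: measurable_mxB.
rewrite /mean_square -ge0_integralZl//; first last.
- by rewrite lee_fin sqr_ge0.
- by move=> w _; rewrite lee_fin sqr_ge0.
- by apply/measurable_EFinP; exact: measurable_sqr_frob.
apply: ge0_le_integral => //.
- by move=> w _; apply: integral_ge0 => xi _; rewrite lee_fin sqr_ge0.
- apply: (measurable_fun_past gensP_sub).
  apply: (measurable_fun_fubini_tonelli_F (m2 := D) (fun z : Past * Xi => (frob (G1 z) ^+ 2)%:E)) => //.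
    by apply/measurable_EFinP; exact: measurable_sqr_frob.
  by move=> z; rewrite lee_fin sqr_ge0.
- by apply: measurable_funeM; apply/measurable_EFinP; exact: measurable_sqr_frob.
move=> w _; rewrite -EFinM; apply: le_trans (est_lip hH (dx w) (dx' w)).
have mV : measurable_mx (fun xi => H (x w) xi - H (x' w) xi).
  by apply: measurable_mxB; exact: measurable_est.
have mV' : measurable_mx (fun xi => G1 ((w : Past), xi)).
  by rewrite /G1/=; apply: (measurable_mxB mV); exact: measurable_mx_cst.
rewrite [leLHS](mean_square_entries D mV') [leRHS](mean_square_entries D mV); apply: lee_sum => q _.
have i1 := est_int hH (x w) q.1 q.2; have i2 := est_int hH (x' w) q.1 q.2.
have iD : D.-integrable [set: Xi] (EFin \o (fun xi => (H (x w) xi - H (x' w) xi) q.1 q.2)).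
  by under [EFin \o _]eq_fun do rewrite /= !mxE EFinB; exact: integrableB.
apply: le_trans (mom2_center_le iD); rewrite le_eqVlt; apply/orP; left; apply/eqP.
apply: eq_integral => xi _; congr (EFin (_ ^+ 2)); rewrite /G1/= !mxE; congr (_ - _).
under [X in fine X]eq_integral do rewrite !mxE EFinB.
by rewrite integralB// !est_mean_entry -EFinB.
Qed.

Lemma estimator_minibatch (b : nat) (X : 'I_b -> Om -> Xi) :
  (0 < b)%N -> (forall i, new (X i)) -> (forall i, law D Pr (X i)) ->
  (forall i j, i != j -> indep_pair D Pr (X i) (X j)) ->
  (mean_square Pr (fun w => (b%:R^-1 *: \sum_(i < b) H (x w) (X i w) - Hbar (x w))%R)
    <= (sigma ^+ 2 / b%:R)%:E)%E.
Proof.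
move=> b0 nX lX iX.
have mX i : measurable_fun [set: Om] (X i) by exact: measurable_fun_past (nX i).
have mxO : measurable_mx (x : Om -> 'cV[R]_p).
  by move=> i j; exact: measurable_fun_past (mx i j).
have mE : measurable_mx (fun w : Om => b%:R^-1 *: \sum_(i < b) H (x w) (X i w) - Hbar (x w)).
  apply: measurable_mxB; last exact: (est_meas_mean hH).
  by apply: measurable_mxZ; apply: measurable_mx_sum => i; exact: (est_meas hH).
have G2oo : (\int[Pr]_w \int[D]_xi (frob (G2 ((w : Past), xi)) ^+ 2)%:E < +oo)%E.
  by apply: (le_lt_trans G2_le); rewrite ltry.
rewrite (mean_square_entries Pr mE) (eq_bigr (fun q => ((1 ^+ 2 / b%:R)%:E * fresh_mom2 D Pr (g2 q))%E)); last first.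
  move=> q _; rewrite -(mom2_minibatch gensP_sub gensN_sub indepNP nX lX iX (mg2 q) (S2_sum_lt q mG2 G2oo) (cg2 q) 1 b0).
  apply: eq_integral => w _; congr (EFin (_ ^+ 2)).
  have sumc k (a : R) : k%:R * a = \sum_(i < k) a by rewrite sumr_const card_ord mulr_natl.
  have -> : \sum_(i < b) g2 q ((w : Past), X i w) =
      \sum_(i < b) (H (x w) (X i w)) q.1 q.2 - b%:R * Hbar (x w) q.1 q.2.
    by rewrite sumc -sumrB; apply: eq_bigr => i _; rewrite /g2 !mxE.
  rewrite !mxE summxE; move: (\sum_(i < b) _) => a.
  by field; rewrite pnatr_eq0 -lt0n.
rewrite -ge0_sume_distrr; last first.
  by move=> q _; apply: integral_ge0 => w _; apply: integral_ge0 => xi _; rewrite lee_fin sqr_ge0.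
by rewrite (sumS2 mG2) expr1n mul1r mulrC EFinM; apply: lee_wpmul2l.
Qed.

(** [hybrid_estimator_step] for each entry of the error, summed over the entries.
    The increments of [H] are centered by subtracting the increments of [Hbar],
    whose contributions cancel between the three terms of the recursion. *)
Lemma estimator_step (b1 b2 : nat) (X1 : 'I_b1 -> Om -> Xi) (X2 : 'I_b2 -> Om -> Xi)
    (E' E : Om -> 'M[R]_(m, n)) (beta kap : R) :
  (0 < b1)%N -> (0 < b2)%N ->
  (forall i, new (X1 i)) -> (forall i, law D Pr (X1 i)) ->
  (forall i j, i != j -> indep_pair D Pr (X1 i) (X1 j)) ->
  (forall i, new (X2 i)) -> (forall i, law D Pr (X2 i)) ->
  (forall i j, i != j -> indep_pair D Pr (X2 i) (X2 j)) ->
  kap = 2 \/ kap = 1 /\ (forall i j, indep_pair D Pr (X1 i) (X2 j)) ->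
  @measurable_mx _ _ Past _ _ E' ->
  (mean_square Pr (fun w => (E' w - Hbar (x' w))%R) < +oo)%E ->
  (mean_square Pr (fun w => (x w - x' w)%R) < +oo)%E ->
  (forall w, E w = beta *: E' w
     + (beta / b1%:R) *: \sum_(i < b1) (H (x w) (X1 i w) - H (x' w) (X1 i w))
     + ((1 - beta) / b2%:R) *: \sum_(i < b2) H (x w) (X2 i w)) ->
  measurable_mx (fun w => E w - Hbar (x w)) ->
  (mean_square Pr (fun w => (E w - Hbar (x w))%R) <= (beta ^+ 2)%:E * mean_square Pr (fun w => (E' w - Hbar (x' w))%R)
     + kap%:E * ((beta ^+ 2 / b1%:R * Lam ^+ 2)%:E * mean_square Pr (fun w => (x w - x' w)%R)
                + ((1 - beta) ^+ 2 / b2%:R * sigma ^+ 2)%:E))%E.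
Proof.
move=> b10 b20 n1 l1 i1 n2 l2 i2 kapE mE' E'oo xoo EE mEV.
have kap0 : (0 <= kap%:E :> \bar R)%E by case: kapE => [->|[-> _]]; rewrite lee_fin.
have mu : @measurable_mx _ _ Past _ _ (fun w => E' w - Hbar (x' w)).
  by apply: measurable_mxB => //; exact: (est_meas_mean hH).
have muO : measurable_mx (fun w : Om => E' w - Hbar (x' w)).
  by move=> i j; apply: (measurable_fun_past gensP_sub); exact: mu.
have G1oo : (\int[Pr]_w \int[D]_xi (frob (G1 ((w : Past), xi)) ^+ 2)%:E < +oo)%E.
  by apply: (le_lt_trans G1_le); rewrite lte_mul_pinfty// lee_fin sqr_ge0.
have G2oo : (\int[Pr]_w \int[D]_xi (frob (G2 ((w : Past), xi)) ^+ 2)%:E < +oo)%E.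
  by apply: (le_lt_trans G2_le); rewrite ltry.
have step q : (mom2 Pr (fun w => (E w - Hbar (x w))%R q.1 q.2) <=
   (beta ^+ 2)%:E * mom2 Pr (fun w => (E' w - Hbar (x' w))%R q.1 q.2)
   + kap%:E * ((beta ^+ 2 / b1%:R)%:E * fresh_mom2 D Pr (g1 q) + ((1 - beta) ^+ 2 / b2%:R)%:E * fresh_mom2 D Pr (g2 q)))%E.
  have := @hybrid_estimator_step _ _ _ _ _ D Pr gensP gensN gensP_sub gensN_sub indepNP b1 b2 X1 X2
    (fun w => (E' w - Hbar (x' w)) q.1 q.2) (g1 q) (g2 q) beta kap
    b10 b20 n1 l1 i1 n2 l2 i2 kapE (mu q.1 q.2) (sqint_entry q muO E'oo)
    (mg1 q) (S2_sum_lt q mG1 G1oo) (cg1 q) (mg2 q) (S2_sum_lt q mG2 G2oo) (cg2 q).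
  move=> /= [_]; apply: le_trans; rewrite le_eqVlt; apply/orP; left; apply/eqP.
  apply: eq_integral => w _; congr (EFin (_ ^+ 2)).
  have sumc k (a : R) : k%:R * a = \sum_(i < k) a by rewrite sumr_const card_ord mulr_natl.
  have s1 : \sum_(i < b1) g1 q ((w : Past), X1 i w) =
      \sum_(i < b1) (H (x w) (X1 i w) - H (x' w) (X1 i w)) q.1 q.2
      - b1%:R * (Hbar (x w) q.1 q.2 - Hbar (x' w) q.1 q.2).
    by rewrite sumc -sumrB; apply: eq_bigr => i _; rewrite /g1 !mxE.
  have s2 : \sum_(i < b2) g2 q ((w : Past), X2 i w) =
      \sum_(i < b2) (H (x w) (X2 i w)) q.1 q.2 - b2%:R * Hbar (x w) q.1 q.2.
    by rewrite sumc -sumrB; apply: eq_bigr => i _; rewrite /g2 !mxE.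
  have -> : (E w - Hbar (x w)) q.1 q.2 = beta * E' w q.1 q.2
     + beta / b1%:R * \sum_(i < b1) (H (x w) (X1 i w) - H (x' w) (X1 i w)) q.1 q.2
     + (1 - beta) / b2%:R * \sum_(i < b2) (H (x w) (X2 i w)) q.1 q.2 - Hbar (x w) q.1 q.2.
    by rewrite EE !mxE !summxE.
  have -> : (E' w - Hbar (x' w)) q.1 q.2 = E' w q.1 q.2 - Hbar (x' w) q.1 q.2 by rewrite !mxE.
  rewrite s1 s2.
  move: (\sum_(i < b1) _) (\sum_(i < b2) _) => a b.
  by field; rewrite !pnatr_eq0 -!lt0n b10 b20.
rewrite (mean_square_entries Pr mEV) (mean_square_entries Pr muO).
apply: (le_trans (lee_sum _ (fun q _ => step q))).
have S20 (g : Past * Xi -> R) : (0 <= fresh_mom2 D Pr g)%E.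
  by apply: integral_ge0 => w _; apply: integral_ge0 => xi _; rewrite lee_fin sqr_ge0.
have c10 : (0 <= (beta ^+ 2 / b1%:R)%:E :> \bar R)%E by rewrite lee_fin divr_ge0 ?sqr_ge0.
have c20 : (0 <= ((1 - beta) ^+ 2 / b2%:R)%:E :> \bar R)%E by rewrite lee_fin divr_ge0 ?sqr_ge0.
rewrite big_split/= -ge0_sume_distrr; last by move=> q _; exact: mom2_ge0.
rewrite -ge0_sume_distrr; last by move=> q _; apply: adde_ge0; apply: mule_ge0.
have -> : \sum_(i : 'I_m * 'I_n) ((beta ^+ 2 / b1%:R)%:E * fresh_mom2 D Pr (g1 i)
      + ((1 - beta) ^+ 2 / b2%:R)%:E * fresh_mom2 D Pr (g2 i))%E =
    ((beta ^+ 2 / b1%:R)%:E * (\int[Pr]_w \int[D]_xi (frob (G1 ((w : Past), xi)) ^+ 2)%:E)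
      + ((1 - beta) ^+ 2 / b2%:R)%:E * (\int[Pr]_w \int[D]_xi (frob (G2 ((w : Past), xi)) ^+ 2)%:E))%E.
  by rewrite big_split/= -(sumS2 mG1) -(sumS2 mG2) !ge0_sume_distrr.
rewrite leeD2l//; apply: lee_wpmul2l => //; apply: leeD.
  have -> : ((beta ^+ 2 / b1%:R * Lam ^+ 2)%:E = (beta ^+ 2 / b1%:R)%:E * (Lam ^+ 2)%:E)%E by [].
  by rewrite -muleA; exact: (lee_wpmul2l c10 G1_le).
have -> : (((1 - beta) ^+ 2 / b2%:R * sigma ^+ 2)%:E = ((1 - beta) ^+ 2 / b2%:R)%:E * (sigma ^+ 2)%:E)%E by [].
exact: (lee_wpmul2l c20 G2_le).
Qed.

End step.

(** At the first iteration the past is the trivial sigma-algebra. *)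
Lemma trivial_past_indep (gensN : set_system Om) : gensN `<=` measurable ->
  indep_systems Pr <<s gensN>> <<s (set0 : set_system Om)>>.
Proof.
move=> Nsub A B NA B0.
have : [set C : set Om | C = set0 \/ C = setT] B.
  apply: (smallest_sub _ _ B0) => //; split.
  - by left.
  - by move=> C [->|->]; rewrite setTD ?setC0 ?setCT; [right|left].
  - move=> F HF; have [[k Fk]|nF] := pselect (exists k, F k = setT).
      by right; apply/seteqP; split => // w _; exists k => //; rewrite Fk.
    left; apply/seteqP; split => // w [k _]; case: (HF k) => Fk; rewrite Fk // => _.
    by case: nF; exists k.
move=> [->|->]; first by rewrite setI0 measure0 mule0.
by rewrite setIT probability_setT mule1.
Qed.

Lemma estimator_init (b : nat) (X : 'I_b -> Om -> Xi) (x0 : 'cV[R]_p) (E : Om -> 'M[R]_(m, n)) :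
  (0 < b)%N -> dom x0 ->
  (forall i, measurable_fun [set: Om] (X i)) -> (forall i, law D Pr (X i)) ->
  (forall i j, i != j -> indep_pair D Pr (X i) (X j)) ->
  (forall w, E w = b%:R^-1 *: \sum_(i < b) H x0 (X i w)) ->
  (mean_square Pr (fun w => (E w - Hbar x0)%R) <= (sigma ^+ 2 / b%:R)%:E)%E.
Proof.
move=> b0 dx0 mX lX iX EE.
pose gN : set_system Om := [set A | exists i, exists2 B, measurable B & A = X i @^-1` B].
have gNsub : gN `<=` measurable.
  by move=> _ [i [B mB ->]]; rewrite -[X in measurable X]setTI; exact: mX.
have nX i : measurable_fun [set: g_sigma_algebraType gN] (X i : g_sigma_algebraType gN -> Xi).
  by move=> _ B mB; rewrite setTI; apply: sub_sigma_algebra; exists i, B.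
have := @estimator_minibatch set0 gN (@sub0set _ _) gNsub (trivial_past_indep gNsub) (fun=> x0)
  (measurable_mx_cst _) (fun=> dx0) b X b0 nX lX iX.
by under eq_fun do rewrite -EE.
Qed.

End estimator.

(** * The smooth part of the objective and one proximal step *)

Section smooth.
Context {R : realType} {d : measure_display} {Xi : measurableType d} (D : probability Xi R).
Context {p q n : nat} (F : 'cV[R]_p -> Xi -> 'cV[R]_q) (K : 'M[R]_(q, n)).
Context (psi : 'cV[R]_n -> \bar R) (Reg : 'cV[R]_p -> \bar R).
Context (LF sigmaF sigmaJ MF Mpsi : R).
Hypotheses (hpsi : proper_closed_convex psi) (hReg : proper_closed_convex Reg)
  (hF : stochastic_smooth_map D F)
  (hreg : regularity D F K psi Reg LF sigmaF sigmaJ MF Mpsi)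
  (hmu : strongly_convex_fun 1 psi).

Local Notation dom := (edom (Psi0 D F K psi Reg)).
Local Notation s := (spectral_norm K).
Local Notation L := (const_L s LF MF Mpsi).
Local Notation Fm := (meanF D F).
Local Notation ys x := (y0star K psi (Fm x)).

Let pReg : Defs.proper Reg. Proof. by case: hReg. Qed.

(** [phi0] is finite everywhere. *)
Lemma edom_Psi0 x : dom x <-> edom Reg x.
Proof. by rewrite /edom/= /Psi0 phi0E// addeC; exact: (edom_addr Reg (fun x => _) x). Qed.

Lemma fine_Psi0 x : dom x ->
  Psi0 D F K psi Reg x = (Phi0 D F K psi x + fine (Reg x))%:E.
Proof.
move=> /edom_Psi0 xd; rewrite /Psi0 /Phi0 EFinD (fineK (proper_fin_num pReg xd)).
by rewrite phi0E.
Qed.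

Lemma dom_segment x y (t : R) : dom x -> dom y -> 0 <= t <= 1 -> dom ((1 - t) *: x + t *: y).
Proof.
move=> dx dy /andP[]; rewrite le_eqVlt => /predU1P[<- _|t0].
  by rewrite subr0 scale1r scale0r addr0.
rewrite le_eqVlt => /predU1P[->|t1]; first by rewrite subrr scale0r add0r scale1r.
apply/edom_Psi0; have [_ _ cv] := hReg.
have sc : strongly_convex_fun 0 Reg by move=> u v r r01; rewrite !mul0r sube0; exact: cv.
have := strongly_convex_fin pReg sc ((edom_Psi0 x).1 dx) ((edom_Psi0 y).1 dy).
by move=> /(_ t); rewrite t0 t1 => /(_ isT) [].
Qed.

Let mFz z : measurable_mx (F z).
Proof. by move=> i j; have /integrableP[/measurable_EFinP] := F_integrable hF z i j. Qed.

(** The segment between two points of the domain stays in it by convexity, so the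
    second moment of the Jacobian is bounded along the segment. *)
Lemma estimable_F : estimable D F Fm dom sigmaF MF.
Proof.
split.
- move=> d3 T Z X mZ mX.
  apply: (@measurable_mx_comp _ _ T p q (fun z t => F z (X t)) Z) => //.
    by move=> z t; exact: (F_differentiable hF).
  by move=> z i j; apply: (measurableT_comp (mFz z i j)).
- move=> d3 T Z mZ; apply: (@measurable_mx_comp _ _ T p q (fun z _ => Fm z) Z) => //.
    by move=> z t; exact: (meanF_differentiable hF).
  by move=> z; exact: measurable_mx_cst.
- exact: (F_integrable hF).
- by [].
- by move=> z dz; have := variance_F hreg dz; rewrite unlock.
- move=> z z' dz dz'.
  have := @second_moment_increment _ _ _ D p q F z' (z - z') (MF ^+ 2) (F_differentiable hF) mFz.
  rewrite [z' + (z - z')]addrC subrK; apply => t t01.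
  have -> : z' + t *: (z - z') = (1 - t) *: z' + t *: z.
    by apply/matrixP => i j; rewrite !mxE; ring.
  have := second_moment_J hreg (dom_segment dz' dz t01); by rewrite unlock.
Qed.

Lemma estimable_JF : estimable D (JF F) (Jac Fm) dom sigmaJ LF.
Proof.
split.
- move=> d3 T Z X mZ mX.
  apply: (@measurable_mx_Jac _ _ T p q (fun z t => F z (X t)) Z) => //.
    by move=> z t; exact: (F_differentiable hF).
  by move=> z i j; apply: (measurableT_comp (mFz z i j)).
- move=> d3 T Z mZ; apply: (@measurable_mx_Jac _ _ T p q (fun z _ => Fm z) Z) => //.
    by move=> z t; exact: (meanF_differentiable hF).
  by move=> z; exact: measurable_mx_cst.
- exact: (JF_integrable hF).
- exact: (Jac_meanF hF).
- by move=> z dz; have := variance_J hreg dz; rewrite unlock.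
- by move=> z z' dz dz'; have := average_smooth hreg dz dz'; rewrite unlock.
Qed.

Let MF0 : 0 <= MF. Proof. by have [_ _ _ /ltW] := constants_gt0 hreg. Qed.
Let LF0 : 0 <= LF. Proof. by have [/ltW] := constants_gt0 hreg. Qed.
Let Mpsi0 : 0 <= Mpsi. Proof. by have [_ _ _ _ /ltW] := constants_gt0 hreg. Qed.
Let s0 : 0 <= s. Proof. exact: spectral_norm_ge0. Qed.

Lemma frob_Jac_le x : dom x -> frob (Jac Fm x) <= MF.
Proof.
move=> dx; rewrite -(ler_sqr (frob_ge0 _)) ?nnegrE//.
apply: (sqr_frob_mean_le estimable_JF).
by have := second_moment_J hreg dx; rewrite unlock.
Qed.

Lemma meanF_lipschitz x y : dom x -> dom y -> frob (Fm x - Fm y) <= MF * frob (x - y).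
Proof.
move=> dx dy; rewrite -(ler_sqr (frob_ge0 _)) ?nnegrE ?mulr_ge0 ?frob_ge0// exprMn.
exact: (mean_increment_le estimable_F).
Qed.

Lemma Jac_lipschitz x y : dom x -> dom y -> frob (Jac Fm x - Jac Fm y) <= LF * frob (x - y).
Proof.
move=> dx dy; rewrite -(ler_sqr (frob_ge0 _)) ?nnegrE ?mulr_ge0 ?frob_ge0// exprMn.
exact: (mean_increment_le estimable_JF).
Qed.

(** The gradient of [Phi0], by [grad_Phi0]. *)
Definition gradPhi x : 'cV[R]_p := (Jac Fm x)^T *m (K *m ys x).

Lemma frob_Ky u : frob (K *m y0star K psi u) <= s * Mpsi.
Proof.
apply: (le_trans (spectral_norm_mulmx _ _)); apply: ler_wpM2l => //.
by apply: (bounded_dom_psi hreg); exact: y0star_edom.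
Qed.

Lemma frob_Ky_lipschitz u v :
  frob (K *m y0star K psi u - K *m y0star K psi v) <= s ^+ 2 * frob (u - v).
Proof.
rewrite -mulmxBr; apply: (le_trans (spectral_norm_mulmx _ _)).
by rewrite expr2 -mulrA; apply: ler_wpM2l => //; exact: y0star_lipschitz.
Qed.

(** Exchange first the Jacobian and then the maximizer; the two Lipschitz
    constants are those of a product of bounded Lipschitz maps. *)
Lemma gradient_error (J : 'M[R]_(q, p)) (u : 'cV[R]_q) x : dom x ->
  frob (J^T *m (K *m y0star K psi u) - gradPhi x) <=
    s * Mpsi * frob (J - Jac Fm x) + MF * s ^+ 2 * frob (u - Fm x).
Proof.
move=> dx.
have -> : J^T *m (K *m y0star K psi u) - gradPhi x =
   (J - Jac Fm x)^T *m (K *m y0star K psi u)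
   + (Jac Fm x)^T *m (K *m y0star K psi u - K *m ys x).
  by rewrite linearB/= mulmxBl mulmxBr addrA subrK.
apply: (le_trans (frobD _ _)); apply: lerD.
  apply: (le_trans (frob_mulmx _ _)); rewrite frob_tr mulrC.
  by apply: ler_wpM2r; [exact: frob_ge0|exact: frob_Ky].
apply: (le_trans (frob_mulmx _ _)); rewrite frob_tr -mulrA.
by apply: ler_pM; rewrite ?frob_ge0 ?frob_Jac_le ?frob_Ky_lipschitz.
Qed.

Lemma sqr_gradient_error (J : 'M[R]_(q, p)) (u : 'cV[R]_q) x : dom x ->
  frob (J^T *m (K *m y0star K psi u) - gradPhi x) ^+ 2 <=
    2 * s ^+ 2 * Mpsi ^+ 2 * frob (J - Jac Fm x) ^+ 2
    + 2 * MF ^+ 2 * s ^+ 4 * frob (u - Fm x) ^+ 2.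
Proof.
move=> dx; have := gradient_error J u dx.
set a := s * Mpsi * _; set b := MF * _ * _ => h.
have a0 : 0 <= a by rewrite !mulr_ge0 ?frob_ge0.
have b0 : 0 <= b by rewrite !mulr_ge0 ?exprn_ge0 ?frob_ge0.
apply: (@le_trans _ _ ((a + b) ^+ 2)).
  by rewrite ler_sqr ?nnegrE ?frob_ge0 ?addr_ge0.
apply: (@le_trans _ _ (2 * a ^+ 2 + 2 * b ^+ 2)).
  by have := sqr_ge0 (a - b); rewrite sqrrB sqrrD; lra.
by rewrite le_eqVlt; apply/orP; left; apply/eqP; rewrite /a /b; ring.
Qed.

Lemma gradPhi_lipschitz x y : dom x -> dom y ->
  frob (gradPhi x - gradPhi y) <= L * frob (x - y).
Proof.
move=> dx dy; apply: (le_trans (gradient_error _ _ dy)).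
apply: (@le_trans _ _ (s * Mpsi * (LF * frob (x - y)) + MF * s ^+ 2 * (MF * frob (x - y)))).
  apply: lerD; apply: ler_wpM2l; rewrite ?mulr_ge0 ?exprn_ge0//; [exact: Jac_lipschitz|exact: meanF_lipschitz].
by rewrite le_eqVlt; apply/orP; left; apply/eqP; rewrite /const_L; ring.
Qed.

(** By [phi0_sandwich], the difference quotient of [Phi0] is that of the mean of
    [F] paired with the maximizer, up to a remainder of second order. *)
Lemma cvg_Phi0 x v :
  (fun h : R => h^-1 *: (Phi0 D F K psi (h *: v + x) - Phi0 D F K psi x)) @ 0^'
    --> dot (gradPhi x) v.
Proof.
have dF := meanF_differentiable hF x.
pose Q (h : R) := h^-1 *: (Fm (h *: v + x) - Fm x).
have cQ : Q @ 0^' --> Jac Fm x *m v.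
  by rewrite -derive_Jac//; exact: (diff_derivable dF).
have cdot : (fun h => dot (K *m ys x) (Q h)) @ 0^' --> dot (gradPhi x) v.
  rewrite /gradPhi dot_mulmx.
  have := cvg_comp _ _ cQ (@continuous_dot _ _ (K *m ys x) (Jac Fm x *m v)).
  exact.
pose r (h : R) := h^-1 * (Phi0 D F K psi (h *: v + x) - Phi0 D F K psi x
   - dot (Fm (h *: v + x) - Fm x) (K *m ys x)).
have cr : r @ 0^' --> 0.
  have [M M0 HM] : exists2 M : R, 0 < M & \forall h \near 0^', frob (Q h) <= M.
    exists (frob (Jac Fm x *m v) + 1); first by rewrite ltr_wpDl ?frob_ge0.
    have nb := cQ _ (@frob_nbhs _ _ _ (Jac Fm x *m v) 1 ltr01).
    apply: (@filterS _ (nbhs (0:R)^') _ _ _ _ nb) => h /= hh.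
    have := frobD (Q h - Jac Fm x *m v) (Jac Fm x *m v); rewrite subrK => /le_trans; apply.
    by rewrite addrC lerD2l ltW.
  apply/cvgrPdist_le => e e0; near=> h.
  rewrite sub0r normrN.
  have h0 : h != 0 by near: h; exact: nbhs_dnbhs_neq.
  have hM : frob (Q h) <= M by near: h.
  have he : `|h| <= e / (s ^+ 2 * M ^+ 2 + 1).
    near: h; apply: nbhs_dnbhs; apply/nbhs_ballP; exists (e / (s ^+ 2 * M ^+ 2 + 1)) => /=.
      by rewrite divr_gt0// ltr_wpDl// mulr_ge0 ?sqr_ge0.
    by move=> y; rewrite /ball/= sub0r normrN => /ltW.
  have := phi0_sandwich K hpsi hmu (Fm x) (Fm (h *: v + x)).
  rewrite /= -/(Phi0 D F K psi _) -/(Phi0 D F K psi x) => /andP[r0 r1].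
  rewrite /r normrM normfV [X in _ * X]ger0_norm//.
  have QE : frob (Fm (h *: v + x) - Fm x) = `|h| * frob (Q h).
    by rewrite /Q frobZ normfV mulrA divff ?mul1r// normr_eq0.
  rewrite QE exprMn in r1.
  apply: (@le_trans _ _ (`|h| * (s ^+ 2 * M ^+ 2))).
    rewrite mulrC ler_pdivrMr ?normr_gt0//; apply: (le_trans r1).
    have -> : `|h| * (s ^+ 2 * M ^+ 2) * `|h| = s ^+ 2 * (`|h| ^+ 2 * M ^+ 2) by ring.
    apply: ler_wpM2l; first exact: sqr_ge0.
    apply: ler_wpM2l; first exact: sqr_ge0.
    by rewrite ler_sqr ?nnegrE ?frob_ge0// ltW.
  have c0 : 0 <= s ^+ 2 * M ^+ 2 by rewrite mulr_ge0 ?sqr_ge0.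
  have c1 : 0 < s ^+ 2 * M ^+ 2 + 1 by rewrite ltr_wpDl.
  rewrite ler_pdivlMr// in he; apply: le_trans he.
  by apply: ler_wpM2l => //; rewrite lerDl.
have H := cvgD cdot cr; rewrite addr0 in H; refine (cvg_trans (near_eq_cvg _) (H _)).
near=> h; change (dot (K *m ys x) (Q h) + r h = h^-1 *: (Phi0 D F K psi (h *: v + x) - Phi0 D F K psi x)).
rewrite /r /Q dotZr dotC /GRing.scale/= -mulrDr; congr (_ * _).
by rewrite addrC subrK.
Unshelve. all: by end_near. Qed.

Lemma grad_Phi0 x : grad (Phi0 D F K psi) x = gradPhi x.
Proof.
apply/colP => j; rewrite mxE.
have := @cvg_Phi0 x (delta_mx j ord0) => /(@cvg_lim _ (@norm_hausdorff _ _)) H.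
rewrite /derive [LHS]H /dot (bigD1 j)//= big1 => [|i ij].
  by rewrite !mxE !eqxx mulr1 addr0.
by rewrite !mxE (negbTE ij) mulr0.
Qed.

Lemma is_derive_quadratic (a b t : R) :
  is_derive t (1 : R) (fun r : R => a * r + b * r ^+ 2) (a + b * (2 * t)).
Proof.
have h : is_derive t (1 : R) (a *: (@idfun R : R -> R) + b *: (fun r : R => r ^+ 2)) (a *: 1 + b *: (2 * t)).
  apply: is_deriveD; apply: is_deriveZ.
  have H := @is_deriveX R R^o idfun 2 t 1 1 (is_derive_id t 1).
  rewrite fctE in H; apply: is_derive_eq.
  by rewrite /= expr1 /GRing.scale/= mulr1.
have -> : a + b * (2 * t) = a%:A + b *: (2 * t : R^o) by rewrite /GRing.scale/= mulr1.
exact: h.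
Qed.

(** The usual descent lemma. Only [Phi0] on the segment is differentiated and its
    derivative is compared with that of a quadratic by the mean value theorem, so
    that no integral is needed. *)
Lemma Phi0_descent x y : dom x -> dom y ->
  Phi0 D F K psi y <= Phi0 D F K psi x + dot (gradPhi x) (y - x) + L / 2 * frob (y - x) ^+ 2.
Proof.
move=> dx dy; set v := y - x; set Phi := Phi0 D F K psi.
have dline (t : R) : is_derive t (1 : R) (fun r : R => Phi (x + r *: v)) (dot (gradPhi (x + t *: v)) v).
  have H : (fun h : R => h^-1 *: (Phi (x + (h *: 1 + t) *: v) - Phi (x + t *: v))) @ 0^'
      --> dot (gradPhi (x + t *: v)) v.
    have := @cvg_Phi0 (x + t *: v) v; apply: cvg_trans; apply: near_eq_cvg; near=> h.
    have -> // : h *: v + (x + t *: v) = x + (h *: 1 + t) *: v.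
    by rewrite scalerDl addrCA [h *: 1]mulr1.
  split; first by apply/cvg_ex; exists (dot (gradPhi (x + t *: v)) v).
  exact: (cvg_lim _ H).
pose a := dot (gradPhi x) v; pose b := L / 2 * frob v ^+ 2.
pose G (t : R) := Phi (x + t *: v) - (a * t + b * t ^+ 2).
pose dG (t : R) := dot (gradPhi (x + t *: v)) v - (a + b * (2 * t)).
have dGt (t : R) : is_derive t (1 : R) G (dG t).
  rewrite /G /dG; apply: is_deriveB.
  exact: is_derive_quadratic.
have cG : {within `[0, 1], continuous G}.
  apply: continuous_subspaceT => t; apply: differentiable_continuous.
  by apply/derivable1_diffP; have [] := dGt t.
have [c c01 Gc] := MVT_segment ler01 (fun t _ => dGt t) cG.
have c01' : 0 <= c <= 1 by move: c01; rewrite in_itv.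
have dGc : dG c <= 0.
  have [c0 c1] := andP c01'.
  have dc : dom (x + c *: v).
    have -> : x + c *: v = (1 - c) *: x + c *: y.
      by apply/matrixP => i j; rewrite !mxE; ring.
    exact: dom_segment.
  have := gradPhi_lipschitz dc dx.
  rewrite addrAC subrr add0r frobZ ger0_norm// => lip.
  have : dot (gradPhi (x + c *: v) - gradPhi x) v <= L * (c * frob v) * frob v.
    apply: le_trans (ler_norm _) _; apply: le_trans (cauchy_schwarz _ _) _.
    by apply: ler_wpM2r => //; exact: frob_ge0.
  rewrite dotBl -/a /dG /b => h.
  rewrite subr_le0 -lerBlDl; apply: (le_trans h).
  by rewrite le_eqVlt; apply/orP; left; apply/eqP; field.
move: Gc; rewrite subr0 mulr1 /G scale1r scale0r addr0 !mulr1 expr1n mulr0 expr0n/= mulr0 mulr1.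
have -> : x + v = y by rewrite addrC subrK.
by rewrite -/a -/b => Gc; move: dGc; rewrite -Gc; lra.
Unshelve. all: by end_near. Qed.

(** One iteration from [x] along an arbitrary direction [v]: the results hold for
    each trajectory separately. *)
Section iteration.
Variables (theta : R) (x v : 'cV[R]_p).
Let eta := 2 / (L * (3 + theta)).
Hypotheses (L0 : 0 < L) (theta0 : 0 < theta) (theta1 : theta < 1) (dx : dom x).
Let xh := prox eta Reg (x - eta *: v).
Let x1 := (1 - theta) *: x + theta *: xh.

Let eta0 : 0 < eta.
Proof. by rewrite /eta divr_gt0// mulr_gt0// ltr_wpDr// ltW. Qed.

Lemma dom_prox : dom xh. Proof. by apply/edom_Psi0; exact: (prox_edom eta0 hReg). Qed.

Lemma dom_step : dom x1.
Proof. by apply: dom_segment => //; [exact: dom_prox|rewrite (ltW theta0) (ltW theta1)]. Qed.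

(** Descent lemma at the new point, convexity of [Reg] between [x] and [xh], and the
    three-point inequality of the proximal step with comparison point [x]. The
    choice of [eta] makes [3 L theta / 2] the net coefficient of the squared step;
    a third of it pays for the inexact gradient. *)
Lemma objective_step :
  fine (Psi0 D F K psi Reg x1) + L * theta * frob (xh - x) ^+ 2
    <= fine (Psi0 D F K psi Reg x) + theta / (2 * L) * frob (v - gradPhi x) ^+ 2.
Proof.
rewrite !fine_Psi0//=; last exact: dom_step.
have des := Phi0_descent dx dom_step.
have x1x : x1 - x = theta *: (xh - x).
  by apply/matrixP => i j; rewrite !mxE; ring.
rewrite x1x dotZr frobZ gtr0_norm// in des.
have [_ _ cv] := hReg.
have scR : strongly_convex_fun 0 Reg by move=> a b r r01; rewrite !mul0r sube0; exact: cv.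
have xd := (edom_Psi0 x).1 dx; have xhd := (edom_Psi0 xh).1 dom_prox.
have t01 : 0 < theta < 1 by rewrite theta0.
have [_ RC] := strongly_convex_fin pReg scR xd xhd t01.
rewrite !mul0r subr0 -/x1 in RC.
have [_ P3] := prox_three_point eta0 hReg (x - eta *: v) xd.
rewrite -/xh in P3.
have e1 : x - (x - eta *: v) = eta *: v by rewrite opprB addrC subrK.
have e2 : xh - (x - eta *: v) = (xh - x) + eta *: v by rewrite opprB addrA addrAC.
rewrite e1 e2 sqr_frobD dotZr frobZ gtr0_norm// in P3.
have bc : frob (x - xh) = frob (xh - x) by exact: frobBC.
rewrite bc in P3.
have Y : dot (gradPhi x - v) (xh - x) <=
    frob (v - gradPhi x) ^+ 2 / (2 * L) + L / 2 * frob (xh - x) ^+ 2.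
  apply: le_trans (ler_norm _) _; apply: le_trans (cauchy_schwarz _ _) _.
  rewrite (frobBC (gradPhi x)).
  set a := frob (v - _); set b := frob (xh - _).
  have := sqr_ge0 (a - L * b); rewrite sqrrB => h.
  rewrite -(ler_pM2l (_ : 0 < 2 * L)) ?mulr_gt0//.
  have -> : 2 * L * (a ^+ 2 / (2 * L) + L / 2 * b ^+ 2) = a ^+ 2 + (L * b) ^+ 2.
    by field; rewrite gt_eqF.
  by lra.
rewrite dotBl (dotC v) in Y.
move: des RC P3 Y => {e1 e2 x1x}.
move: (fine (Reg x1)) (fine (Reg x)) (fine (Reg xh)) (Phi0 D F K psi x1) (Phi0 D F K psi x)
  (dot (gradPhi x) (xh - x)) (dot (xh - x) v) (frob (xh - x)) (frob v) (frob (v - gradPhi x)).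
move=> r1 r rh p1 p0 dg dv X V E des RC P3 Y.
have P3' : rh + dv + X ^+ 2 / eta <= r.
  move: P3; have -> : (X ^+ 2 + 2 * (eta * dv) + (eta * V) ^+ 2) / (2 * eta)
     = X ^+ 2 / (2 * eta) + dv + (eta * V) ^+ 2 / (2 * eta) by field; rewrite gt_eqF.
  have -> : X ^+ 2 / eta = X ^+ 2 / (2 * eta) + X ^+ 2 / (2 * eta) by field; rewrite gt_eqF.
  by lra.
have etaE : X ^+ 2 / eta = L * (3 + theta) / 2 * X ^+ 2.
  by rewrite /eta; field; rewrite !gt_eqF//; lra.
rewrite etaE in P3'.
have h1 : theta * (dg - dv) <= theta * (E ^+ 2 / (2 * L) + L / 2 * X ^+ 2) by rewrite ler_pM2l.
have h2 : theta * (rh + dv + L * (3 + theta) / 2 * X ^+ 2) <= theta * r by rewrite ler_pM2l.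
have -> : theta / (2 * L) * E ^+ 2 = theta * (E ^+ 2 / (2 * L)) by field; rewrite gt_eqF.
move: (E ^+ 2 / (2 * L)) h1 => E' h1.
move: des; rewrite exprMn; move: (X ^+ 2) h1 h2 => X2 h1 h2 des.
lra.
Qed.

(** Nonexpansiveness compares the exact and the inexact proximal step; moreover
    [1 / eta = L (3 + theta) / 2 <= 2 L]. *)
Lemma grad_mapping_step :
  frob (grad_mapping D F K psi Reg eta x) ^+ 2
    <= 8 * L ^+ 2 * frob (xh - x) ^+ 2 + 2 * frob (v - gradPhi x) ^+ 2.
Proof.
rewrite /grad_mapping grad_Phi0.
set xg := prox eta Reg (x - eta *: gradPhi x).
have h : frob (x - xg) <= frob (xh - x) + eta * frob (v - gradPhi x).
  have tri (a b c : 'cV[R]_p) B : frob (b - c) <= B -> frob (a - c) <= frob (b - a) + B.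
    by move=> bc; apply: (le_trans (frobB_le a b c)); rewrite (frobBC a) lerD2l.
  apply: tri; apply: (le_trans (prox_nonexpansive eta0 hReg _ _)).
  have -> : x - eta *: v - (x - eta *: gradPhi x) = - eta *: (v - gradPhi x).
    by apply/matrixP => i j; rewrite !mxE; ring.
  by rewrite frobZ normrN gtr0_norm.
rewrite frobZ gtr0_norm ?invr_gt0//.
have : eta^-1 * frob (x - xg) <= eta^-1 * frob (xh - x) + frob (v - gradPhi x).
  apply: (le_trans (ler_wpM2l _ h)); first by rewrite invr_ge0 ltW.
  by rewrite mulrDr mulrA mulVf ?mul1r// gt_eqF.
have eL : eta^-1 <= 2 * L.
  have -> : eta^-1 = L * ((3 + theta) / 2) by rewrite /eta invf_div mulrA.
  rewrite [leRHS]mulrC ler_pM2l// ler_pdivrMr//.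
  have -> : 2 * 2 = 3 + 1 :> R by ring.
  by rewrite lerD2l ltW.
have a0 := frob_ge0 (xh - x); have b0 := frob_ge0 (v - gradPhi x); have c0 := frob_ge0 (x - xg).
move: a0 b0 c0; move: (frob (xh - x)) (frob (v - gradPhi x)) (frob (x - xg)) => a b c a0 b0 c0 k.
have k' : eta^-1 * c <= 2 * L * a + b.
  by apply: (le_trans k); rewrite lerD2r ler_wpM2r.
apply: (@le_trans _ _ ((2 * L * a + b) ^+ 2)).
  have L2a : 0 <= 2 * L * a by rewrite !mulr_ge0// ltW.
  by rewrite ler_sqr ?nnegrE ?addr_ge0// mulr_ge0// invr_ge0 ltW.
have := sqr_ge0 (2 * L * a - b); rewrite sqrrB sqrrD !exprMn; lra.
Qed.

(** Adds [theta / (16 L)] times [grad_mapping_step] to [objective_step]: half of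
    the squared step is spent on the gradient mapping, half is kept. *)
Lemma descent_step :
  theta / (16 * L) * frob (grad_mapping D F K psi Reg eta x) ^+ 2
     + L * theta / 2 * frob (xh - x) ^+ 2
  <= fine (Psi0 D F K psi Reg x) - fine (Psi0 D F K psi Reg x1)
     + 5 * theta / (8 * L) * frob (v - gradPhi x) ^+ 2.
Proof.
have h1 := objective_step; have h2 := grad_mapping_step.
have h3 : theta / (16 * L) * frob (grad_mapping D F K psi Reg eta x) ^+ 2 <=
   theta / (16 * L) * (8 * L ^+ 2 * frob (xh - x) ^+ 2 + 2 * frob (v - gradPhi x) ^+ 2).
  by rewrite ler_pM2l// divr_gt0 ?mulr_gt0.
move: h1 h3; clear h2.
move: (fine _) (fine _) (frob (grad_mapping D F K psi Reg eta x) ^+ 2) => f1 f0 G2.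
move: (frob (xh - x) ^+ 2) (frob (v - gradPhi x) ^+ 2) => X E h1 h3.
have e1 : theta / (16 * L) * (8 * L ^+ 2 * X + 2 * E) = L * theta / 2 * X + theta / (8 * L) * E.
  by field; rewrite gt_eqF.
have e2 : 5 * theta / (8 * L) * E = theta / (2 * L) * E + theta / (8 * L) * E.
  by field; rewrite gt_eqF.
rewrite e1 in h3; rewrite e2.
move: (theta / (8 * L) * E) (theta / (2 * L) * E) h1 h3 => a b h1 h3.
move: (theta / (16 * L) * G2) h3 => g h3.
lra.
Qed.

End iteration.
End smooth.

(** * Sigma-algebras of samples *)

Section independence.
Context {R : realType} {d d' : measure_display} {Xi : measurableType d} {Om : measurableType d'}.
Context (D : probability Xi R) (Pr : probability Om R).

(** The generators of [sigma_of S], which is [<<s preimages S>>] by definition. *)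
Definition preimages (S : set (Om -> Xi)) : set_system Om :=
  [set A | exists2 X, S X & exists2 B, measurable B & A = X @^-1` B].

Lemma preimages_measurable (S : set (Om -> Xi)) :
  (forall X, S X -> measurable_fun [set: Om] X) -> preimages S `<=` measurable.
Proof. by move=> mS A [X SX [B mB ->]]; rewrite -[_ @^-1` _]setTI; exact: mS. Qed.

Lemma measurable_member (S : set (Om -> Xi)) X : S X ->
  measurable_fun [set: g_sigma_algebraType (preimages S)] (X : g_sigma_algebraType _ -> Xi).
Proof. by move=> SX _ B mB; rewrite setTI; apply: sub_sigma_algebra; exists X => //; exists B. Qed.

Lemma measurable_preimages_sub (S S' : set (Om -> Xi)) d3 (E : measurableType d3) (f : Om -> E) :
  S `<=` S' ->
  measurable_fun [set: g_sigma_algebraType (preimages S)] (f : g_sigma_algebraType (preimages S) -> E) ->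
  measurable_fun [set: g_sigma_algebraType (preimages S')] (f : g_sigma_algebraType (preimages S') -> E).
Proof.
move=> SS' mf mT B mB; have := mf measurableT _ mB; rewrite !setTI.
apply: smallest_sub; first exact: smallest_sigma_algebra.
by move=> A [X SX XA]; apply: sub_sigma_algebra; exists X => //; exact: SS'.
Qed.

Lemma iid_law m (X : 'I_m -> Om -> Xi) i : iid_copies Pr D X -> law D Pr (X i).
Proof. by case=> _ + _ B mB; exact. Qed.

Lemma iid_indep_pair m (X : 'I_m -> Om -> Xi) i j : iid_copies Pr D X -> i != j ->
  indep_pair D Pr (X i) (X j).
Proof.
move=> [mX lX iX] ij A B mA mB.
pose C k := if k == i then A else if k == j then B else [set: Xi].
have mC k : measurable (C k) by rewrite /C; case: ifP => // _; case: ifP.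
have := iX C mC.
have -> : \bigcap_(k in [set: 'I_m]) (X k @^-1` C k) = X i @^-1` A `&` X j @^-1` B.
  apply/seteqP; split => w.
    move=> H; split; first by have := H i I; rewrite /C eqxx.
    by have := H j I; rewrite /C eq_sym (negbTE ij) eqxx.
  move=> [wA wB] k _; rewrite /C; case: eqP => [->//|_]; case: eqP => [->//|_].
  by [].
move=> ->; rewrite (bigD1 i)//= (bigD1 j)/=; last by rewrite eq_sym.
rewrite big1 ?mule1; last first.
  move=> k /andP[ki kj]; rewrite /C (negbTE ki) (negbTE kj) preimage_setT.
  by rewrite probability_setT.
by rewrite /C eqxx eq_sym (negbTE ij) eqxx !lX.
Qed.

Lemma indep_systems_pair (S S' : set (Om -> Xi)) X Y : S X -> S' Y -> law D Pr X -> law D Pr Y ->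
  indep_systems Pr (sigma_of S) (sigma_of S') -> indep_pair D Pr X Y.
Proof.
move=> SX SY lX lY iS A B mA mB; rewrite iS ?lX ?lY//.
  by apply: sub_sigma_algebra; exists X => //; exists A.
by apply: sub_sigma_algebra; exists Y => //; exists B.
Qed.

(** The event that the output index is [t] is independent of [G]. *)
Lemma indep_integral_fiber (gensP : set_system Om) (tau : Om -> nat) (G : g_sigma_algebraType gensP -> R) (t : nat) :
  gensP `<=` measurable -> measurable_fun [set: Om] tau ->
  indep_systems Pr [set tau @^-1` A | A in [set: set nat]] <<s gensP>> ->
  measurable_fun [set: g_sigma_algebraType gensP] G -> (forall w, 0 <= G w) ->
  (\int[Pr]_(w in tau @^-1` [set t]) (G w)%:E = Pr (tau @^-1` [set t]) * \int[Pr]_w (G w)%:E)%E.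
Proof.
move=> gsub mtau itau mG G0.
pose taup : {mfun Om >-> nat} := HB.pack tau (isMeasurableFun.Build _ _ _ _ tau mtau).
pose m2 : probability nat R := distribution Pr taup.
pose f (z : g_sigma_algebraType gensP * nat) : \bar R := ((G z.1)%:E * (\1_[set t] z.2)%:E)%E.
have mf : measurable_fun [set: _] f.
  apply: emeasurable_funM; apply/measurable_EFinP.
    by apply: (measurableT_comp mG); exact: measurable_fst.
  by apply: measurableT_comp; [exact: measurable_indic|exact: measurable_snd].
have f0 z : (0 <= f z)%E by rewrite mule_ge0// lee_fin.
have mid := measurable_id_past gsub.
have ind A B : measurable A -> measurable B ->
    (Pr ((id : Om -> g_sigma_algebraType gensP) @^-1` A `&` tau @^-1` B) = Pr (id @^-1` A) * m2 B)%E.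
  by move=> mA mB; rewrite setIC muleC; apply: itau => //; exists B.
have := joint_ge0_integral mid mtau ind mf f0.
have -> : (\int[Pr]_w f (id w, tau w) = \int[Pr]_(w in tau @^-1` [set t]) (G w)%:E)%E.
  rewrite [RHS]integral_mkcond; apply: eq_integral => w _.
  by rewrite /f/= epatch_indic/= !indicE; congr (_ * (_%:R)%:E)%E.
move=> ->.
have -> : (\int[Pr]_w \int[m2]_y f (id w, y) = \int[Pr]_w (Pr (tau @^-1` [set t]) * (G w)%:E))%E.
  apply: eq_integral => w _; rewrite /f/= ge0_integralZl//; last by rewrite lee_fin.
  by rewrite integral_indic// setIT muleC.
rewrite ge0_integralZl//.
- by apply/measurable_EFinP; exact: (measurable_fun_past gsub mG).
- by move=> w _; rewrite lee_fin.
Qed.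

End independence.

(** * Summing the recursions *)

Section recursion.
Context {R : realType}.

(** The induction carries the extra term [(1 - alpha) W_k], which turns
    [(1 - alpha)^2 <= 1 - alpha] into a telescoping sum. *)
Lemma averaged_recursion (W r : nat -> R) (alpha w0 A B : R) T :
  0 <= alpha <= 1 -> 0 <= A -> (forall t, 0 <= W t) -> (forall t, 0 <= r t) -> W 0%N <= w0 ->
  (forall t, (t < T)%N -> W t.+1 <= (1 - alpha) ^+ 2 * W t + A * r t + B) ->
  alpha * \sum_(t < T.+1) W t <= w0 + A * \sum_(t < T.+1) r t + T%:R * B.
Proof.
move=> /andP[al0 al1] A0 W0 r0 Ww0 step.
have H k : (k <= T)%N ->
    alpha * \sum_(t < k.+1) W t + (1 - alpha) * W k <= w0 + A * \sum_(t < k) r t + k%:R * B.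
  elim: k => [_|k IH kT]; first by rewrite big_ord_recr !big_ord0/= mulr0 mul0r !addr0 add0r; lra.
  have IHk := IH (ltnW kT); have st := step k kT.
  have sq : (1 - alpha) ^+ 2 * W k <= (1 - alpha) * W k.
    by apply: ler_wpM2r => //; rewrite expr2 ler_piMl//; lra.
  rewrite big_ord_recr [in leRHS]big_ord_recr/= -natr1.
  move: (\sum_(t < k.+1) W t) (\sum_(t < k) r t) (W k.+1) IHk st sq => SW Sr W1 IHk st sq.
  rewrite !mulrDr mulrDl mul1r; move: IHk st sq; rewrite mulrBl mul1r.
  by move: ((1 - alpha) * W k) ((1 - alpha) ^+ 2 * W k) => u v; lra.
apply: (le_trans _ (le_trans (H T (leqnn T)) _)).
  by rewrite lerDl mulr_ge0// subr_ge0.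
rewrite lerD2r lerD2l; apply: ler_wpM2l => //.
by rewrite big_ord_recr/= lerDl.
Qed.

(** [W] is eliminated between the two hypotheses: the first is multiplied by
    [5 theta / (8 L alpha)], which gives the coefficient [45/104] of [L theta r],
    less than the available [1/2]. The two contributions of [Q] have the same size
    since [alpha^2 (N hb0) = b]. *)
Lemma mean_gradient_bound (L theta alpha P2 Q hb0 b N T D0 G r W : R) :
  0 < L -> 0 < theta -> 0 < alpha -> 0 < hb0 -> 0 < b -> 0 < N -> 0 <= r -> 0 <= Q -> T <= N ->
  P2 * theta ^+ 2 = L ^+ 2 * b * alpha -> alpha ^+ 2 * (N * hb0) = b ->
  alpha * W <= 9 / 13 * Q / hb0 + 9 / 13 * (P2 * theta ^+ 2 / b) * r + T * (alpha ^+ 2 * (9 / 13 * Q / b)) ->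
  theta / (16 * L) * G + L * theta / 2 * r <= D0 + 5 * theta / (8 * L) * W ->
  N^-1 * G <= 16 * (L / (theta * N)) * D0 + 24 * Q / (hb0 * alpha * N).
Proof.
move=> L0 th0 al0 h0 b0 N0 r0 Q0 TN Pth alN HW HG.
have HW' : alpha * W <= 18 / 13 * Q / hb0 + 9 / 13 * (L ^+ 2 * alpha) * r.
  have e1 : 9 / 13 * (P2 * theta ^+ 2 / b) * r = 9 / 13 * (L ^+ 2 * alpha) * r.
    by rewrite Pth; field; rewrite gt_eqF.
  have e2 : T * (alpha ^+ 2 * (9 / 13 * Q / b)) <= 9 / 13 * Q / hb0.
    have -> : 9 / 13 * Q / hb0 = N * (alpha ^+ 2 * (9 / 13 * Q / b)).
      by rewrite -alN; field; rewrite !gt_eqF.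
    apply: ler_wpM2r => //; apply: mulr_ge0; first exact: sqr_ge0.
    by apply: mulr_ge0; [apply: mulr_ge0|rewrite invr_ge0 ltW].
  have e3 : 18 / 13 * Q / hb0 = 9 / 13 * Q / hb0 + 9 / 13 * Q / hb0 by field; rewrite gt_eqF.
  rewrite e1 in HW; rewrite e3.
  by move: HW e2; move: (9 / 13 * Q / hb0) (T * _) (_ * r) (alpha * W) => a c e f; lra.
have HWL : 5 * theta / (8 * L) * W <= 45 / 52 * (theta / (L * alpha)) * (Q / hb0) + L * theta / 2 * r.
  have k0 : 0 <= 5 * theta / (8 * L) / alpha by rewrite !divr_ge0// ?mulr_ge0// ltW.
  have := ler_wpM2l k0 HW'.
  have -> : 5 * theta / (8 * L) / alpha * (alpha * W) = 5 * theta / (8 * L) * W.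
    by field; rewrite !gt_eqF.
  have -> : 5 * theta / (8 * L) / alpha * (18 / 13 * Q / hb0 + 9 / 13 * (L ^+ 2 * alpha) * r) =
     45 / 52 * (theta / (L * alpha)) * (Q / hb0) + 45 / 104 * (L * theta * r).
    by field; rewrite !gt_eqF.
  have -> : L * theta / 2 * r = 1 / 2 * (L * theta * r) by field.
  have : 0 <= L * theta * r by rewrite mulr_ge0// mulr_ge0// ltW.
  by move: (L * theta * r) (45 / 52 * _ * _) (5 * theta / _ * W) => u v w; lra.
have HG' : theta / (16 * L) * G <= D0 + 45 / 52 * (theta / (L * alpha)) * (Q / hb0).
  by move: HG HWL; move: (_ * G) (_ * r) (_ * W) (_ * (Q / hb0)) => u v w z; lra.
have k0 : 0 <= 16 * (L / (theta * N)) by apply: mulr_ge0 => //; apply: divr_ge0; [exact: ltW|rewrite mulr_ge0// ltW].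
have := ler_wpM2l k0 HG'.
have -> : 16 * (L / (theta * N)) * (theta / (16 * L) * G) = N^-1 * G by field; rewrite !gt_eqF.
move/le_trans; apply; rewrite mulrDr lerD2l.
have -> : 16 * (L / (theta * N)) * (45 / 52 * (theta / (L * alpha)) * (Q / hb0)) =
   180 / 13 * (Q / (hb0 * alpha * N)) by field; rewrite !gt_eqF.
rewrite -(mulrA 24); apply: ler_wpM2r; last by lra.
by rewrite divr_ge0// mulr_ge0 ?mulr_ge0// ltW.
Qed.

End recursion.

(** * The run of the algorithm *)

Lemma telescope_le (R : realType) (u r e : nat -> R) k :
  (forall t, (t < k)%N -> u t.+1 + r t <= u t + e t) ->
  u k + \sum_(t < k) r t <= u 0%N + \sum_(t < k) e t.
Proof.
elim: k => [_|k IH H]; first by rewrite !big_ord0 !addr0.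
rewrite !big_ord_recr/=; have := H k (ltnSn k); have := IH (fun t tk => H t (ltnW tk)).
by lra.
Qed.

Section run.
Context {R : realType} {d d' : measure_display} {Xi : measurableType d} {Om : measurableType d'}.
Context (D : probability Xi R) (Pr : probability Om R).
Context {p q n : nat} (F : 'cV[R]_p -> Xi -> 'cV[R]_q) (K : 'M[R]_(q, n)).
Context (psi : 'cV[R]_n -> \bar R) (Reg : 'cV[R]_p -> \bar R).
Context (LF sigmaF sigmaJ MF Mpsi : R).
Hypotheses (hpsi : proper_closed_convex psi) (hReg : proper_closed_convex Reg)
  (hF : stochastic_smooth_map D F)
  (hreg : regularity D F K psi Reg LF sigmaF sigmaJ MF Mpsi)
  (hinf : (-oo < Psi0_star D F K psi Reg)%E)
  (hmu : strongly_convex_fun 1 psi).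
Context {T b0 hb0 b1 hb1 b2 hb2 : nat} (S : minibatches Om Xi b0 hb0 b1 hb1 b2 hb2).
Hypotheses (hS : sampling_scheme D Pr S T)
  (b0_gt0 : (0 < b0)%N) (hb0_gt0 : (0 < hb0)%N) (b1_gt0 : (0 < b1)%N)
  (hb1_gt0 : (0 < hb1)%N) (b2_gt0 : (0 < b2)%N) (hb2_gt0 : (0 < hb2)%N).
Context (x0 : 'cV[R]_p) (x : nat -> Om -> 'cV[R]_p) (Ft : nat -> Om -> 'cV[R]_q)
  (Jt : nat -> Om -> 'M[R]_(q, p)) (beta theta : R).

Local Notation dom := (edom (Psi0 D F K psi Reg)).
Local Notation s := (spectral_norm K).
Local Notation L := (const_L s LF MF Mpsi).
Local Notation Fm := (meanF D F).
Local Notation Past t := (g_sigma_algebraType (preimages (draws_before S t))).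
Local Notation Psi z := (fine (Psi0 D F K psi Reg z)).
Local Notation eta := (2 / (L * (3 + theta))).

Hypotheses (hx0 : dom x0) (L0 : 0 < L) (theta0 : 0 < theta) (theta1 : theta < 1)
  (galg : generated_by_algorithm S F K psi Reg T x0
    (fun=> beta) (fun=> beta) (fun=> theta) (fun=> eta) x Ft Jt).

Definition direction t w := (Jt t w)^T *m (K *m y0star K psi (Ft t w)).
Definition prox_step t w := prox eta Reg (x t w - eta *: direction t w).

Local Notation r2 t w := (frob (prox_step t w - x t w) ^+ 2).
Local Notation e2 t w := (frob (direction t w - gradPhi D F K psi (x t w)) ^+ 2).
Local Notation G2 t w := (frob (grad_mapping D F K psi Reg eta (x t w)) ^+ 2).

Let eta0 : 0 < eta. Proof. by rewrite divr_gt0// mulr_gt0// ltr_wpDr// ltW. Qed.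

Lemma x_stepE t w : (t <= T)%N -> x t.+1 w = (1 - theta) *: x t w + theta *: prox_step t w.
Proof. by move=> tT; rewrite (x_step galg w tT). Qed.

(** The algorithm never leaves the domain, where all the assumptions apply. *)
Lemma dom_iterate t w : (t <= T.+1)%N -> dom (x t w).
Proof.
elim: t => [_|t IH tT]; first by rewrite (x_init galg).
rewrite x_stepE//; apply: (dom_step hpsi hReg hmu) => //; exact: IH (ltnW tT).
Qed.

Lemma Psi_ge_star z : dom z -> fine (Psi0_star D F K psi Reg) <= Psi z.
Proof.
move=> dz; have h : (Psi0_star D F K psi Reg <= Psi0 D F K psi Reg z)%E.
  by apply: ereal_inf_lbound; exists z.
apply: fine_le => //.
  rewrite fin_numElt hinf/=; exact: le_lt_trans h dz.
by rewrite fin_numElt (lt_le_trans hinf h).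
Qed.

Lemma draw_measurable t X : (t <= T)%N -> draws S t X -> measurable_fun [set: Om] X.
Proof.
case: t => [_|t tT] /=.
  move=> [[i _ <-]|[i _ <-]]; first by have [] := iid_bat0 hS.
  by have [] := iid_hbat0 hS.
have tT' : (0 < t.+1 <= T)%N by [].
by move=> [[[[i _ <-]|[i _ <-]]|[i _ <-]]|[i _ <-]];
  [have [] := iid_bat1 hS tT'|have [] := iid_hbat1 hS tT'
  |have [] := iid_bat2 hS tT'|have [] := iid_hbat2 hS tT'].
Qed.

Lemma draws_before_sub t t' : (t <= t')%N -> draws_before S t `<=` draws_before S t'.
Proof. by move=> tt' X [k /= kt XS]; exists k => //=; exact: leq_trans kt tt'. Qed.

Lemma past_measurable t : (t <= T.+1)%N -> preimages (draws_before S t) `<=` measurable.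
Proof.
move=> tT; apply: preimages_measurable => X [k /= kt XS].
by apply: draw_measurable XS; rewrite -ltnS; exact: leq_trans kt tT.
Qed.

Lemma new_measurable t : (t <= T)%N -> preimages (draws S t) `<=` measurable.
Proof. by move=> tT; apply: preimages_measurable => X; exact: draw_measurable. Qed.

Lemma past_draw t t' X : (t < t')%N -> draws S t X ->
  measurable_fun [set: Past t'] (X : Past t' -> Xi).
Proof. by move=> tt' XS; apply: measurable_member; exists t. Qed.

Lemma measurable_mx_past t t' m l (Z : Om -> 'M[R]_(m, l)) : (t <= t')%N ->
  @measurable_mx _ _ (Past t) _ _ Z -> @measurable_mx _ _ (Past t') _ _ Z.
Proof.
by move=> tt' mZ i j; apply: (measurable_preimages_sub (draws_before_sub tt')); exact: mZ.
Qed.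

Lemma measurable_mx_Om t m l (Z : Om -> 'M[R]_(m, l)) : (t <= T.+1)%N ->
  @measurable_mx _ _ (Past t) _ _ Z -> measurable_mx Z.
Proof. by move=> tT mZ i j; apply: (measurable_fun_past (past_measurable tT)); exact: mZ. Qed.

Lemma measurable_mx_new t m l (Z : Om -> 'M[R]_(m, l)) : (t <= T)%N ->
  @measurable_mx _ _ (Past t.+1) _ _ Z -> measurable_mx Z.
Proof. by move=> tT; exact: measurable_mx_Om. Qed.

Let eF := estimable_F hpsi hReg hF hreg hmu.
Let eJ := estimable_JF hF hreg.

Lemma measurable_y0star d3 (U : measurableType d3) (Z : U -> 'cV[R]_q) : measurable_mx Z ->
  measurable_mx (fun u => K *m y0star K psi (Z u)).
Proof.
move=> mZ; apply: measurable_mxM; first exact: measurable_mx_cst.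
by apply: (@measurable_mx_lipschitz _ _ _ _ _ (y0star K psi) s) => // u v; exact: y0star_lipschitz.
Qed.

Lemma measurable_prox d3 (U : measurableType d3) (Z : U -> 'cV[R]_p) : measurable_mx Z ->
  measurable_mx (fun u => prox eta Reg (Z u)).
Proof.
move=> mZ; apply: (@measurable_mx_lipschitz _ _ _ _ _ (prox eta Reg) 1) => // u v.
by rewrite mul1r; exact: prox_nonexpansive.
Qed.

(** [x_t] depends on samples drawn before iteration [t], while the estimators also
    depend on those of iteration [t]. *)
Lemma measurable_algorithm t : (t <= T)%N ->
  [/\ @measurable_mx _ _ (Past t) _ _ (x t), @measurable_mx _ _ (Past t.+1) _ _ (Ft t)
    & @measurable_mx _ _ (Past t.+1) _ _ (Jt t)].
Proof.
elim: t => [_|t IH tT].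
  have mx0 t : @measurable_mx _ _ (Past t) _ _ (x 0).
    have -> : x 0 = (fun=> x0) by apply/funext => w; rewrite (x_init galg).
    exact: measurable_mx_cst.
  split => //.
    have -> : Ft 0 = fun w => b0%:R^-1 *: \sum_(i < b0) F (x 0 w) (bat0 S i w).
      by apply/funext => w; rewrite (Ft_init galg).
    apply: measurable_mxZ; apply: measurable_mx_sum => i.
    apply: (est_meas eF) => //; apply: (@past_draw 0) => //; by left; exists i.
  have -> : Jt 0 = fun w => hb0%:R^-1 *: \sum_(i < hb0) JF F (x 0 w) (hbat0 S i w).
    by apply/funext => w; rewrite (Jt_init galg).
  apply: measurable_mxZ; apply: measurable_mx_sum => i.
  apply: (est_meas eJ) => //; apply: (@past_draw 0) => //; by right; exists i.
have [mx mF mJ] := IH (ltnW tT).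
have mx' : @measurable_mx _ _ (Past t.+1) _ _ (x t) by exact: measurable_mx_past mx.
have mxS : @measurable_mx _ _ (Past t.+1) _ _ (x t.+1).
  have -> : x t.+1 = fun w => (1 - theta) *: x t w + theta *: prox_step t w.
    by apply/funext => w; rewrite x_stepE// ltnW.
  apply: measurable_mxD; apply: measurable_mxZ => //; apply: measurable_prox.
  apply: measurable_mxB => //; apply: measurable_mxZ; apply: measurable_mxM.
    exact: measurable_mx_tr.
  exact: measurable_y0star.
have up m l (Z : Om -> 'M[R]_(m, l)) : @measurable_mx _ _ (Past t.+1) _ _ Z ->
   @measurable_mx _ _ (Past t.+2) _ _ Z by exact: measurable_mx_past.
have nw X : draws S t.+1 X -> measurable_fun [set: Past t.+2] (X : Past t.+2 -> Xi).
  by apply: past_draw.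
split => //.
  have -> : Ft t.+1 = fun w => beta *: Ft t w
      + (beta / b1%:R) *: \sum_(i < b1)
          (F (x t.+1 w) (bat1 S t.+1 i w) - F (x t w) (bat1 S t.+1 i w))
      + ((1 - beta) / b2%:R) *: \sum_(i < b2) F (x t.+1 w) (bat2 S t.+1 i w).
    by apply/funext => w; rewrite (Ft_step galg).
  apply: measurable_mxD; first apply: measurable_mxD.
  - by apply: measurable_mxZ; exact: up.
  - apply: measurable_mxZ; apply: measurable_mx_sum => i.
    by apply: measurable_mxB; apply: (est_meas eF); [exact: up|apply: nw; do 3 left; exists i|exact: up|apply: nw; do 3 left; exists i].
  - apply: measurable_mxZ; apply: measurable_mx_sum => i.
    by apply: (est_meas eF); [exact: up|apply: nw; left; right; exists i].
have -> : Jt t.+1 = fun w => beta *: Jt t w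
      + (beta / hb1%:R) *: \sum_(i < hb1)
          (JF F (x t.+1 w) (hbat1 S t.+1 i w) - JF F (x t w) (hbat1 S t.+1 i w))
      + ((1 - beta) / hb2%:R) *: \sum_(i < hb2) JF F (x t.+1 w) (hbat2 S t.+1 i w).
  by apply/funext => w; rewrite (Jt_step galg).
apply: measurable_mxD; first apply: measurable_mxD.
- by apply: measurable_mxZ; exact: up.
- apply: measurable_mxZ; apply: measurable_mx_sum => i.
  by apply: measurable_mxB; apply: (est_meas eJ); [exact: up|apply: nw; do 2 left; right; exists i|exact: up|apply: nw; do 2 left; right; exists i].
- apply: measurable_mxZ; apply: measurable_mx_sum => i.
  by apply: (est_meas eJ); [exact: up|apply: nw; right; exists i].
Qed.

Local Notation MSF t := (mean_square Pr (fun w => (Ft t w - Fm (x t w))%R)).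
Local Notation MSJ t := (mean_square Pr (fun w => (Jt t w - Jac Fm (x t w))%R)).
Local Notation MSr t := (mean_square Pr (fun w => (prox_step t w - x t w)%R)).
Local Notation MSe t := (mean_square Pr (fun w => (direction t w - gradPhi D F K psi (x t w))%R)).

Lemma measurable_direction t : (t <= T)%N ->
  [/\ @measurable_mx _ _ (Past t.+1) _ _ (prox_step t),
      @measurable_mx _ _ (Past t.+1) _ _ (fun w => prox_step t w - x t w),
      @measurable_mx _ _ (Past t) _ _ (fun w => gradPhi D F K psi (x t w)),
      @measurable_mx _ _ (Past t.+1) _ _ (fun w => direction t w - gradPhi D F K psi (x t w))
    & @measurable_mx _ _ (Past t) _ _ (fun w => grad_mapping D F K psi Reg eta (x t w))].
Proof.
move=> tT; have [mx mF mJ] := measurable_algorithm tT.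
have mx' : @measurable_mx _ _ (Past t.+1) _ _ (x t) by exact: measurable_mx_past mx.
have md : @measurable_mx _ _ (Past t.+1) _ _ (direction t).
  by apply: measurable_mxM; [exact: measurable_mx_tr|exact: measurable_y0star].
have mp : @measurable_mx _ _ (Past t.+1) _ _ (prox_step t).
  by apply: measurable_prox; apply: measurable_mxB => //; exact: measurable_mxZ.
have mg : @measurable_mx _ _ (Past t) _ _ (fun w => gradPhi D F K psi (x t w)).
  apply: measurable_mxM; first by apply: measurable_mx_tr; exact: (est_meas_mean eJ).
  by apply: measurable_y0star; exact: (est_meas_mean eF).
split => //.
- exact: measurable_mxB.
- by apply: measurable_mxB => //; exact: measurable_mx_past mg.
- have -> : (fun w => grad_mapping D F K psi Reg eta (x t w)) =
      fun w => eta^-1 *: (x t w - prox eta Reg (x t w - eta *: gradPhi D F K psi (x t w))).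
    by apply/funext => w; rewrite /grad_mapping grad_Phi0.
  apply: measurable_mxZ; apply: (measurable_mxB mx).
  apply: (@measurable_prox _ (Past t)).
  by apply: (measurable_mxB mx); exact: measurable_mxZ.
Qed.

Lemma measurable_errors t : (t <= T)%N ->
  measurable_mx (fun w => Ft t w - Fm (x t w)) /\
  measurable_mx (fun w => Jt t w - Jac Fm (x t w)).
Proof.
move=> tT; have [mx mF mJ] := measurable_algorithm tT.
have tT1 : (t.+1 <= T.+1)%N by [].
have mxO := measurable_mx_Om (leqW tT) mx.
split; apply: measurable_mxB.
- exact: (measurable_mx_Om tT1 mF).
- exact: (est_meas_mean eF).
- exact: (measurable_mx_Om tT1 mJ).
- exact: (est_meas_mean eJ).
Qed.

(** Holds for each trajectory, so that no measurability of the objective along the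
    iterates is involved. *)
Lemma objective_sum k w : (k <= T.+1)%N ->
  Psi (x k w) + L * theta * \sum_(t < k) r2 t w
    <= Psi x0 + theta / (2 * L) * \sum_(t < k) e2 t w.
Proof.
move=> kT; rewrite !mulr_sumr -(x_init galg w).
apply: (@telescope_le _ (fun k => Psi (x k w)) (fun t => L * theta * r2 t w)
  (fun t => theta / (2 * L) * e2 t w)) => t tk.
have tT : (t < T.+1)%N by exact: leq_trans tk kT.
rewrite x_stepE//; apply: (objective_step hpsi hReg hF hreg hmu) => //.
exact: dom_iterate (ltnW tT).
Qed.

Lemma descent_sum w :
  theta / (16 * L) * \sum_(t < T.+1) G2 t w + L * theta / 2 * \sum_(t < T.+1) r2 t w
    <= Psi x0 - fine (Psi0_star D F K psi Reg) + 5 * theta / (8 * L) * \sum_(t < T.+1) e2 t w.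
Proof.
rewrite !mulr_sumr -big_split/= -(x_init galg w).
have H := @telescope_le _ (fun k => Psi (x k w))
  (fun t => theta / (16 * L) * G2 t w + L * theta / 2 * r2 t w)
  (fun t => 5 * theta / (8 * L) * e2 t w) T.+1.
have conclude (u u0 m A B : R) : u + A <= u0 + B -> m <= u -> A <= u0 - m + B by lra.
apply: (conclude (Psi (x T.+1 w))); last by apply: Psi_ge_star; exact: dom_iterate.
apply: H => t tT; have move_left (u1 u0 a e : R) : a <= u0 - u1 + e -> u1 + a <= u0 + e by lra.
apply: move_left; rewrite x_stepE//; apply: (descent_step hpsi hReg hF hreg hmu) => //.
exact: dom_iterate (ltnW tT).
Qed.

Let D0 := Psi x0 - fine (Psi0_star D F K psi Reg).
Let D0_ge0 : 0 <= D0. Proof. by rewrite subr_ge0; exact: Psi_ge_star. Qed.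

Lemma direction_error_le t : (t <= T)%N ->
  (MSe t <= (2 * s ^+ 2 * Mpsi ^+ 2)%:E * MSJ t + (2 * MF ^+ 2 * s ^+ 4)%:E * MSF t)%E.
Proof.
move=> tT; have [mF mJ] := measurable_errors tT.
have [_ _ _ me _] := measurable_direction tT.
have meO := measurable_mx_new tT me.
have c1 : 0 <= 2 * s ^+ 2 * Mpsi ^+ 2 by exact: mulr_ge0 (mulr_ge0 (ler0n _ _) (sqr_ge0 _)) (sqr_ge0 _).
have c2 : 0 <= 2 * MF ^+ 2 * s ^+ 4 by exact: mulr_ge0 (mulr_ge0 (ler0n _ _) (sqr_ge0 _)) (exprn_ge0 _ (spectral_norm_ge0 _)).
rewrite /mean_square -!ge0_integralZl ?lee_fin//; first last.
- by move=> w _; rewrite lee_fin sqr_ge0.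
- by apply/measurable_EFinP; exact: measurable_sqr_frob.
- by move=> w _; rewrite lee_fin sqr_ge0.
- by apply/measurable_EFinP; exact: measurable_sqr_frob.
rewrite -ge0_integralD//; first last.
- by apply: measurable_funeM; apply/measurable_EFinP; exact: measurable_sqr_frob.
- by move=> w _; rewrite -EFinM lee_fin mulr_ge0// sqr_ge0.
- by apply: measurable_funeM; apply/measurable_EFinP; exact: measurable_sqr_frob.
- by move=> w _; rewrite -EFinM lee_fin mulr_ge0// sqr_ge0.
apply: ge0_le_integral => //.
- by move=> w _; rewrite lee_fin sqr_ge0.
- by apply/measurable_EFinP; exact: measurable_sqr_frob.
- apply: emeasurable_funD; apply: measurable_funeM; apply/measurable_EFinP; exact: measurable_sqr_frob.
move=> w _; rewrite -!EFinM -EFinD lee_fin.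
apply: (sqr_gradient_error hpsi hF hreg hmu); exact: dom_iterate (leqW tT).
Qed.

Lemma integral_le_affine k (f : Om -> R) (g : nat -> Om -> R) (a c : R) :
  0 <= a -> 0 <= c -> measurable_fun [set: Om] f -> (forall w, 0 <= f w) ->
  (forall t, (t < k)%N -> measurable_fun [set: Om] (g t)) -> (forall t w, 0 <= g t w) ->
  (forall w, f w <= c + a * \sum_(t < k) g t w) ->
  (\int[Pr]_w (f w)%:E <= c%:E + a%:E * \sum_(t < k) \int[Pr]_w (g t w)%:E)%E.
Proof.
move=> a0 c0 mf f0 mg g0 fg.
have mG : measurable_fun [set: Om] (fun w => \sum_(t < k) g t w).
  by apply: measurable_sum => i; exact: mg.
have -> : (\sum_(t < k) \int[Pr]_w (g t w)%:E = \int[Pr]_w (\sum_(t < k) g t w)%:E)%E.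
  rewrite -ge0_integral_sum//.
  - by apply: eq_integral => w _; rewrite sumEFin.
  - by move=> i; apply/measurable_EFinP; exact: mg.
  - by move=> i w _; rewrite lee_fin.
have G0 w : 0 <= \sum_(t < k) g t w by exact: sumr_ge0.
rewrite -ge0_integralZl//; first last.
- by move=> w _; rewrite lee_fin.
- by apply/measurable_EFinP.
have -> : (c%:E = \int[Pr]_w (cst c%:E) w)%E by rewrite integral_cst//= probability_setT mule1.
rewrite -ge0_integralD//; first last.
- by apply: measurable_funeM; apply/measurable_EFinP.
- by move=> w _; rewrite -EFinM lee_fin mulr_ge0.
apply: ge0_le_integral => //.
- by move=> w _; rewrite lee_fin.
- by apply/measurable_EFinP.
- by apply: emeasurable_funD => //; apply: measurable_funeM; apply/measurable_EFinP.
by move=> w _; rewrite -EFinM -EFinD lee_fin.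
Qed.

(** [objective_sum] bounds the squared step by the initial gap and the errors. *)
Lemma step_square_lt t : (t <= T)%N -> (forall k, (k <= t)%N -> MSe k < +oo)%E -> (MSr t < +oo)%E.
Proof.
move=> tT eoo; have [_ mr _ _ _] := measurable_direction tT.
have Lt0 : 0 < L * theta by rewrite mulr_gt0.
have mrO := measurable_mx_new tT mr.
have := @integral_le_affine t.+1 (fun w => r2 t w) (fun k w => e2 k w)
  ((L * theta)^-1 * (theta / (2 * L))) ((L * theta)^-1 * D0).
rewrite /= -/(MSr t) => H.
have c0 : 0 <= (L * theta)^-1 * (theta / (2 * L)).
  by rewrite mulr_ge0 ?invr_ge0 ?divr_ge0// ?mulr_ge0// ltW.
apply: (le_lt_trans (H c0 _ _ _ _ _ _)) => //.
- by rewrite mulr_ge0// invr_ge0 ltW.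
- exact: measurable_sqr_frob.
- by move=> w; exact: sqr_ge0.
- move=> k kt; have kT : (k <= T)%N by rewrite (leq_trans _ tT).
  by have [_ _ _ me _] := measurable_direction kT; exact: measurable_sqr_frob (measurable_mx_new kT me).
- by move=> k w; exact: sqr_ge0.
- move=> w; rewrite -mulrA -mulrDr ler_pdivlMl//.
  have := objective_sum w (tT : (t.+1 <= T.+1)%N).
  have := Psi_ge_star (dom_iterate w (tT : (t.+1 <= T.+1)%N)).
  have -> : \sum_(k < t.+1) r2 k w = \sum_(k < t) r2 k w + r2 t w by rewrite big_ord_recr.
  rewrite (mulrDr (L * theta)).
  have : 0 <= L * theta * \sum_(i < t) r2 i w.
    by rewrite mulr_ge0 ?(ltW Lt0)// sumr_ge0// => i _; exact: sqr_ge0.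
  rewrite /D0; move: (L * theta * _) (L * theta * _) (theta / _ * _) (Psi _) (Psi _) (fine _) => u1 u2 u3 u4 u5 u6.
  lra.
rewrite lte_add_pinfty ?ltry// lte_mul_pinfty ?lee_fin//.
apply: lte_sum_pinfty => i _; apply: eoo; by rewrite -ltnS.
Qed.

Let indep_now t : (t < T)%N ->
  indep_systems Pr <<s preimages (draws S t.+1)>> <<s preimages (draws_before S t.+1)>>.
Proof. by move=> tT; exact: (indep_past hS). Qed.

Lemma kappa_cases t : (t < T)%N ->
  kappa Pr S T = 2 :> R \/ kappa Pr S T = 1 :> R /\
    (forall i j, indep_pair D Pr (bat1 S t.+1 i) (bat2 S t.+1 j)).
Proof.
move=> tT; have tT' : (0 < t.+1 <= T)%N by [].
rewrite /kappa; case: asboolP => [H|_]; last by left.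
right; split => // i j; apply: indep_systems_pair (H _ tT'); [by exists i|by exists j| |].
  exact: iid_law (iid_bat1 hS tT').
exact: iid_law (iid_bat2 hS tT').
Qed.

Lemma hkappa_cases t : (t < T)%N ->
  hkappa Pr S T = 2 :> R \/ hkappa Pr S T = 1 :> R /\
    (forall i j, indep_pair D Pr (hbat1 S t.+1 i) (hbat2 S t.+1 j)).
Proof.
move=> tT; have tT' : (0 < t.+1 <= T)%N by [].
rewrite /hkappa; case: asboolP => [H|_]; last by left.
right; split => // i j; apply: indep_systems_pair (H _ tT'); [by exists i|by exists j| |].
  exact: iid_law (iid_hbat1 hS tT').
exact: iid_law (iid_hbat2 hS tT').
Qed.

Lemma increment_mean_square t : (t <= T)%N ->
  mean_square Pr (fun w => (x t.+1 w - x t w)%R) = ((theta ^+ 2)%:E * MSr t)%E.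
Proof.
move=> tT; have [_ mr _ _ _] := measurable_direction tT; have mrO := measurable_mx_new tT mr.
rewrite /mean_square -ge0_integralZl//; first last.
- by rewrite lee_fin sqr_ge0.
- by move=> w _; rewrite lee_fin sqr_ge0.
- by apply/measurable_EFinP; exact: measurable_sqr_frob.
apply: eq_integral => w _; rewrite -EFinM x_stepE//; congr EFin.
have -> : (1 - theta) *: x t w + theta *: prox_step t w - x t w = theta *: (prox_step t w - x t w).
  by apply/matrixP => i j; rewrite !mxE; ring.
by rewrite frobZ exprMn ger0_norm// ltW.
Qed.

Let draw1 t i : draws S t.+1 (bat1 S t.+1 i). Proof. by do 3 left; exists i. Qed.
Let draw2 t i : draws S t.+1 (bat2 S t.+1 i). Proof. by left; right; exists i. Qed.
Let hdraw1 t i : draws S t.+1 (hbat1 S t.+1 i). Proof. by do 2 left; right; exists i. Qed.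
Let hdraw2 t i : draws S t.+1 (hbat2 S t.+1 i). Proof. by right; exists i. Qed.

Lemma error_F_init : (MSF 0 <= (sigmaF ^+ 2 / b0%:R)%:E)%E.
Proof.
have iid := iid_bat0 hS; have [mX _ _] := iid.
have H := estimator_init eF (E := Ft 0) b0_gt0 hx0 mX (fun i => iid_law i iid) (fun i j => iid_indep_pair iid).
have -> : MSF 0 = mean_square Pr (fun w => (Ft 0 w - Fm x0)%R).
  by have -> : x 0 = (fun=> x0) by apply/funext => w; rewrite (x_init galg).
by apply: H => w; rewrite (Ft_init galg) (x_init galg).
Qed.

Lemma error_J_init : (MSJ 0 <= (sigmaJ ^+ 2 / hb0%:R)%:E)%E.
Proof.
have iid := iid_hbat0 hS; have [mX _ _] := iid.
have H := estimator_init eJ (E := Jt 0) hb0_gt0 hx0 mX (fun i => iid_law i iid) (fun i j => iid_indep_pair iid).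
have -> : MSJ 0 = mean_square Pr (fun w => (Jt 0 w - Jac Fm x0)%R).
  by have -> : x 0 = (fun=> x0) by apply/funext => w; rewrite (x_init galg).
by apply: H => w; rewrite (Jt_init galg) (x_init galg).
Qed.

Lemma error_F_step t : (t < T)%N -> (MSF t < +oo)%E -> (MSr t < +oo)%E ->
  (MSF t.+1 <= (beta ^+ 2)%:E * MSF t + (kappa Pr S T)%:E *
     ((beta ^+ 2 / b1%:R * MF ^+ 2)%:E * ((theta ^+ 2)%:E * MSr t)
      + ((1 - beta) ^+ 2 / b2%:R * sigmaF ^+ 2)%:E))%E.
Proof.
move=> tT Foo roo; have tT' : (0 < t.+1 <= T)%N by [].
have [mx mF _] := measurable_algorithm (ltnW tT).
have [mx1 _ _] := measurable_algorithm tT.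
have [mE _] := measurable_errors tT.
have iid1 := iid_bat1 hS tT'; have iid2 := iid_bat2 hS tT'.
rewrite -increment_mean_square; last exact: ltnW.
apply: (@estimator_step _ _ _ _ _ D Pr _ _ _ F Fm dom sigmaF MF eF _ _
  (past_measurable (leqW tT)) (new_measurable tT) (indep_now tT) (x t.+1) (x t)
  mx1 (measurable_mx_past (leqnSn t) mx) _ _ _ _ (bat1 S t.+1) (bat2 S t.+1) (Ft t) (Ft t.+1) beta
  (kappa Pr S T) b1_gt0 b2_gt0) => //.
- by move=> w; exact: dom_iterate (leqW tT).
- by move=> w; exact: dom_iterate (leqW (ltnW tT)).
- by move=> i; exact: measurable_member.
- by move=> i; exact: iid_law iid1.
- by move=> i j; exact: iid_indep_pair iid1.
- by move=> i; exact: measurable_member.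
- by move=> i; exact: iid_law iid2.
- by move=> i j; exact: iid_indep_pair iid2.
- exact: kappa_cases.
- by rewrite increment_mean_square ?(ltnW tT)// lte_mul_pinfty// lee_fin sqr_ge0.
- by move=> w; rewrite (Ft_step galg).
Qed.

Lemma error_J_step t : (t < T)%N -> (MSJ t < +oo)%E -> (MSr t < +oo)%E ->
  (MSJ t.+1 <= (beta ^+ 2)%:E * MSJ t + (hkappa Pr S T)%:E *
     ((beta ^+ 2 / hb1%:R * LF ^+ 2)%:E * ((theta ^+ 2)%:E * MSr t)
      + ((1 - beta) ^+ 2 / hb2%:R * sigmaJ ^+ 2)%:E))%E.
Proof.
move=> tT Joo roo; have tT' : (0 < t.+1 <= T)%N by [].
have [mx _ mJ] := measurable_algorithm (ltnW tT).
have [mx1 _ _] := measurable_algorithm tT.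
have [_ mE] := measurable_errors tT.
have iid1 := iid_hbat1 hS tT'; have iid2 := iid_hbat2 hS tT'.
rewrite -increment_mean_square; last exact: ltnW.
apply: (@estimator_step _ _ _ _ _ D Pr _ _ _ (JF F) (Jac Fm) dom sigmaJ LF eJ _ _
  (past_measurable (leqW tT)) (new_measurable tT) (indep_now tT) (x t.+1) (x t)
  mx1 (measurable_mx_past (leqnSn t) mx) _ _ _ _ (hbat1 S t.+1) (hbat2 S t.+1) (Jt t) (Jt t.+1) beta
  (hkappa Pr S T) hb1_gt0 hb2_gt0) => //.
- by move=> w; exact: dom_iterate (leqW tT).
- by move=> w; exact: dom_iterate (leqW (ltnW tT)).
- by move=> i; exact: measurable_member.
- by move=> i; exact: iid_law iid1.
- by move=> i j; exact: iid_indep_pair iid1.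
- by move=> i; exact: measurable_member.
- by move=> i; exact: iid_law iid2.
- by move=> i j; exact: iid_indep_pair iid2.
- exact: hkappa_cases.
- by rewrite increment_mean_square ?(ltnW tT)// lte_mul_pinfty// lee_fin sqr_ge0.
- by move=> w; rewrite (Jt_step galg).
Qed.

Lemma direction_error_lt t : (t <= T)%N -> (MSF t < +oo)%E -> (MSJ t < +oo)%E -> (MSe t < +oo)%E.
Proof.
move=> tT Foo Joo; apply: (le_lt_trans (direction_error_le tT)).
have c1 : 0 <= 2 * s ^+ 2 * Mpsi ^+ 2 by exact: mulr_ge0 (mulr_ge0 (ler0n _ _) (sqr_ge0 _)) (sqr_ge0 _).
have c2 : 0 <= 2 * MF ^+ 2 * s ^+ 4 by exact: mulr_ge0 (mulr_ge0 (ler0n _ _) (sqr_ge0 _)) (exprn_ge0 _ (spectral_norm_ge0 _)).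
by rewrite lte_add_pinfty// lte_mul_pinfty// lee_fin.
Qed.

Lemma kappa_ge1 : 1 <= kappa Pr S T :> R.
Proof. by rewrite /kappa; case: ifP => _ //; rewrite ler1n. Qed.

Lemma hkappa_ge1 : 1 <= hkappa Pr S T :> R.
Proof. by rewrite /hkappa; case: ifP => _ //; rewrite ler1n. Qed.

(** Strong induction: finite errors up to time [t] make the step at time [t] square
    integrable, and this makes the errors at time [t + 1] finite. *)
Lemma errors_finite t : (t <= T)%N -> (MSF t < +oo)%E /\ (MSJ t < +oo)%E.
Proof.
suff H k : (k <= T)%N -> forall t, (t <= k)%N -> (MSF t < +oo)%E /\ (MSJ t < +oo)%E.
  by move=> tT; exact: (H t tT t (leqnn t)).
elim: k => [_ t'|k IH kT t'].
  rewrite leqn0 => /eqP ->; split.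
    by apply: (le_lt_trans error_F_init); rewrite ltry.
  by apply: (le_lt_trans error_J_init); rewrite ltry.
rewrite leq_eqVlt => /predU1P[->{t'}|]; last by apply: IH; exact: ltnW.
have {}IH := IH (ltnW kT); have [Foo Joo] := IH k (leqnn k).
have roo : (MSr k < +oo)%E.
  apply: step_square_lt => [|j jk]; first exact: ltnW.
  by have [F1 J1] := IH j jk; apply: direction_error_lt => //; exact: leq_trans jk (ltnW kT).
have bound (a b c e : R) (u v : \bar R) : 0 <= a -> 0 <= b -> 0 <= c -> (u < +oo)%E -> (v < +oo)%E ->
    (a%:E * u + b%:E * (c%:E * ((theta ^+ 2)%:E * v) + e%:E) < +oo)%E.
  move=> a0 b0' c0 uoo voo; rewrite lte_add_pinfty// lte_mul_pinfty// ?lee_fin//.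
  rewrite lte_add_pinfty ?ltry// lte_mul_pinfty ?lee_fin//.
  by rewrite lte_mul_pinfty// lee_fin sqr_ge0.
split.
  apply: (le_lt_trans (error_F_step kT Foo roo)); apply: bound => //; rewrite ?sqr_ge0//.
    exact: le_trans ler01 kappa_ge1.
  by rewrite mulr_ge0 ?sqr_ge0// divr_ge0 ?sqr_ge0.
apply: (le_lt_trans (error_J_step kT Joo roo)); apply: bound => //; rewrite ?sqr_ge0//.
  exact: le_trans ler01 hkappa_ge1.
by rewrite mulr_ge0 ?sqr_ge0// divr_ge0 ?sqr_ge0.
Qed.

Lemma step_square_finite t : (t <= T)%N -> (MSr t < +oo)%E.
Proof.
move=> tT; apply: step_square_lt => // k kt; have kT := leq_trans kt tT.
by have [Foo Joo] := errors_finite kT; exact: direction_error_lt.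
Qed.

Section totals.
Context (c0 : R) (c0_gt0 : 0 < c0).
Hypotheses (b0E : b0%:R = c0 * hb0%:R :> R) (b1E : b1%:R = c0 * hb1%:R :> R)
  (b2E : b2%:R = c0 * hb1%:R :> R) (hb2E : hb2 = hb1).
Local Notation P := (const_P s c0 (kappa Pr S T) (hkappa Pr S T) LF MF Mpsi).
Local Notation Q := (const_Q s c0 (kappa Pr S T) (hkappa Pr S T) sigmaF sigmaJ MF Mpsi).

Definition step_mean t : R := fine (MSr t).
(** The weights are those of [sqr_gradient_error]. *)
Definition error_mean t : R :=
  2 * s ^+ 2 * Mpsi ^+ 2 * fine (MSJ t) + 2 * MF ^+ 2 * s ^+ 4 * fine (MSF t).
Definition grad_mean t : R := fine (\int[Pr]_w (G2 t w)%:E).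

Let fineE (u : \bar R) : (0 <= u)%E -> (u < +oo)%E -> u = (fine u)%:E.
Proof. by move=> u0 uoo; rewrite fineK// ge0_fin_numE. Qed.

Let fine_affine (u u1 v : \bar R) (a k b c e : R) :
  (0 <= u)%E -> (u < +oo)%E -> (0 <= u1)%E -> (u1 < +oo)%E -> (0 <= v)%E -> (v < +oo)%E ->
  (u1 <= a%:E * u + k%:E * (b%:E * (c%:E * v) + e%:E))%E ->
  fine u1 <= a * fine u + k * (b * (c * fine v) + e).
Proof.
case: u => [u| |]// _ _; case: u1 => [u1| |]// _ _; by case: v => [v| |].
Qed.

Lemma step_mean_ge0 t : 0 <= step_mean t.
Proof. by apply: fine_ge0; exact: mean_square_ge0. Qed.

Let wJ : 0 <= 2 * s ^+ 2 * Mpsi ^+ 2.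
Proof. exact: mulr_ge0 (mulr_ge0 (ler0n _ _) (sqr_ge0 _)) (sqr_ge0 _). Qed.
Let wF : 0 <= 2 * MF ^+ 2 * s ^+ 4.
Proof. exact: mulr_ge0 (mulr_ge0 (ler0n _ _) (sqr_ge0 _)) (exprn_ge0 _ (spectral_norm_ge0 _)). Qed.

Lemma error_mean_ge0 t : 0 <= error_mean t.
Proof. by rewrite addr_ge0// mulr_ge0// fine_ge0// mean_square_ge0. Qed.

Let hb0R : 0 < hb0%:R :> R. Proof. by rewrite ltr0n. Qed.
Let hb1R : 0 < hb1%:R :> R. Proof. by rewrite ltr0n. Qed.

Lemma sqr_const_P : P ^+ 2 =
  26 / (9 * c0) * s ^+ 2 * (kappa Pr S T * MF ^+ 4 * s ^+ 2 + c0 * hkappa Pr S T * LF ^+ 2 * Mpsi ^+ 2).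
Proof.
have k0 : 0 <= kappa Pr S T :> R by exact: le_trans ler01 kappa_ge1.
have h0 : 0 <= hkappa Pr S T :> R by exact: le_trans ler01 hkappa_ge1.
rewrite /const_P exprMn sqr_sqrtr; last first.
  apply: addr_ge0; first exact: mulr_ge0 (mulr_ge0 k0 (exprn_even_ge0 MF (isT : ~~ odd 4))) (sqr_ge0 _).
  exact: mulr_ge0 (mulr_ge0 (mulr_ge0 (ltW c0_gt0) h0) (sqr_ge0 _)) (sqr_ge0 _).
have e1 : Num.sqrt 26 ^+ 2 = 26 :> R by rewrite sqr_sqrtr ?ler0n.
have e2 : Num.sqrt c0 ^+ 2 = c0 by rewrite sqr_sqrtr// ltW.
congr (_ * _); rewrite expr_div_n !exprMn e1 e2.
by field; rewrite gt_eqF.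
Qed.

(** As [b0 = c0 hb0], both variances enter with the weight [2 s^2 / (c0 hb0)],
    where [2 = 9/13 * 26/9], and [kappa] and [hkappa] are at least 1. *)
Lemma error_mean_init : error_mean 0 <= 9 / 13 * Q / hb0%:R.
Proof.
have [Foo Joo] := errors_finite (leq0n T).
have F1 := error_F_init; have J1 := error_J_init.
rewrite (fineE (mean_square_ge0 _ _) Foo) lee_fin in F1.
rewrite (fineE (mean_square_ge0 _ _) Joo) lee_fin in J1.
apply: (@le_trans _ _ (2 * s ^+ 2 * Mpsi ^+ 2 * (sigmaJ ^+ 2 / hb0%:R) + 2 * MF ^+ 2 * s ^+ 4 * (sigmaF ^+ 2 / b0%:R))).
  by apply: lerD; exact: ler_wpM2l.
have k1 : MF ^+ 2 * s ^+ 2 * sigmaF ^+ 2 <= kappa Pr S T * (MF ^+ 2 * s ^+ 2 * sigmaF ^+ 2).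
  by rewrite ler_peMl ?kappa_ge1// mulr_ge0 ?sqr_ge0// mulr_ge0 ?sqr_ge0.
have h1 : Mpsi ^+ 2 * sigmaJ ^+ 2 <= hkappa Pr S T * (Mpsi ^+ 2 * sigmaJ ^+ 2).
  by rewrite ler_peMl ?hkappa_ge1// mulr_ge0 ?sqr_ge0.
rewrite b0E.
have -> : 2 * s ^+ 2 * Mpsi ^+ 2 * (sigmaJ ^+ 2 / hb0%:R) + 2 * MF ^+ 2 * s ^+ 4 * (sigmaF ^+ 2 / (c0 * hb0%:R))
  = 2 * s ^+ 2 / (c0 * hb0%:R) * (MF ^+ 2 * s ^+ 2 * sigmaF ^+ 2 + c0 * (Mpsi ^+ 2 * sigmaJ ^+ 2)).
  by field; rewrite !gt_eqF.
have -> : 9 / 13 * Q / hb0%:R = 2 * s ^+ 2 / (c0 * hb0%:R) *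
   (kappa Pr S T * (MF ^+ 2 * s ^+ 2 * sigmaF ^+ 2) + c0 * (hkappa Pr S T * (Mpsi ^+ 2 * sigmaJ ^+ 2))).
  by rewrite /const_Q; field; rewrite !gt_eqF.
apply: ler_wpM2l; first by apply: divr_ge0; apply: mulr_ge0; rewrite ?sqr_ge0// ltW.
by apply: lerD => //; rewrite ler_pM2l.
Qed.

(** The constants [P] and [Q] are made for this recursion: their brackets are the
    weighted sums of the two contributions, and [26/9 * 9/13 = 2] is the weight in
    [error_mean]. *)
Lemma error_mean_step t : (t < T)%N ->
  error_mean t.+1 <= beta ^+ 2 * error_mean t
    + 9 / 13 * (P ^+ 2 * theta ^+ 2 / hb1%:R) * beta ^+ 2 * step_mean t
    + (1 - beta) ^+ 2 * (9 / 13 * Q / hb1%:R).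
Proof.
move=> tT; have [Foo Joo] := errors_finite (ltnW tT); have [Foo1 Joo1] := errors_finite tT.
have roo := step_square_finite (ltnW tT).
have F1 := error_F_step tT Foo roo; have J1 := error_J_step tT Joo roo.
have {}F1 := fine_affine (mean_square_ge0 _ _) Foo (mean_square_ge0 _ _) Foo1 (mean_square_ge0 _ _) roo F1.
have {}J1 := fine_affine (mean_square_ge0 _ _) Joo (mean_square_ge0 _ _) Joo1 (mean_square_ge0 _ _) roo J1.
rewrite -/(step_mean t) in F1; rewrite -/(step_mean t) in J1.
rewrite sqr_const_P.
apply: (le_trans (lerD (ler_wpM2l wJ J1) (ler_wpM2l wF F1))).
have hb2R : hb2%:R = hb1%:R :> R by rewrite hb2E.
rewrite /error_mean b1E b2E hb2R le_eqVlt; apply/orP; left; apply/eqP; rewrite /const_Q.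
move: (fine _) (fine _) (step_mean t) (kappa _ _ _) (hkappa _ _ _) => f j r k h.
by field; rewrite !gt_eqF.
Qed.

Lemma direction_error_le_mean t : (t <= T)%N -> (MSe t <= (error_mean t)%:E)%E.
Proof.
move=> tT; apply: (le_trans (direction_error_le tT)).
have [Foo Joo] := errors_finite tT.
by rewrite (fineE (mean_square_ge0 _ _) Foo) (fineE (mean_square_ge0 _ _) Joo).
Qed.

Lemma integral_affine_sums k (f g : nat -> Om -> R) (a b : R) : 0 <= a -> 0 <= b ->
  (forall t, (t < k)%N -> measurable_fun [set: Om] (f t)) -> (forall t w, 0 <= f t w) ->
  (forall t, (t < k)%N -> measurable_fun [set: Om] (g t)) -> (forall t w, 0 <= g t w) ->
  (\int[Pr]_w (a * (\sum_(t < k) f t w) + b * (\sum_(t < k) g t w))%:E =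
    a%:E * \sum_(t < k) \int[Pr]_w (f t w)%:E + b%:E * \sum_(t < k) \int[Pr]_w (g t w)%:E)%E.
Proof.
move=> a0 b0' mf f0 mg g0.
have sumE (h : nat -> Om -> R) : (forall t, (t < k)%N -> measurable_fun [set: Om] (h t)) ->
    (forall t w, 0 <= h t w) ->
    (\sum_(t < k) \int[Pr]_w (h t w)%:E = \int[Pr]_w (\sum_(t < k) h t w)%:E)%E.
  move=> mh h0; rewrite -ge0_integral_sum//.
  - by apply: eq_integral => w _; rewrite sumEFin.
  - by move=> i; apply/measurable_EFinP; exact: mh.
  - by move=> i w _; rewrite lee_fin.
have mS (h : nat -> Om -> R) : (forall t, (t < k)%N -> measurable_fun [set: Om] (h t)) ->
    measurable_fun [set: Om] (fun w => (\sum_(t < k) h t w)%:E).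
  by move=> mh; apply/measurable_EFinP; apply: measurable_sum => i; exact: mh.
have S0 (h : nat -> Om -> R) : (forall t w, 0 <= h t w) -> forall w, (0 <= (\sum_(t < k) h t w)%:E)%E.
  by move=> h0 w; rewrite lee_fin; apply: sumr_ge0.
rewrite !sumE// -!ge0_integralZl ?lee_fin//; first last.
- by move=> w _; exact: S0.
- exact: mS.
- by move=> w _; exact: S0.
- exact: mS.
rewrite -ge0_integralD//.
- by move=> w _; apply: mule_ge0; rewrite ?lee_fin// -lee_fin; exact: S0.
- by apply: measurable_funeM; exact: mS.
- by move=> w _; apply: mule_ge0; rewrite ?lee_fin// -lee_fin; exact: S0.
- by apply: measurable_funeM; exact: mS.
Qed.

Let mr t : (t < T.+1)%N -> measurable_fun [set: Om] (fun w => r2 t w).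
Proof.
by move=> tT; have [_ m _ _ _] := measurable_direction tT; exact: measurable_sqr_frob (measurable_mx_new tT m).
Qed.
Let me t : (t < T.+1)%N -> measurable_fun [set: Om] (fun w => e2 t w).
Proof.
by move=> tT; have [_ _ _ m _] := measurable_direction tT; exact: measurable_sqr_frob (measurable_mx_new tT m).
Qed.
Let mG t : (t < T.+1)%N -> measurable_fun [set: Om] (fun w => G2 t w).
Proof.
by move=> tT; have [_ _ _ _ m] := measurable_direction tT; exact: measurable_sqr_frob (measurable_mx_Om (leqW tT) m).
Qed.

Let aG_gt0 : 0 < theta / (16 * L). Proof. by rewrite divr_gt0// mulr_gt0. Qed.
Let br_gt0 : 0 < L * theta / 2. Proof. by rewrite divr_gt0// mulr_gt0. Qed.
Let ce_gt0 : 0 < 5 * theta / (8 * L). Proof. by rewrite divr_gt0// mulr_gt0. Qed.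

Let sum_dir_le : (\sum_(t < T.+1) MSe t <= (\sum_(t < T.+1) error_mean t)%:E)%E.
Proof. by rewrite -sumEFin; apply: lee_sum => t _; apply: direction_error_le_mean; rewrite -ltnS. Qed.

Lemma grad_finite t : (t <= T)%N -> (\int[Pr]_w (G2 t w)%:E < +oo)%E.
Proof.
move=> tT; have a0 := ltW aG_gt0; have ia0 : 0 <= (theta / (16 * L))^-1 by rewrite invr_ge0.
have := @integral_le_affine T.+1 (fun w => G2 t w) (fun k w => e2 k w)
  ((theta / (16 * L))^-1 * (5 * theta / (8 * L))) ((theta / (16 * L))^-1 * D0).
move=> /(_ (mulr_ge0 ia0 (ltW ce_gt0)) (mulr_ge0 ia0 D0_ge0) (mG tT) (fun w => sqr_ge0 _) me (fun k w => sqr_ge0 _)) H.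
apply: (le_lt_trans (H _)).
  have divide (a c y u e : R) : 0 < a -> a * u <= y + c * e -> u <= a^-1 * y + a^-1 * c * e.
    by move=> a_gt0; rewrite -mulrA -mulrDr ler_pdivlMl.
  move=> w; apply: (divide _ _ _ _ _ aG_gt0); apply: le_trans (descent_sum w).
  apply: (@le_trans _ _ (theta / (16 * L) * \sum_(k < T.+1) G2 k w)).
    apply: ler_wpM2l => //; rewrite (bigD1 (Ordinal (tT : (t < T.+1)%N)))//= lerDl.
    by apply: sumr_ge0 => i _; exact: sqr_ge0.
  by rewrite lerDl mulr_ge0 ?(ltW br_gt0)// sumr_ge0// => i _; exact: sqr_ge0.
apply: (@le_lt_trans _ _ (((theta / (16 * L))^-1 * D0)%:E +
   ((theta / (16 * L))^-1 * (5 * theta / (8 * L)))%:E * (\sum_(t < T.+1) error_mean t)%:E)%E).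
  apply: leeD => //; apply: lee_wpmul2l => //; rewrite lee_fin; exact: mulr_ge0 ia0 (ltW ce_gt0).
by rewrite -EFinM -EFinD ltry.
Qed.

Lemma grad_meanE t : (t <= T)%N -> (\int[Pr]_w (G2 t w)%:E = (grad_mean t)%:E)%E.
Proof.
by move=> tT; apply: fineE; [apply: integral_ge0 => w _; rewrite lee_fin sqr_ge0|exact: grad_finite].
Qed.

Lemma mean_descent :
  theta / (16 * L) * \sum_(t < T.+1) grad_mean t + L * theta / 2 * \sum_(t < T.+1) step_mean t
    <= Psi x0 - fine (Psi0_star D F K psi Reg) + 5 * theta / (8 * L) * \sum_(t < T.+1) error_mean t.
Proof.
have G0 t w : 0 <= G2 t w by exact: sqr_ge0.
have r0 t w : 0 <= r2 t w by exact: sqr_ge0.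
have e0 t w : 0 <= e2 t w by exact: sqr_ge0.
have mLHS : measurable_fun [set: Om] (fun w => theta / (16 * L) * (\sum_(t < T.+1) G2 t w)
    + L * theta / 2 * (\sum_(t < T.+1) r2 t w)).
  by apply: measurable_funD; apply: measurable_funM => //; apply: measurable_sum => i; [exact: mG|exact: mr].
have LHS0 w : 0 <= theta / (16 * L) * (\sum_(t < T.+1) G2 t w) + L * theta / 2 * (\sum_(t < T.+1) r2 t w).
  by apply: addr_ge0; apply: mulr_ge0; rewrite ?(ltW aG_gt0) ?(ltW br_gt0)// sumr_ge0.
have := @integral_le_affine T.+1 _ (fun t w => e2 t w) _ _ (ltW ce_gt0) D0_ge0 mLHS LHS0 me e0 descent_sum.
rewrite (integral_affine_sums (f := fun t w => G2 t w) (g := fun t w => r2 t w) (ltW aG_gt0) (ltW br_gt0) mG G0 mr r0).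
have -> : (\sum_(t < T.+1) \int[Pr]_w (G2 t w)%:E = (\sum_(t < T.+1) grad_mean t)%:E)%E.
  by rewrite -sumEFin; apply: eq_bigr => t _; apply: grad_meanE; rewrite -ltnS.
have -> : (\sum_(t < T.+1) \int[Pr]_w (r2 t w)%:E = (\sum_(t < T.+1) step_mean t)%:E)%E.
  rewrite -sumEFin; apply: eq_bigr => t _; apply: fineE; first exact: mean_square_ge0.
  by apply: step_square_finite; rewrite -ltnS.
move=> H; rewrite -lee_fin; apply: (le_trans H).
rewrite [leRHS]EFinD [X in (_ <= _ + X)%E]EFinM leeD2l//; apply: lee_wpmul2l; last exact: sum_dir_le.
by rewrite lee_fin ltW.
Qed.

(** Splits the expectation over the values of the output index. *)
Lemma output_expectation (tau : Om -> nat) : uniform_output_index Pr S T tau ->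
  (\int[Pr]_w (frob (grad_mapping D F K psi Reg eta (x (tau w) w)) ^+ 2)%:E =
    (T.+1%:R^-1 * \sum_(t < T.+1) grad_mean t)%:E)%E.
Proof.
move=> [mtau tauT Ptau itau].
have mGP (t : 'I_T.+1) : @measurable_mx _ _ (Past T.+1) _ _ (fun w => grad_mapping D F K psi Reg eta (x t w)).
  have tT : (t <= T)%N by rewrite -ltnS.
  have [_ _ _ _ m] := measurable_direction tT; exact: measurable_mx_past (leqW tT) m.
have fiber (t : 'I_T.+1) : (\int[Pr]_(w in tau @^-1` [set (t : nat)]) (G2 t w)%:E
    = (T.+1%:R^-1)%:E * (grad_mean t)%:E)%E.
  have tT : (t <= T)%N by rewrite -ltnS.
  rewrite -grad_meanE// -(Ptau t tT).
  apply: (@indep_integral_fiber _ _ _ Pr _ tau (fun w => G2 t w) t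
    (past_measurable (leqnn _)) mtau itau) => [|w]; last exact: sqr_ge0.
  exact: measurable_sqr_frob (mGP t).
rewrite mulr_sumr -sumEFin.
rewrite (eq_bigr (fun t : 'I_T.+1 => \int[Pr]_w (((fun w => (G2 t w)%:E) \_ (tau @^-1` [set (t : nat)])) w))%E); last first.
  by move=> t _; rewrite EFinM -fiber [LHS]integral_mkcond.
rewrite -ge0_integral_sum//.
- apply: eq_integral => w _; have wT : (tau w < T.+1)%N by rewrite ltnS.
  rewrite (bigD1 (Ordinal wT))//= patchE mem_set// big1 ?adde0//.
  move=> i iw; rewrite patchE memNset//= => tw; move/negP: iw; apply.
  by apply/eqP/val_inj.
- move=> t; apply/(measurable_restrictT _ _).1.
    by rewrite -[_ @^-1` _]setTI; exact: mtau.
  apply: measurable_funTS; apply/measurable_EFinP; exact: mG.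
- by move=> t w _; rewrite patchE; case: ifP => // _; rewrite lee_fin sqr_ge0.
Qed.

(** The rate in terms of [theta] and [alpha = 1 - beta], for every choice of the
    parameters that satisfies the two balance equations. *)
Lemma output_gradient_bound (tau : Om -> nat) (alpha : R) : uniform_output_index Pr S T tau ->
  0 < alpha <= 1 -> beta = 1 - alpha ->
  P ^+ 2 * theta ^+ 2 = L ^+ 2 * hb1%:R * alpha -> alpha ^+ 2 * (T.+1%:R * hb0%:R) = hb1%:R ->
  (\int[Pr]_w (frob (grad_mapping D F K psi Reg eta (x (tau w) w)) ^+ 2)%:E <=
    (16 * (L / (theta * T.+1%:R)) * (Psi x0 - fine (Psi0_star D F K psi Reg))
       + 24 * Q / (hb0%:R * alpha * T.+1%:R))%:E)%E.
Proof.
move=> htau /andP[al0 al1] betaE Pth alN; rewrite output_expectation// lee_fin.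
have k1 : 0 <= kappa Pr S T :> R by exact: le_trans ler01 kappa_ge1.
have k2 : 0 <= hkappa Pr S T :> R by exact: le_trans ler01 hkappa_ge1.
have Q0 : 0 <= Q.
  apply: mulr_ge0; first by apply: mulr_ge0; rewrite ?sqr_ge0// divr_ge0// mulr_ge0// ltW.
  apply: addr_ge0; first exact: mulr_ge0 (mulr_ge0 (mulr_ge0 k1 (sqr_ge0 _)) (sqr_ge0 _)) (sqr_ge0 _).
  exact: mulr_ge0 (mulr_ge0 (mulr_ge0 (ltW c0_gt0) k2) (sqr_ge0 _)) (sqr_ge0 _).
have A0 : 0 <= 9 / 13 * (P ^+ 2 * theta ^+ 2 / hb1%:R).
  by rewrite mulr_ge0// divr_ge0// mulr_ge0// sqr_ge0.
apply: (mean_gradient_bound (T := T%:R) L0 theta0 al0 hb0R hb1R _ _ Q0 _ Pth alN _ mean_descent).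
- by rewrite ltr0n.
- by apply: sumr_ge0 => t _; exact: step_mean_ge0.
- by rewrite ler_nat; exact: leqnSn.
apply: averaged_recursion => //.
- by rewrite (ltW al0).
- by move=> t; exact: error_mean_ge0.
- by move=> t; exact: step_mean_ge0.
- exact: error_mean_init.
move=> t tT; apply: (le_trans (error_mean_step tT)); rewrite betaE.
have -> : 1 - (1 - alpha) = alpha by ring.
rewrite lerD2r lerD2l; apply: ler_wpM2r; first exact: step_mean_ge0.
by rewrite ler_piMr// expr2 mulr_ile1//; lra.
Qed.

End totals.

End run.

(** * The parameter schedule and the complexity counts *)

Section arithmetic_of_rates.
Context {R : realType}.

Lemma powR_root (z : R) (m : nat) : 0 <= z -> (0 < m)%N -> (z ^+ m) `^ (m%:R^-1) = z.
Proof.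
move=> z0 m0; rewrite -powR_mulrn// -powRrM mulfV ?powRr1// pnatr_eq0 -lt0n//.
Qed.

Lemma powR_fracE (y : R) (k m : nat) : 0 <= y -> (y `^ (m%:R^-1)) ^+ k = y `^ (k%:R / m%:R).
Proof. by move=> y0; rewrite -powR_mulrn ?powR_ge0// -powRrM mulrC. Qed.

(** With [u] and [v] the twelfth roots of [N] and [b], and [k] the square root of
    [c1], all powers in the schedule are monomials in [u], [v] and [k], and the
    identities below become rational. Here [N] stands for [T + 1]. *)
Section schedule.
Variables (L P c1 : R) (b hb0 N : nat).
Hypotheses (L0 : 0 < L) (P0 : 0 < P) (c10 : 0 < c1) (b0 : (0 < b)%N) (N0 : (0 < N)%N)
  (hb0E : hb0%:R = c1 ^+ 2 * (b * N)%:R `^ (1 / 3) :> R).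
Let v : R := b%:R `^ (12%:R^-1).
Let u : R := N%:R `^ (12%:R^-1).
Let k : R := Num.sqrt c1.
Let v0 : 0 < v. Proof. by rewrite powR_gt0// ltr0n. Qed.
Let u0 : 0 < u. Proof. by rewrite powR_gt0// ltr0n. Qed.
Let k0 : 0 < k. Proof. by rewrite sqrtr_gt0. Qed.
Let k2 : k ^+ 2 = c1. Proof. by rewrite sqr_sqrtr// ltW. Qed.

Let bv (j : nat) (e : R) : e = j%:R / 12%:R -> b%:R `^ e = v ^+ j.
Proof. by move=> ->; rewrite powR_fracE. Qed.
Let uN (j : nat) (e : R) : e = j%:R / 12%:R -> N%:R `^ e = u ^+ j.
Proof. by move=> ->; rewrite powR_fracE. Qed.
Let b12 : b%:R = v ^+ 12. Proof. by rewrite -(bv (e := 1)) ?powRr1//; field. Qed.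
Let N12 : N%:R = u ^+ 12. Proof. by rewrite -(uN (e := 1)) ?powRr1//; field. Qed.

Let bN j (e : R) : e = j%:R / 12%:R -> (b * N)%:R `^ e = (u * v) ^+ j.
Proof. by move=> ee; rewrite natrM powRM// (bv ee) (uN ee) exprMn mulrC. Qed.

Let hb0uv : hb0%:R = c1 ^+ 2 * (u * v) ^+ 4.
Proof. by rewrite hb0E (bN (j := 4))//; field. Qed.

Let m2 : (hb0 * N)%:R `^ (1 / 2) = c1 * u ^+ 8 * v ^+ 2.
Proof.
have -> : (hb0 * N)%:R = (c1 * u ^+ 8 * v ^+ 2) ^+ 2 by rewrite natrM hb0uv N12; ring.
by rewrite div1r powR_root// mulr_ge0// ?mulr_ge0 ?exprn_ge0// ltW.
Qed.

Let m4 : (hb0 * N)%:R `^ (1 / 4) = k * u ^+ 4 * v.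
Proof.
have -> : (hb0 * N)%:R = (k * u ^+ 4 * v) ^+ 4 by rewrite natrM hb0uv N12 -k2; ring.
by rewrite div1r powR_root// mulr_ge0// ?mulr_ge0 ?exprn_ge0// ltW.
Qed.

Let theta := L * b%:R `^ (3 / 4) / (P * (hb0 * N)%:R `^ (1 / 4)).
Let alpha : R := b%:R `^ (1 / 2) / (hb0 * N)%:R `^ (1 / 2).

Let thetaE : theta = L * v ^+ 8 / (P * k * u ^+ 4).
Proof.
rewrite /theta m4 (bv (j := 9)); last by field.
by field; rewrite !gt_eqF.
Qed.

Let alphaE : alpha = v ^+ 4 / (c1 * u ^+ 8).
Proof.
rewrite /alpha m2 (bv (j := 6)); last by field.
by field; rewrite !gt_eqF.
Qed.

Lemma theta_gt0 : 0 < theta.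
Proof. by rewrite thetaE divr_gt0// ?mulr_gt0// exprn_gt0. Qed.

Lemma alpha_gt0 : 0 < alpha.
Proof. by rewrite alphaE divr_gt0// ?mulr_gt0// exprn_gt0. Qed.

Lemma alpha_le1 : (b <= hb0 * N)%N -> alpha <= 1.
Proof.
rewrite -(ler_nat R) => bm; rewrite /alpha ler_pdivrMr ?mul1r; last first.
  by rewrite -div1r m2 !mulr_gt0// exprn_gt0.
by apply: ge0_ler_powR; rewrite ?nnegrE//; lra.
Qed.

Lemma theta_lt1 : L ^+ 4 / P ^+ 4 < (hb0 * N)%:R / b%:R ^+ 3 -> theta < 1.
Proof.
have -> : (hb0 * N)%:R / b%:R ^+ 3 = (k * u ^+ 4 / v ^+ 8) ^+ 4.
  by rewrite natrM hb0uv N12 b12 -k2; field; rewrite gt_eqF.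
have -> : L ^+ 4 / P ^+ 4 = (L / P) ^+ 4 by field; rewrite gt_eqF.
have q0 : 0 <= k * u ^+ 4 / v ^+ 8 by rewrite ltW// divr_gt0// ?mulr_gt0// exprn_gt0.
rewrite ltr_pXn2r// ?nnegrE ?divr_ge0 ?ltW// => h.
rewrite thetaE ltr_pdivrMr; last by rewrite !mulr_gt0// exprn_gt0.
rewrite ltr_pdivrMr// in h; rewrite mul1r.
have := h; rewrite -(ltr_pM2r (_ : 0 < v ^+ 8)) ?exprn_gt0// => /lt_le_trans; apply.
by rewrite le_eqVlt; apply/orP; left; apply/eqP; field; rewrite gt_eqF.
Qed.

Lemma sqr_P_theta : P ^+ 2 * theta ^+ 2 = L ^+ 2 * b%:R * alpha.
Proof. by rewrite thetaE alphaE b12 -k2; field; rewrite !gt_eqF. Qed.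

Lemma sqr_alpha : alpha ^+ 2 * (N%:R * hb0%:R) = b%:R.
Proof. by rewrite alphaE hb0uv N12 b12; field; rewrite !gt_eqF. Qed.

Lemma step_rate : L / (theta * N%:R) = P * Num.sqrt c1 / (b * N)%:R `^ (2 / 3).
Proof.
rewrite (bN (j := 8)); last by field.
by rewrite -/k thetaE N12; field; rewrite !gt_eqF.
Qed.

Lemma variance_rate : hb0%:R * alpha * N%:R = c1 * (b * N)%:R `^ (2 / 3).
Proof.
rewrite (bN (j := 8)); last by field.
by rewrite alphaE hb0uv N12; field; rewrite !gt_eqF.
Qed.

End schedule.

(** With [w] the cube root of [b (T + 1)] and [delta] the square root of [Delta],
    the rate is [(delta / w)^2], the initial batch is a multiple of [w], and the
    bound on [T] compares [w^3] with [(delta / eps)^3]. *)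
Section complexity.
Variables (c1 Delta : R) (b T hb0 : nat).
Hypotheses (b0 : (0 < b)%N) (Delta0 : 0 <= Delta)
  (hb0E : hb0%:R = c1 ^+ 2 * (b * T.+1)%:R `^ (1 / 3) :> R).
Let w : R := (b * T.+1)%:R `^ 3^-1.
Let delta : R := Delta `^ 2^-1.
Let v : R := b%:R `^ 3^-1.
Let bR : 0 < b%:R :> R. Proof. by rewrite ltr0n. Qed.
Let w0 : 0 < w. Proof. by rewrite powR_gt0// ltr0n muln_gt0 b0. Qed.
Let w3 : w ^+ 3 = b%:R * T.+1%:R.
Proof. by rewrite /w powR_fracE// mulfV// powRr1// natrM. Qed.
Let w2 : (b * T.+1)%:R `^ (2 / 3) = w ^+ 2. Proof. by rewrite /w powR_fracE. Qed.
Let v3 : v ^+ 3 = b%:R. Proof. by rewrite /v powR_fracE// mulfV// powRr1. Qed.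
Let v0 : 0 <= v. Proof. exact: powR_ge0. Qed.
Let delta0 : 0 <= delta. Proof. exact: powR_ge0. Qed.
Let delta3 : Delta `^ (3 / 2) = delta ^+ 3. Proof. by rewrite /delta powR_fracE. Qed.
Let delta2 : Delta = delta ^+ 2. Proof. by rewrite /delta powR_fracE// mulfV// powRr1. Qed.
Let hb0w : hb0%:R = c1 ^+ 2 * w. Proof. by rewrite hb0E /w div1r. Qed.

Variable eps : R.
Hypothesis eps0 : 0 < eps.
Let Tbound : R := Delta `^ (3 / 2) / (b%:R * eps ^+ 3).

Let le_cube (x y : R) : 0 <= x -> 0 <= y -> (x ^+ 3 <= y ^+ 3) = (x <= y).
Proof. by move=> x0 y0; rewrite ler_pXn2r// nnegrE. Qed.

Lemma accuracy_reached : Tbound <= T.+1%:R -> Delta / (b * T.+1)%:R `^ (2 / 3) <= eps ^+ 2.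
Proof.
rewrite /Tbound delta3 ler_pdivrMr ?mulr_gt0 ?exprn_gt0// => h.
rewrite w2 delta2 ler_pdivrMr ?exprn_gt0// -exprMn.
have : delta <= eps * w.
  have epsw0 : 0 <= eps * w by rewrite mulr_ge0// ltW.
  rewrite -(le_cube delta0 epsw0) exprMn w3; apply: (le_trans h).
  by rewrite le_eqVlt; apply/orP; left; apply/eqP; ring.
by rewrite ler_sqr// nnegrE mulr_ge0 ?ltW.
Qed.

Lemma run_length : T.+1%:R <= Tbound -> w <= delta / eps /\ b%:R * T%:R <= Delta `^ (3 / 2) / eps ^+ 3.
Proof.
rewrite /Tbound delta3 ler_pdivlMr ?mulr_gt0 ?exprn_gt0// => h; split.
  have weps0 : 0 <= w * eps by rewrite mulr_ge0// ltW.
  rewrite ler_pdivlMr// -(le_cube weps0 delta0) exprMn w3.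
  by apply: le_trans h; rewrite le_eqVlt; apply/orP; left; apply/eqP; ring.
rewrite ler_pdivlMr ?exprn_gt0//; apply: le_trans h; rewrite -natr1.
have : 0 <= b%:R * eps ^+ 3 by rewrite mulr_ge0 ?exprn_ge0 ?ltW.
have -> : b%:R * T%:R * eps ^+ 3 = T%:R * (b%:R * eps ^+ 3) by ring.
by rewrite mulrDl mul1r lerDl.
Qed.

(** When only [T], and not [T + 1], is below the bound, the cube root is
    subadditive: [b (T + 1) = b T + b]. *)
Lemma run_length_floor : T%:R <= Tbound ->
  w <= delta / eps + v /\ b%:R * T%:R <= Delta `^ (3 / 2) / eps ^+ 3.
Proof.
rewrite /Tbound delta3 ler_pdivlMr ?mulr_gt0 ?exprn_gt0// => h.
have h' : b%:R * T%:R <= delta ^+ 3 / eps ^+ 3.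
  rewrite ler_pdivlMr ?exprn_gt0//; apply: le_trans h.
  by rewrite le_eqVlt; apply/orP; left; apply/eqP; ring.
split => //; have q0 : 0 <= delta / eps by rewrite divr_ge0// ltW.
rewrite -le_cube ?addr_ge0// ?(ltW w0)// w3 -natr1 mulrDr mulr1.
apply: (@le_trans _ _ ((delta / eps) ^+ 3 + v ^+ 3)); first by rewrite v3 lerD2r expr_div_n.
have -> : (delta / eps + v) ^+ 3 = (delta / eps) ^+ 3 + v ^+ 3 + 3 * ((delta / eps) ^+ 2 * v + (delta / eps) * v ^+ 2).
  by ring.
by rewrite lerDl mulr_ge0// addr_ge0// mulr_ge0// exprn_ge0.
Qed.

Lemma evaluations_natr (m0 m1 m2 : nat) (c : R) : m0%:R = c * hb0%:R :> R -> m1%:R = c * b%:R :> R ->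
  m2%:R = c * b%:R :> R ->
  (evaluations m0 m1 m2 T)%:R = c * (c1 ^+ 2 * w) + c * (3 * (b%:R * T%:R)) :> R.
Proof.
move=> e0 e1 e2; rewrite /evaluations sum_nat_const_nat subn1/= natrD natrM natrD natrM e0 e1 e2 hb0w.
by ring.
Qed.

Lemma evaluations_le (m0 m1 m2 : nat) (c e : R) : 0 <= c -> m0%:R = c * hb0%:R :> R ->
  m1%:R = c * b%:R :> R -> m2%:R = c * b%:R :> R -> w <= delta / eps + e ->
  b%:R * T%:R <= Delta `^ (3 / 2) / eps ^+ 3 ->
  ((evaluations m0 m1 m2 T)%:Z <= Num.floor (c * (c1 ^+ 2 * Delta `^ (1 / 2) / eps + c1 ^+ 2 * e)
      + c * (3 * Delta `^ (3 / 2) / eps ^+ 3)))%R.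
Proof.
move=> c0' e0 e1 e2 hw hT; rewrite floor_ge_int -[(_)%:~R]/((evaluations m0 m1 m2 T)%:R).
rewrite (evaluations_natr e0 e1 e2); apply: lerD; apply: ler_wpM2l => //.
  rewrite div1r -/delta -mulrA -mulrDr; apply: ler_wpM2l => //; exact: sqr_ge0.
by rewrite -mulrA; apply: ler_wpM2l.
Qed.

End complexity.
End arithmetic_of_rates.

(** * Convergence rate and complexity *)

Theorem theorem3p1
  (R : realType) (d d' : measure_display)
  (Xi : measurableType d) (Om : measurableType d')
  (D : probability Xi R) (Pr : probability Om R)
  (p q n : nat) (F : 'cV[R]_p -> Xi -> 'cV[R]_q) (K : 'M[R]_(q, n))
  (psi : 'cV[R]_n -> \bar R) (Reg : 'cV[R]_p -> \bar R)
  (LF sigmaF sigmaJ MF Mpsi : R)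
  (hpsi : proper_closed_convex psi) (hReg : proper_closed_convex Reg)
  (hF : stochastic_smooth_map D F)
  (hreg : regularity D F K psi Reg LF sigmaF sigmaJ MF Mpsi)
  (hinf : (-oo < Psi0_star D F K psi Reg)%E)
  (hmu : strongly_convex_fun 1 psi)
  (c0 c1 : R) (hc0 : 0 < c0) (hc1 : 0 < c1)
  (T b b0 hb0 b1 hb1 b2 hb2 : nat)
  (hb : (0 < b <= hb0 * T.+1)%N)
  (hb0E : hb0%:R = c1 ^+ 2 * (b * T.+1)%:R `^ (1 / 3) :> R)
  (b0E : b0%:R = c0 * hb0%:R :> R)
  (hb1E : hb1 = b) (hb2E : hb2 = b)
  (b1E : b1%:R = c0 * b%:R :> R) (b2E : b2%:R = c0 * b%:R :> R)
  (S : minibatches Om Xi b0 hb0 b1 hb1 b2 hb2)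
  (hS : sampling_scheme D Pr S T)
  (x0 : 'cV[R]_p) (hx0 : edom (Psi0 D F K psi Reg) x0)
  (x : nat -> Om -> 'cV[R]_p) (Ft : nat -> Om -> 'cV[R]_q)
  (Jt : nat -> Om -> 'M[R]_(q, p))
  (tau : Om -> nat) (htau : uniform_output_index Pr S T tau) :
  let normK := spectral_norm K in
  let P := const_P normK c0 (kappa Pr S T) (hkappa Pr S T) LF MF Mpsi in
  let Q := const_Q normK c0 (kappa Pr S T) (hkappa Pr S T)
             sigmaF sigmaJ MF Mpsi in
  let L := const_L normK LF MF Mpsi in
  let beta := 1 - b%:R `^ (1 / 2) / (hb0 * T.+1)%:R `^ (1 / 2) in
  let theta := L * b%:R `^ (3 / 4) / (P * (hb0 * T.+1)%:R `^ (1 / 4)) in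
  let eta := 2 / (L * (3 + theta)) in
  let Delta0 :=
    16 * P * Num.sqrt c1 *
      (fine (Psi0 D F K psi Reg x0) - fine (Psi0_star D F K psi Reg))
    + 24 * Q / c1 in
  let err := ('E_Pr[fun w =>
    (frob (grad_mapping D F K psi Reg eta (x (tau w) w)) ^+ 2)%R])%E in
  L ^+ 4 / P ^+ 4 < (hb0 * T.+1)%:R / b%:R ^+ 3 ->
  generated_by_algorithm S F K psi Reg T x0
    (fun=> beta) (fun=> beta) (fun=> theta) (fun=> eta) x Ft Jt ->
  (err <= (Delta0 / (b * T.+1)%:R `^ (2 / 3))%:E)%E
  /\
  forall eps : R, 0 < eps ->
    let Tbound := Delta0 `^ (3 / 2) / (b%:R * eps ^+ 3) in
    let main_cost := 3 * Delta0 `^ (3 / 2) / eps ^+ 3 in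
    let init_cost := c1 ^+ 2 * Delta0 `^ (1 / 2) / eps in
    let evalsF := evaluations b0 b1 b2 T in
    let evalsJ := evaluations hb0 hb1 hb2 T in
    [/\ (* accuracy eps is reached by every run that is long enough *)
        Tbound <= T.+1%:R -> (err <= (eps ^+ 2)%:E)%E,
        (* costs of the runs with at most Tbound iterations *)
        T.+1%:R <= Tbound ->
          [/\ (T%:Z <= Num.floor Tbound)%R,
              (evalsF%:Z <= Num.floor (c0 * init_cost + c0 * main_cost))%R
            & (evalsJ%:Z <= Num.floor (init_cost + main_cost))%R]
      & (* the run with T = floor Tbound; T + 1 may then exceed Tbound, which
           adds c1 ^ 2 * b ^ (1/3) to the bound on the initial batch size *)
        T%:Z = Num.floor Tbound ->
          [/\ (err <= (eps ^+ 2)%:E)%E,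
              (evalsF%:Z <= Num.floor
                (c0 * (init_cost + c1 ^+ 2 * b%:R `^ (1 / 3))
                   + c0 * main_cost))%R
            & (evalsJ%:Z <= Num.floor
                (init_cost + c1 ^+ 2 * b%:R `^ (1 / 3) + main_cost))%R]].
Proof.
move=> normK P Q L beta theta eta Delta0 err hcond galg.
have [b_gt0 bm] := andP hb.
have hb0_gt0 : (0 < hb0)%N by move: (leq_trans b_gt0 bm); rewrite muln_gt0 => /andP[].
have pos_nat (k m : nat) : k%:R = c0 * m%:R :> R -> (0 < m)%N -> (0 < k)%N.
  by move=> kE m0; rewrite -(ltr_nat R) kE mulr_gt0// ltr0n.
have b0_gt0 := pos_nat _ _ b0E hb0_gt0.
have b1_gt0 := pos_nat _ _ b1E b_gt0.
have b2_gt0 := pos_nat _ _ b2E b_gt0.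
have [LF0 sF0 sJ0 MF0 Mpsi0] := constants_gt0 hreg.
have normK0 : 0 <= normK by exact: spectral_norm_ge0.
have kap1 := kappa_ge1 Pr S (T := T); have hkap1 := hkappa_ge1 Pr S (T := T).
have kap0 : 0 <= kappa Pr S T :> R by exact: le_trans ler01 kap1.
have hkap0 : 0 <= hkappa Pr S T :> R by exact: le_trans ler01 hkap1.
have P0 : 0 <= P.
  apply: mulr_ge0; last exact: sqrtr_ge0.
  by apply: divr_ge0; apply: mulr_ge0; rewrite ?sqrtr_ge0.
have Q0 : 0 <= Q.
  apply: mulr_ge0; first by apply: mulr_ge0; rewrite ?sqr_ge0// divr_ge0// mulr_ge0// ltW.
  apply: addr_ge0; first exact: mulr_ge0 (mulr_ge0 (mulr_ge0 kap0 (sqr_ge0 _)) (sqr_ge0 _)) (sqr_ge0 _).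
  exact: mulr_ge0 (mulr_ge0 (mulr_ge0 (ltW hc0) hkap0) (sqr_ge0 _)) (sqr_ge0 _).
have Delta0_ge0 : 0 <= Delta0.
  apply: addr_ge0; last by apply: divr_ge0; [exact: mulr_ge0|exact: ltW].
  apply: mulr_ge0; last by rewrite subr_ge0; exact: Psi_ge_star.
  by apply: mulr_ge0; [exact: mulr_ge0|exact: sqrtr_ge0].
have rate : (err <= (Delta0 / (b * T.+1)%:R `^ (2 / 3))%:E)%E.
  have rhs0 : 0 <= Delta0 / (b * T.+1)%:R `^ (2 / 3) by rewrite divr_ge0// powR_ge0.
  (* If [K = 0] then [L = 0], and division by zero makes [eta] and [eta^-1] zero. *)
  move: normK0; rewrite le_eqVlt => /predU1P[K0|K_gt0].
    have L0 : L = 0 by rewrite /L /const_L -K0 expr0n/= !mulr0 addr0.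
    have eta0 : eta = 0 by rewrite /eta L0 mul0r invr0 mulr0.
    have -> : err = 0%E.
      rewrite /err unlock -[RHS](integral0 Pr [set: Om]); apply: eq_integral => w _.
      by rewrite /grad_mapping eta0 invr0 scale0r frob0 expr0n.
    by rewrite lee_fin.
  have L_gt0 : 0 < L by rewrite addr_gt0// !mulr_gt0// exprn_gt0.
  have P_gt0 : 0 < P.
    apply: mulr_gt0.
      by apply: divr_gt0; rewrite mulr_gt0 ?sqrtr_gt0// ltr0n.
    rewrite sqrtr_gt0 ltr_wpDr//.
      exact: mulr_ge0 (mulr_ge0 (mulr_ge0 (ltW hc0) hkap0) (sqr_ge0 _)) (sqr_ge0 _).
    by rewrite !mulr_gt0// ?exprn_gt0//; exact: lt_le_trans ltr01 kap1.
  have hb0T : hb0%:R = c1 ^+ 2 * (b * T.+1)%:R `^ (1 / 3) :> R := hb0E.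
  pose alpha : R := b%:R `^ (1 / 2) / (hb0 * T.+1)%:R `^ (1 / 2).
  have theta_pos : 0 < theta by exact: theta_gt0 L_gt0 P_gt0 hc1 b_gt0 (ltn0Sn T) hb0T.
  have theta_small : theta < 1 by exact: theta_lt1 L_gt0 P_gt0 hc1 b_gt0 (ltn0Sn T) hb0T hcond.
  have al0 : 0 < alpha by exact: alpha_gt0 hc1 b_gt0 (ltn0Sn T) hb0T.
  have al1 : alpha <= 1 by exact: alpha_le1 hc1 b_gt0 (ltn0Sn T) hb0T bm.
  have betaE : beta = 1 - alpha by [].
  subst hb1 hb2.
  have bound := @output_gradient_bound _ _ _ _ _ D Pr _ _ _ F K psi Reg LF sigmaF sigmaJ MF Mpsi
    hpsi hReg hF hreg hinf hmu T b0 hb0 b1 b b2 b S hS b0_gt0 hb0_gt0 b1_gt0 b_gt0 b2_gt0 b_gt0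
    x0 x Ft Jt beta theta hx0 L_gt0 theta_pos theta_small galg c0 hc0 b0E b1E b2E erefl tau alpha htau.
  rewrite /err unlock; apply: (le_trans (bound _ betaE _ _)).
  - by rewrite al0.
  - exact: sqr_P_theta _ P_gt0 hc1 b_gt0 (ltn0Sn T) hb0T.
  - exact: sqr_alpha hc1 b_gt0 (ltn0Sn T) hb0T.
  rewrite (step_rate L_gt0 P_gt0 hc1 b_gt0 (ltn0Sn T) hb0T).
  rewrite (variance_rate hc1 b_gt0 (ltn0Sn T) hb0T).
  rewrite lee_fin le_eqVlt; apply/orP; left; apply/eqP; rewrite /Delta0.
  have : 0 < (b * T.+1)%:R `^ (2 / 3) :> R by rewrite powR_gt0// ltr0n muln_gt0 b_gt0.
  move: ((b * T.+1)%:R `^ (2 / 3)) => Y Y0; rewrite /Q /P /normK.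
  by field; rewrite !gt_eqF.
split=> // eps eps0 Tbound main_cost init_cost evalsF evalsJ.
have floorT : T%:Z = Num.floor Tbound -> T%:R <= Tbound.
  by move=> TE; have := floor_le Tbound; rewrite -TE.
have hb1R : hb1%:R = 1 * b%:R :> R by rewrite hb1E mul1r.
have hb2R : hb2%:R = 1 * b%:R :> R by rewrite hb2E mul1r.
have hb0R : hb0%:R = 1 * hb0%:R :> R by rewrite mul1r.
have acc : Tbound <= T.+1%:R -> (err <= (eps ^+ 2)%:E)%E.
  move=> TN; apply: (le_trans rate); rewrite lee_fin.
  exact: (accuracy_reached b_gt0 Delta0_ge0 eps0 TN).
split => // [TN|TE].
  have [w1 w2] := run_length b_gt0 Delta0_ge0 eps0 TN.
  have w1' : (b * T.+1)%:R `^ 3^-1 <= Delta0 `^ 2^-1 / eps + 0 by rewrite addr0.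
  split.
  - by rewrite floor_ge_int; apply: le_trans TN; rewrite ler_nat leqnSn.
  - have := evaluations_le hb0E (ltW hc0) b0E b1E b2E w1' w2.
    by rewrite mulr0 addr0.
  - have := evaluations_le hb0E ler01 hb0R hb1R hb2R w1' w2.
    by rewrite mulr0 addr0 /init_cost /main_cost !mul1r.
have [w1 w2] := run_length_floor b_gt0 Delta0_ge0 eps0 (floorT TE).
split.
- apply: acc; have := floor_itv Tbound; rewrite -TE => /andP[_ /ltW].
  by rewrite intrD natr1.
- have := evaluations_le hb0E (ltW hc0) b0E b1E b2E w1 w2.
  by rewrite /init_cost /main_cost !div1r.
- have := evaluations_le hb0E ler01 hb0R hb1R hb2R w1 w2.
  by rewrite /init_cost /main_cost !mul1r.
Qed.
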